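(* Let $T>0$. Let $g\colon\mathbb{R}^{+}\to\mathbb{R}^{+}$ be a continuous function with $g(0)=0$ and $g(s)>0$ for $s>0$. Let $a\in L^{1}([0,T])$ satisfy: (i) there exist $m\ge1$ closed and pairwise disjoint intervals $I_1,\dots,I_m\subseteq[0,T]$ such that, for $i=1,\dots,m$, $a(x)\ge0$ for a.e. $x\in I_i$ with $a\not\equiv0$ on $I_i$, and $a(x)\le0$ for a.e. $x\in[0,T]\setminus\bigcup_{i=1}^{m}I_i$; (ii) $\int_{0}^{T}a(x)\,dx<0$. For $i=1,\dots,m$ let $\lambda_1^i$ be the first eigenvalue of $\varphi''+\lambda a(x)\varphi=0$, $\varphi|_{\partial I_i}=0$. Suppose that \[ \lim_{s\to0^{+}}\frac{g(s)}{s}=0\quad\text{and}\quad\liminf_{s\to+\infty}\frac{g(s)}{s}>\max_{i=1,\dots,m}\lambda_1^i, \] and that $g$ is continuously differentiable on a right neighborhood $[0,\varepsilon_0)$ of $s=0$. Then the problem \[ u''+a(x)g(u)=0\ \text{ on }(0,T),\qquad\mathscr{B}(u,u')=\underline{0}, \] has at least one positive solution, where $\mathscr{B}(u,u')=\underline{0}$ denotes either of the two boundary conditions (Neumann or periodic) described in the context.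
   Context: $\mathbb{R}^{+}=[0,+\infty)$. The boundary operator is either $\mathscr{B}(u,u')=(u'(0),u'(T))$ (Neumann) or $\mathscr{B}(u,u')=(u(T)-u(0),u'(T)-u'(0))$ (periodic); the statement holds for each of the two choices. A solution is a continuously differentiable function $u\colon[0,T]\to\mathbb{R}$ with $u'$ absolutely continuous, satisfying the equation for a.e. $x\in[0,T]$ and the boundary condition. A positive solution is a solution with $u(x)>0$ for every $x\in[0,T]$. ''$a\not\equiv0$ on $I_i$'' means that $a$ is not a.e. zero on $I_i$. The $\liminf$ may be $+\infty$. *)

(* Defs.v *)
From HB Require Import structures.
From mathcomp Require Import all_boot all_order all_algebra.
From mathcomp Require Import all_classical all_reals all_analysis.

Set Implicit Arguments.
Unset Strict Implicit.
Unset Printing Implicit Defensive.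

Import Order.TTheory GRing.Theory Num.Theory.
Import numFieldNormedType.Exports.

Local Open Scope classical_set_scope.
Local Open Scope ring_scope.

Section Calculus.
Context {R : realType}.
Implicit Types (D : set R) (f u : R -> R) (x c d : R).

(* Difference quotients only use points of D, so that the derivative is the
   one-sided one at an endpoint of an interval D and the values of f outside D
   are irrelevant. *)
Definition diff_quotient f x : R -> R := fun y => (f y - f x) / (y - x).

Definition derivable_within D f x : Prop :=
  cvg (diff_quotient f x y @[y --> within D x^']).

Definition derive_within D f x : R :=
  lim (diff_quotient f x y @[y --> within D x^']).

Definition continuously_differentiable_on D f : Prop :=
  (forall x, D x -> derivable_within D f x) /\
  {within D, continuous (derive_within D f)}.

Definition absolutely_continuous_on c d f : Prop :=
  forall e : R, 0 < e -> exists2 delta : R, 0 < delta &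
    forall (n : nat) (s t : 'I_n -> R),
      (forall i, [/\ c <= s i, s i <= t i & t i <= d]) ->
      trivIset setT (fun i => `]s i, t i[%classic) ->
      \sum_(i < n) (t i - s i) < delta ->
      \sum_(i < n) `|f (t i) - f (s i)| < e.

(* u is a solution of u'' + F(x, u) = 0 on [c, d] in the Caratheodory sense. *)
Definition ode_solution (F : R -> R -> R) c d u : Prop :=
  let u' := derive_within `[c, d] u in
  [/\ continuously_differentiable_on `[c, d] u,
      absolutely_continuous_on c d u'
    & {ae lebesgue_measure, forall x, x \in `[c, d] ->
        derivable u' x 1 /\ derive1 u' x + F x (u x) = 0}].

End Calculus.

Section DirichletEigenvalue.
Context {R : realType}.
Variables (a : R -> R) (c d : R).

Definition dirichlet_eigenvalue (lam : R) : Prop :=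
  exists phi : R -> R,
    [/\ ode_solution (fun x y => lam * a x * y) c d phi,
        phi c = 0, phi d = 0
      & exists2 x, x \in `[c, d] & phi x != 0].

Definition first_dirichlet_eigenvalue (lam : R) : Prop :=
  dirichlet_eigenvalue lam /\
  forall mu : R, dirichlet_eigenvalue mu -> lam <= mu.

End DirichletEigenvalue.

Inductive boundary_condition : Set := Neumann | Periodic.

Definition boundary_operator {R : realType} (B : boundary_condition) (T : R)
    (u u' : R -> R) : R * R :=
  match B with
  | Neumann => (u' 0, u' T)
  | Periodic => (u T - u 0, u' T - u' 0)
  end.

(* u'' + a(x) g(u) = 0, B(u, u') = 0, u > 0 on [0, T].  Since u > 0, only the
   values of g on [0, +oo) enter. *)
Definition positive_solution {R : realType} (B : boundary_condition) (T : R)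
    (a g u : R -> R) : Prop :=
  [/\ ode_solution (fun x y => a x * g y) 0 T u,
      boundary_operator B T u (derive_within `[0, T] u) = (0, 0)
    & forall x, x \in `[0, T] -> 0 < u x].

(* Main.v *)
Require Import Defs.
From mathcomp Require Import all_boot all_order all_algebra.
From mathcomp Require Import all_classical all_reals all_analysis.
From mathcomp Require Import measurable_realfun.
From mathcomp Require Import ring lra zify.

Set Implicit Arguments.
Unset Strict Implicit.
Unset Printing Implicit Defensive.

Import Order.TTheory GRing.Theory Num.Theory.
Import numFieldNormedType.Exports.

Local Open Scope classical_set_scope.
Local Open Scope ring_scope.

(* Shooting instead of coincidence degree. Beyond the a priori bound g is
   replaced by a linear function, and by 0 on the negative half-line, so that a
   solution which has become nonpositive with negative slope stays nonpositive.
   The initial value problem is discretised by an Euler scheme, whose end point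
   is a continuous function of the initial data (s, p) although g need not be
   Lipschitz, and an exact solution is recovered as an ultrafilter limit of
   discrete ones.

   On an interval I_i a nonnegative solution is concave; comparing it with a
   nodal domain of the eigenfunction (Wronskian identity) bounds it there by a
   constant depending only on a lower bound g(s) >= k s - K with
   k > lambda_1^i. Hence the initial data of nonnegative solutions are bounded,
   and, as solutions are convex off the intervals I_i, so are the solutions of
   the boundary value problems.

   Neumann: on p = 0 the final slope is positive for s small, because
   int a < 0 and g(u) is nearly constant (g is C^1 at 0 with g'(0) = 0), and
   negative for s large; apply the intermediate value theorem.
   Periodic: on a rectangle [r, S] x [r - P, r + P] of initial data,
   A = u(T) - s is negative on three sides; on the side s = r it is positive at
   p = r, its zeros below have B = u'(T) - p > 0 and those above have B < 0.
   Sperner's parity argument on a grid then yields a common zero of A and B. *)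

(** Without uniqueness for the initial value problem there is no exact shooting map, so the
    topological arguments are run on the scheme at a fixed mesh. Facts about exact solutions reach
    all sufficiently fine meshes by contradiction: violating data on finer and finer meshes would
    yield, along an ultrafilter, an exact solution that violates them. Conversely the discrete zeros
    so found tend to an exact solution, nontrivial because u(0) >= r is kept. The uniqueness that
    remains is that for zero data, from |g(s)| <= C |s|. It is carried along as a two-sided Gronwall
    estimate and serves twice: it makes nonnegative solutions positive, and it transports a bound at
    the midpoint of one I_i back to time 0. The truncation level M has to exceed the a priori bound
    of the truncated problem itself. This is not circular, because g is continued along a line of
    slope g(M)/M >= k, so that k s - K stays a lower bound with K independent of M. *)

(** * Integrals with variable endpoints *)

Section Primitive.
Context {R : realType}.
Implicit Types (f h w : R -> R) (x y z t : R).

Local Notation mu := (@lebesgue_measure R).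

Definition summable f := mu.-integrable setT (EFin \o f).

(** A difference of integrals over half-lines, so that Chasles' relation holds for endpoints in any
    order and without integrability. *)
Definition integ f x y : R :=
  \int[mu]_(t in `]-oo, y]) f t - \int[mu]_(t in `]-oo, x]) f t.

Lemma integ_chasles f x y z : integ f x z = integ f x y + integ f y z.
Proof. by rewrite /integ; ring. Qed.

Lemma integxx f x : integ f x x = 0.
Proof. by rewrite /integ subrr. Qed.

Lemma summableS f (A : set R) : measurable A -> summable f ->
  mu.-integrable A (EFin \o f).
Proof. by move=> mA; apply: integrableS. Qed.

Lemma integE f x y : summable f -> x <= y ->
  integ f x y = \int[mu]_(t in `]x, y]) f t.
Proof.
move=> sf xy; rewrite /integ Rintegral_itvB ?bnd_simp//.
exact: summableS.
Qed.

Lemma integ_itvcc f x y : summable f -> x <= y ->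
  integ f x y = \int[mu]_(t in `[x, y]) f t.
Proof.
by move=> sf xy; rewrite integE// Rintegral_itv_obnd_cbnd//; exact: summableS.
Qed.

Lemma summable_norm f : summable f -> summable (fun t => `|f t|).
Proof. exact: integrable_norm. Qed.

Lemma summableD f h : summable f -> summable h -> summable (fun t => f t + h t).
Proof.
move=> sf sh; have := integrableD measurableT sf sh.
by apply: eq_integrable.
Qed.

Lemma summableZ c f : summable f -> summable (fun t => c * f t).
Proof.
move=> sf; have := integrableZl measurableT c sf.
by apply: eq_integrable.
Qed.

Lemma integD f h x y : summable f -> summable h -> x <= y ->
  integ (fun t => f t + h t) x y = integ f x y + integ h x y.
Proof.
move=> sf sh xy; rewrite !integE//; last exact: summableD.
by rewrite RintegralD//; apply: summableS.
Qed.

Lemma integZ c f x y : summable f -> x <= y ->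
  integ (fun t => c * f t) x y = c * integ f x y.
Proof.
move=> sf xy; rewrite !integE//; last exact: summableZ.
by rewrite RintegralZl//; apply: summableS.
Qed.

Lemma eq_integ f h x y : summable f -> summable h -> x <= y ->
  (forall t, x <= t <= y -> f t = h t) -> integ f x y = integ h x y.
Proof.
move=> sf sh xy e; rewrite !integE//; apply: eq_Rintegral => t.
by rewrite inE/= in_itv/= => /andP[xt ty]; apply: e; rewrite (ltW xt).
Qed.

Lemma le_integ f h x y : summable f -> summable h -> x <= y ->
  (forall t, x <= t <= y -> f t <= h t) -> integ f x y <= integ h x y.
Proof.
move=> sf sh xy e; rewrite !integE//; apply: le_Rintegral => //.
- exact: summableS.
- exact: summableS.
- by move=> t; rewrite /= in_itv/= => /andP[xt ty]; apply: e; rewrite (ltW xt).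
Qed.

Lemma integ_ge0 f x y : summable f -> x <= y ->
  (forall t, x <= t <= y -> 0 <= f t) -> 0 <= integ f x y.
Proof.
move=> sf xy e; rewrite integE//; apply: Rintegral_ge0 => t.
by rewrite /= in_itv/= => /andP[xt ty]; apply: e; rewrite (ltW xt).
Qed.

Lemma integ_norm_ge0 f x y : summable f -> x <= y ->
  0 <= integ (fun t => `|f t|) x y.
Proof. by move=> sf xy; apply: integ_ge0 => //; exact: summable_norm. Qed.

Lemma ler_norm_integ f x y : summable f -> x <= y ->
  `|integ f x y| <= integ (fun t => `|f t|) x y.
Proof.
move=> sf xy; rewrite !integE//; last exact: summable_norm.
by apply: le_normr_Rintegral => //; exact: summableS.
Qed.

Lemma integ_norm_mono f x y z t : summable f -> x <= y -> y <= z -> z <= t ->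
  integ (fun t => `|f t|) y z <= integ (fun t => `|f t|) x t.
Proof.
move=> sf xy yz zt.
rewrite (integ_chasles _ x y) (integ_chasles _ y z t).
have := integ_norm_ge0 sf xy; have := integ_norm_ge0 sf zt; lra.
Qed.

Lemma integ_mono f x y z t : summable f -> x <= y -> y <= z -> z <= t ->
  (forall u, x <= u <= t -> 0 <= f u) -> integ f y z <= integ f x t.
Proof.
move=> sf xy yz zt f0.
rewrite (integ_chasles _ x y) (integ_chasles _ y z t).
have : 0 <= integ f x y.
  apply: integ_ge0 => // u /andP[? ?]; apply: f0; lra.
have : 0 <= integ f z t.
  apply: integ_ge0 => // u /andP[? ?]; apply: f0; lra.
lra.
Qed.

(** The integrals over the intervals add up to one integral over the union, whose measure is the sum
    of the lengths; the union is taken over open intervals, since only these are assumed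
    disjoint. *)
Lemma summable_abs_cont f : summable f -> forall e : R, 0 < e ->
  exists2 d : R, 0 < d & forall (n : nat) (s t : 'I_n -> R),
    (forall i, s i <= t i) ->
    trivIset setT (fun i => `]s i, t i[%classic) ->
    \sum_(i < n) (t i - s i) < d ->
    \sum_(i < n) integ (fun t => `|f t|) (s i) (t i) < e.
Proof.
move=> sf e e0; have [d [d0 dP]] := integral_normr_continuous sf e0.
exists d => // n s t st tI sd.
pose U := \big[setU/set0]_(i < n) `]s i, t i[%classic.
have mU : measurable U by exact: bigsetU_measurable.
have muU : mu U = (\sum_(i < n) (t i - s i))%:E.
  rewrite [LHS](@measure_semi_additive_ord _ _ _ mu)// -sumEFin.
  apply: eq_bigr => i _.
  by rewrite [LHS]lebesgue_measure_itv/= lte_fin; case: ltP => // ?; congr EFin;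
    have := st i; lra.
have Ud : (mu U < d%:E)%E by rewrite muU lte_fin.
have := dP _ mU Ud; apply: le_lt_trans; rewrite le_eqVlt; apply/orP; left; apply/eqP.
rewrite /Rintegral ge0_integral_bigsetU//=; last 3 first.
- exact: index_enum_uniq.
- exact: sub_trivIset tI.
- have /measurable_int := summableS mU (summable_norm sf).
  by [].
rewrite -[LHS]/(fine (_%:E)) -sumEFin; congr fine.
apply: eq_bigr => i _.
rewrite integ_itvcc//; last exact: summable_norm.
rewrite -Rintegral_itv_obnd_cbnd; last exact/summableS/summable_norm.
rewrite -Rintegral_itv_bndo_bndc; last exact/summableS/summable_norm.
rewrite /Rintegral fineK//.
apply: integrable_fin_num => //.
exact: (summableS _ (summable_norm sf)).
Qed.

Lemma integ_small f : summable f -> forall e : R, 0 < e ->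
  exists2 d : R, 0 < d & forall x y, x <= y -> y - x < d ->
    integ (fun t => `|f t|) x y < e.
Proof.
move=> sf e e0; have [d d0 dP] := summable_abs_cont sf e0.
exists d => // x y xy xyd; have := dP 1%N (fun=> x) (fun=> y).
rewrite !big_ord1; apply => // i j _ _ _.
by rewrite (ord1 i) (ord1 j).
Qed.

Lemma summable_derive f : summable f ->
  {ae mu, forall x, derivable (integ f 0) x 1 /\ derive1 (integ f 0) x = f x}.
Proof.
move=> sf; have := @FTC1Ny R f (fun y => summableS (measurable_itv `]-oo, y]) sf).
have lf : locally_integrable [set: R] f.
  by apply: open_integrable_locally => //; exact: openT.
move/(_ lf) => /=; apply: filterS.
  exact: (ae_filter_ringOfSetsType mu).
move=> x [dx ex].
set F := (fun y : R => _) in dx ex *.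
have e : integ f 0 = F \+ cst (- F 0) by [].
have dc : derivable (cst (- F 0) : R -> R) x 1 by exact: derivable_cst.
rewrite e; split; first exact: (derivableD dx dc).
by rewrite derive1E (deriveD dx dc) derive_cst addr0 -derive1E.
Qed.

(** A continuous w is bounded only on compact sets, hence the requirement that f vanish off
    [0, T]. *)
Lemma summableM f w T : summable f -> (forall t, ~~ (0 <= t <= T) -> f t = 0) ->
  continuous w -> summable (fun t => f t * w t).
Proof.
move=> sf f0 cw.
have [T0|T0] := ltP T 0.
  have -> : (fun t => f t * w t) = f.
    apply/funext => t; rewrite f0 ?mul0r//; apply/negP => /andP[]; lra.
  by [].
have cw' : {within `[0, T], continuous w} by exact: continuous_subspaceT.
have [c _ cP] := @EVT_max R (fun t => `|w t|) 0 T T0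
  (continuous_subspaceT (fun t => continuous_comp (cw t) (@norm_continuous _ _ _))).
apply: (@le_integrable _ _ _ mu _ _ _ (EFin \o (fun t => `|w c| * f t))) => //.
- apply/measurable_EFinP; apply: measurable_funM.
    by have /measurable_int/measurable_EFinP := sf.
  exact: continuous_measurable_fun.
- move=> t _ /=; rewrite lee_fin !normrM normr_id mulrC.
  have [tI|tI] := boolP (0 <= t <= T).
    by rewrite ler_wpM2r//; apply: cP; rewrite in_itv.
  by rewrite f0// normr0 !mulr0.
- exact: summableZ.
Qed.

End Primitive.

(** * Cousin's lemma; absolutely continuous functions with zero derivative *)

Section AbsolutelyContinuousConstant.
Context {R : realType}.
Implicit Types (c d x y z t : R) (Q : R -> R -> Prop) (F : R -> R).

Local Notation mu := (@lebesgue_measure R).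

(** Compactness of [c, d] as an induction on intervals: the supremum of the y with [Q c y] is
    attained and cannot lie below d. This spares the handling of tagged partitions in all later
    local-to-global arguments. *)
Lemma cousin c d Q : c <= d ->
  (forall x y z, c <= x -> x <= y -> y <= z -> z <= d ->
    Q x y -> Q y z -> Q x z) ->
  (forall z, c <= z <= d -> exists2 r : R, 0 < r & forall x y,
    c <= x -> x <= z -> z <= y -> y <= d -> z - r < x -> y < z + r -> Q x y) ->
  Q c d.
Proof.
move=> cd Qadd Qloc; pose S := [set y | c <= y <= d /\ Q c y].
have Sc : S c.
  split; first by rewrite lexx.
  have [|r r0 rP] := Qloc c; first by rewrite lexx.
  by apply: rP; lra.
have ubS : ubound S d by move=> y [/andP[]].
have hS : has_sup S by split; [exists c|exists d].
have cs : c <= sup S by apply: ub_le_sup => //; exists d.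
have sd : sup S <= d by apply: ge_sup => //; exists c.
have [|r r0 rP] := Qloc (sup S); first by rewrite cs.
have [y [/andP[cy yd] Qcy] ry] := sup_adherent r0 hS.
have ys : y <= sup S by apply: ub_le_sup; [exists d|split=> //; rewrite cy].
(* A point to the right of [sup S] unless [sup S] is d; half of r, because the local hypothesis asks
   for a strict inequality. *)
pose m := Num.min d (sup S + r / 2).
have sm : sup S <= m by rewrite le_min sd/=; lra.
have md : m <= d by rewrite ge_min lexx.
have mr : m <= sup S + r / 2 by rewrite ge_min lexx orbT.
have Sm : S m.
  split; first by rewrite md (le_trans cs).
  apply: (Qadd c y m) => //; first exact: le_trans sm.
  by apply: rP => //; lra.
have ms : m <= sup S by apply: ub_le_sup => //; exists d.
have : m = d.
  by move: ms; rewrite /m; case: (leP d (sup S + r / 2)) => // _; lra.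
by move=> <-; case: Sm.
Qed.

(* Consecutive intervals [s_1, t_1], [s_2, t_2], ... listed from left to right
   in [x, y]. *)
Fixpoint chain x (l : seq (R * R)) y : Prop :=
  if l is (s, t) :: l' then [/\ x <= s, s <= t & chain t l' y] else x <= y.

Lemma chain_le x l y : chain x l y -> x <= y.
Proof.
elim: l x => [//|[s t] l IH] x /= [xs st /IH ty].
exact: le_trans (le_trans xs st) ty.
Qed.

Lemma chain_cat x y z l l' : chain x l y -> chain y l' z -> chain x (l ++ l') z.
Proof.
elim: l x => [|[s t] l IH] x /=.
  by case: l' => [|[s t] l] /= xy; [exact: le_trans|case=> ys st h; split=> //;
    exact: le_trans ys].
by move=> [xs st h] h'; split=> //; exact: IH.
Qed.

Lemma chain_nth x l y i : chain x l y -> (i < size l)%N ->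
  let p := nth (0, 0) l i in [/\ x <= p.1, p.1 <= p.2 & p.2 <= y].
Proof.
elim: l x i => [//|[s t] l IH] x [|i] /= [xs st h].
  by split=> //; exact: chain_le h.
move=> il; have [h1 h2 h3] := IH _ _ h il; split=> //.
by apply: le_trans h1; exact: le_trans st.
Qed.

Lemma chain_nth_lt x l y i j : chain x l y -> (i < j)%N -> (j < size l)%N ->
  (nth (0, 0) l i).2 <= (nth (0, 0) l j).1.
Proof.
elim: l x i j => [//|[s t] l IH] x [|i] [|j] //= [xs st h] ij jl.
  by have [] := chain_nth h jl.
exact: (IH _ _ _ h).
Qed.

(** Cousin's lemma takes the place of a Vitali covering. Around a point off the null set N the
    increment is at most e times the length; around a point of N an interval inside an open U of
    small measure is used, and absolute continuity bounds the sum of the increments over all of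
    these. *)
Lemma ac_ae_derive0 c d F : c <= d -> absolutely_continuous_on c d F ->
  {ae mu, forall x, x \in `[c, d] -> derivable F x 1 /\ derive1 F x = 0} ->
  F d = F c.
Proof.
move=> cd acF [N [mN muN NP]].
suff H : forall e : R, 0 < e -> `|F d - F c| <= e * (d - c) + e.
  apply/eqP; rewrite -subr_eq0 -normr_eq0 -[_ == 0]negbK; apply/negP => n0.
  have Fp : 0 < `|F d - F c| by rewrite lt_def n0 normr_ge0.
  have := H (`|F d - F c| / (2 * (d - c + 1))).
  have dc1 : 0 < d - c + 1 by lra.
  rewrite divr_gt0//; last by lra.
  move/(_ isT); set D := `|_|.
  have -> : D / (2 * (d - c + 1)) * (d - c) + D / (2 * (d - c + 1)) = D / 2.
    by field; apply/eqP; lra.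
  by have := Fp; rewrite -/D; lra.
move=> e e0; have [dl dl0 acP] := acF _ e0.
have muNy : (mu N < +oo)%E by rewrite muN.
have [U [oU NU muU]] := lebesgue_regularity_outer mN muNy dl0.
have mU : measurable U by exact: open_measurable.
have muUd : (mu U < dl%:E)%E.
  have muN0 : mu N = 0%E by exact: muN.
  have -> : mu U = (mu N + mu (U `\` N))%E.
    rewrite -{1}(setDUK NU) [LHS]measureU//; first exact: measurableD.
    by rewrite setDIK.
  by rewrite muN0 add0e.
(* The intervals around exceptional points are recorded in a list, since absolute continuity has to
   be applied to all of them at once. *)
pose Q x y := exists l : seq (R * R), [/\ chain x l y,
  forall i, (i < size l)%N ->
    `](nth (0, 0) l i).1, (nth (0, 0) l i).2[ `<=` U &
  `|F y - F x| <= e * (y - x) + \sum_(p <- l) `|F p.2 - F p.1| ].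
have : Q c d.
  apply: cousin => //.
  - move=> x y z cx xy yz zd [l [l1 l2 l3]] [l' [l1' l2' l3']].
    exists (l ++ l'); split; first exact: chain_cat l1'.
    + move=> i; rewrite size_cat nth_cat; case: (ltnP i (size l)) => il ill; first exact: l2.
      by apply: l2'; rewrite ltn_subLR.
    + rewrite big_cat/=.
      have -> : F z - F x = (F z - F y) + (F y - F x) by ring.
      have := ler_normD (F z - F y) (F y - F x); lra.
  - move=> z zcd; have [zN|zN] := pselect (N z).
      have := oU z (NU _ zN) => /nbhs_ballP[r /= r0 rP].
      exists r => // x y cx xz zy yd rx yr.
      exists [:: (x, y)]; split => /=; [by split=> //; lra| |].
        move=> [|//] _ /= t /=; rewrite in_itv/= => /andP[xt ty].
        by apply: rP; rewrite /ball/= ltr_norml; apply/andP; split; lra.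
      rewrite big_seq1/= lerDr mulr_ge0//; lra.
    have [dF F0] : derivable F z 1 /\ derive1 F z = 0.
      have := contra_not (NP z) zN; rewrite /= => /contrapT; apply.
      by rewrite in_itv.
    have : h^-1 * (F (h + z) - F z) @[h --> 0^'] --> (0 : R).
      have l0 : lim (h^-1 *: ((F \o shift z) (h *: 1) - F z) @[h --> 0^']) = 0.
        by rewrite -[RHS]F0 derive1E.
      have := dF; rewrite /derivable l0; apply: cvg_trans; apply: near_eq_cvg.
      by near=> h; rewrite /= {1}/GRing.scale/= [_ *: 1]mulr1.
    move=> /cvgrPdist_le/(_ _ e0) [r /= r0 rP].
    have key w : `|w - z| < r -> `|F w - F z| <= e * `|w - z|.
      move=> wr; have [->|wz] := eqVneq w z; first by rewrite !subrr normr0 mulr0.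
      have wz0 : w - z != 0 by rewrite subr_eq0.
      have := rP (w - z); rewrite /= sub0r normrN => /(_ wr wz0).
      rewrite sub0r normrN subrK normrM normfV mulrC ler_pdivrMr//.
      by rewrite normr_gt0.
    exists r => // x y cx xz zy yd rx yr; exists [::]; split => //=.
      exact: le_trans zy.
    rewrite big_nil addr0.
    have -> : F y - F x = (F y - F z) - (F x - F z) by ring.
    have := ler_normB (F y - F z) (F x - F z).
    have := key y; have := key x.
    rewrite (ger0_norm (_ : 0 <= y - z)); last lra.
    rewrite (ler0_norm (_ : x - z <= 0)); last lra.
    have h1 : - (x - z) < r by lra.
    have h2 : y - z < r by lra.
    move=> /(_ h1) k1 /(_ h2) k2 k3; nra.
case=> l [l1 l2 l3]; apply: (le_trans l3); rewrite lerD2l.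
apply: ltW; rewrite (big_nth (0, 0)) big_mkord.
pose s (i : 'I_(size l)) := (nth (0, 0) l i).1.
pose t (i : 'I_(size l)) := (nth (0, 0) l i).2.
have st i : [/\ c <= s i, s i <= t i & t i <= d].
  exact: (chain_nth l1 (ltn_ord i)).
have tI : trivIset setT (fun i => `]s i, t i[%classic).
  have lt_disj (i j : 'I_(size l)) x : (i < j)%N -> x < t i -> s j < x -> False.
    move=> ij xt sx; have := chain_nth_lt l1 ij (ltn_ord _).
    by rewrite -/(t _) -/(s _); lra.
  apply/trivIsetP => i j _ _ /eqP ij.
  apply/seteqP; split => // x [] /=.
  rewrite !in_itv/= => /andP[six xti] /andP[sjx xtj].
  have : (i < j)%N \/ (j < i)%N by apply/orP; rewrite -neq_ltn; apply/eqP => /val_inj.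
  by case=> /lt_disj; [move/(_ _ xti sjx)|move/(_ _ xtj six)].
apply: (acP _ s t) => //.
rewrite -lte_fin; apply: le_lt_trans muUd.
have mV : measurable (\big[setU/set0]_(i < size l) `]s i, t i[%classic).
  exact: bigsetU_measurable.
have -> : (\sum_(i < size l) (t i - s i))%:E =
  mu (\big[setU/set0]_(i < size l) `]s i, t i[%classic).
  rewrite [RHS](@measure_semi_additive_ord _ _ _ mu)// -sumEFin.
  apply: eq_bigr => i _.
  rewrite [RHS]lebesgue_measure_itv/= lte_fin; case: ltP => // ?; congr EFin.
  by have [] := st i; lra.
apply: le_measure; rewrite ?inE//.
by elim/big_ind: _ => [//|A B AU BU x [/AU|/BU]//|i _]; exact: l2.
Unshelve. all: by end_near. Qed.

End AbsolutelyContinuousConstant.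

(** * Limits of real sequences along an ultrafilter *)

Section UltrafilterLimits.
Context {R : realType}.
Implicit Types (u : nat -> R) (l c : R).

Lemma flim_le (F : set_system nat) {FF : ProperFilter F} u l c :
  u @ F --> l -> (\forall n \near F, u n <= c) -> l <= c.
Proof. by move=> ul uc; apply: (closed_cvg (fun x => x <= c) (@closed_le _ c) uc). Qed.

Lemma flim_ge (F : set_system nat) {FF : ProperFilter F} u l c :
  u @ F --> l -> (\forall n \near F, c <= u n) -> c <= l.
Proof. by move=> ul uc; apply: (closed_cvg (fun x => c <= x) (@closed_ge _ c) uc). Qed.

Lemma ultra_oo : exists U : set_system nat, UltraFilter U /\ \oo `<=` U.
Proof. exact: ultraFilterLemma. Qed.

Lemma ultra_fmap {T : Type} (U : set_system nat) (u : nat -> T) :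
  UltraFilter U -> UltraFilter (u @ U).
Proof.
move=> UU; split=> [|G GF sG]; first exact: fmap_proper_filter.
apply/seteqP; split => // A GA.
have [//|UA] := in_ultra_setVsetC (u @^-1` A) UU.
have /sG GC : (u @ U) (~` A) by exact: UA.
have : G set0 by rewrite -(setICr A); exact: filterI.
by move/(@filter_not_empty _ _ GF).
Qed.

(** One ultrafilter makes all bounded sequences converge simultaneously; it replaces the extraction
    of subsequences and equicontinuity arguments. *)
Lemma ultra_cvg (U : set_system nat) (UU : UltraFilter U) u (a b : R) :
  (forall n, a <= u n <= b) -> exists2 l, a <= l <= b & u @ U --> l.
Proof.
move=> ub; have := @segment_compact R a b; rewrite compact_ultra.
move=> /(_ (u @ U) (ultra_fmap u UU)); case.
  by apply: (@filterE _ U) => n; rewrite /= in_itv/=; exact: ub.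
by move=> l [/=]; rewrite in_itv/= => lab ul; exists l.
Qed.

Lemma oo_cvg_ultra (U : set_system nat) u l :
  \oo `<=` U -> u @ \oo --> l -> u @ U --> l.
Proof. by move=> oU ul A /ul; exact: oU. Qed.

End UltrafilterLimits.

(** * Sperner's parity argument on a rectangular grid *)

Section GridSperner.

Definition edge01 (k l : nat) : bool :=
  [|| (k == 0) && (l == 1) | (k == 1) && (l == 0)]%N.

(** Here the 01-edges are exactly the changes between zero and nonzero labels, so their parity only
    compares the two ends. *)
Lemma edge01_left (L : nat -> nat) j : L 0%N = 0%N ->
  (forall i, (i < j)%N -> (L i == 0%N) (+) (L i.+1 == 0%N) ->
     edge01 (L i) (L i.+1)) ->
  \big[addb/false]_(i < j) edge01 (L i) (L i.+1) = (L j != 0%N).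
Proof.
move=> L0; elim: j => [|j IH] H; first by rewrite big_ord0 L0.
rewrite big_ord_recr/= IH => [|i ij]; last by apply: H; rewrite ltnS ltnW.
have := H j (ltnSn j); rewrite /edge01.
by case: (L j) (L j.+1) => [|[|?]] [|[|?]] //= h; have := h isT.
Qed.

Definition trichromatic (k1 k2 k3 k4 : nat) : Prop :=
  forall k, (k < 3)%N -> k \in [:: k1; k2; k3; k4].

(** If label 2 is missing, the 01-edges are the label changes along a closed cycle, an even number;
    if 0 or 1 is missing there are none. *)
Lemma edge01_cycle k1 k2 k3 k4 : (k1 < 3)%N -> (k2 < 3)%N -> (k3 < 3)%N ->
  (k4 < 3)%N ->
  edge01 k1 k2 (+) edge01 k2 k3 (+) edge01 k3 k4 (+) edge01 k4 k1 ->
  trichromatic k1 k2 k3 k4.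
Proof.
by move: k1 k2 k3 k4 => [|[|[|?]]] [|[|[|?]]] [|[|[|?]]] [|[|[|?]]] //= _ _ _ _ _;
  move=> [|[|[|?]]].
Qed.

(* A cell which misses one of the labels has an even number of 01-edges, so
   without trichromatic cells the parity of the number of 01-edges on the line
   i = const does not depend on i; it is odd for i = 0 and even for i = n. *)
Lemma grid_sperner (L : nat -> nat -> nat) (n m j0 : nat) :
  (j0 <= m)%N -> (forall i j, L i j < 3)%N ->
  (forall j, (j <= m)%N -> L n j = 0%N) ->
  (forall i, (i <= n)%N -> L i 0%N = 0%N) ->
  (forall i, (i <= n)%N -> L i m = 0%N) ->
  L 0%N j0 != 0%N ->
  (forall j, (j < j0)%N -> (L 0 j == 0) (+) (L 0 j.+1 == 0) ->
     edge01 (L 0 j) (L 0 j.+1))%N ->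
  (forall j, (j0 <= j < m)%N -> ~~ edge01 (L 0 j) (L 0 j.+1))%N ->
  exists i j, [/\ (i < n)%N, (j < m)%N &
    trichromatic (L i j) (L i.+1 j) (L i.+1 j.+1) (L i j.+1)].
Proof.
move=> j0m L3 Ln Lb Lt Lj0 Hlow Hup; apply: contrapT => notri.
pose V i := \big[addb/false]_(j < m) edge01 (L i j) (L i j.+1).
pose cell i j := edge01 (L i j) (L i.+1 j) (+) edge01 (L i.+1 j) (L i.+1 j.+1)
  (+) edge01 (L i.+1 j.+1) (L i j.+1) (+) edge01 (L i j.+1) (L i j).
have edgeC k l : edge01 k l = edge01 l k.
  by rewrite /edge01 orbC andbC; congr (_ || _); rewrite andbC.
have cell0 i j : (i < n)%N -> (j < m)%N -> cell i j = false.
  move=> i_n jm; apply/negbTE/negP => c; apply: notri; exists i, j; split=> //.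
  exact: edge01_cycle.
have VS i : (i < n)%N -> V i.+1 = V i.
  move=> i_n.
  (* Cells are added one by one in the strip between the lines i and i + 1; up to height k the two
     counts differ by the rung at height k. *)
  have E k : (k <= m)%N ->
      \big[addb/false]_(j < k) edge01 (L i.+1 j) (L i.+1 j.+1) =
      \big[addb/false]_(j < k) edge01 (L i j) (L i j.+1)
        (+) edge01 (L i k) (L i.+1 k).
    elim: k => [|k IH] km; first by rewrite !big_ord0 (Lb i) ?(Lb i.+1)// ltnW.
    rewrite !big_ord_recr/= IH; last exact: ltnW.
    have := cell0 _ _ i_n km; rewrite /cell (edgeC (L i k.+1) (L i k)).
    rewrite (edgeC (L i.+1 k.+1) (L i k.+1)).
    set b := \big[_/_]_(j < k) _.
    move: b (edge01 (L i k) _) (edge01 (L i k) _) (edge01 (L i.+1 k) _)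
      (edge01 (L i k.+1) _) => [] [] [] [] [] //=.
  rewrite /V E// (Lt i) ?(Lt i.+1)//; last exact: ltnW.
  by rewrite addbF.
have Vn : V n = false.
  by rewrite /V big1// => j _; rewrite !Ln// ltnW.
have V0 : V 0%N = false.
  have H k : (k <= n)%N -> V k = V 0%N.
    by elim: k => // k IH kn; rewrite VS// IH// ltnW.
  by rewrite -(H n)// Vn.
move: V0; rewrite /V -(big_mkord xpredT (fun j => edge01 (L 0%N j) (L 0%N j.+1))).
rewrite (big_cat_nat (n := j0))//= big_mkord edge01_left ?Lb// Lj0.
rewrite big_nat_cond big1// => j; rewrite andbT => /Hup.
by move/negbTE.
Qed.

End GridSperner.

(** * Common zero of two functions on a rectangle *)

Section PlanarZero.
Context {R : realType}.

(* The boundary behaviour forces the zero set of A to join the two parts of the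
   left side, on which B has opposite signs. *)
Lemma planar_zero (A B : R * R -> R) (x0 x1 ym P : R) :
  x0 < x1 -> 0 < P -> continuous A -> continuous B ->
  (forall y, ym - P <= y <= ym + P -> A (x1, y) < 0) ->
  (forall x, x0 <= x <= x1 -> A (x, ym - P) < 0) ->
  (forall x, x0 <= x <= x1 -> A (x, ym + P) < 0) ->
  0 < A (x0, ym) ->
  (forall y, ym - P <= y <= ym -> A (x0, y) = 0 -> 0 < B (x0, y)) ->
  (forall y, ym <= y <= ym + P -> A (x0, y) = 0 -> B (x0, y) < 0) ->
  exists p, [/\ x0 <= p.1 <= x1, ym - P <= p.2 <= ym + P, A p = 0 & B p = 0].
Proof.
move=> x01 P0 cA cB Ar Ab At Am Blow Bup.
pose h K : R := (K.+1%:R)^-1.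
have h0 K : 0 < h K by rewrite invr_gt0 ltr0n.
have hK K : K.+1%:R * h K = 1 by rewrite mulfV// pnatr_eq0.
pose X K i : R := x0 + (x1 - x0) * (i%:R * h K).
(* There will be twice as many rows as columns, so that row [K.+1] has height exactly [ym], where
   the left side splits into its two parts. *)
pose Y K j : R := ym - P + P * (j%:R * h K).
have Xb K i : (i <= K.+1)%N -> x0 <= X K i <= x1.
  move=> iK; have i0 : 0 <= i%:R * h K by rewrite mulr_ge0// ltW.
  have i1 : i%:R * h K <= 1 by rewrite -[leRHS](hK K) ler_pM2r// ler_nat.
  by rewrite /X; apply/andP; split; nra.
have Yb K j : (j <= K.+1 + K.+1)%N -> ym - P <= Y K j <= ym + P.
  move=> jK; have j_0 : 0 <= j%:R * h K by rewrite mulr_ge0// ltW.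
  have j1 : j%:R * h K <= 2.
    have -> : 2 = (K.+1 + K.+1)%:R * h K by rewrite natrD mulrDl hK.
    by rewrite ler_pM2r// ler_nat.
  by rewrite /Y; apply/andP; split; nra.
have Ylow K j : (j <= K.+1)%N -> Y K j <= ym.
  move=> jK; have j1 : j%:R * h K <= 1 by rewrite -[leRHS](hK K) ler_pM2r// ler_nat.
  by rewrite /Y; nra.
have Yup K j : (K.+1 <= j)%N -> ym <= Y K j.
  move=> jK; have j1 : 1 <= j%:R * h K by rewrite -[leLHS](hK K) ler_pM2r// ler_nat.
  by rewrite /Y; nra.
have X0 K : X K 0%N = x0 by rewrite /X mul0r mulr0 addr0.
have XK K : X K K.+1 = x1 by rewrite /X hK mulr1 addrC subrK.
have Y0 K : Y K 0%N = ym - P by rewrite /Y mul0r mulr0 addr0.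
have YM K : Y K K.+1 = ym by rewrite /Y hK mulr1 subrK.
have YK K : Y K (K.+1 + K.+1)%N = ym + P.
  by rewrite /Y natrD mulrDl hK mulrDr mulr1 addrA subrK.
have XS K i : X K i.+1 - X K i = (x1 - x0) * h K.
  by rewrite /X -[i.+1]addn1 natrD; ring.
have YS K j : Y K j.+1 - Y K j = P * h K.
  by rewrite /Y -[j.+1]addn1 natrD; ring.
pose D := x1 - x0 + P.
pose near_pts K (p q : R * R) := `|p.1 - q.1| <= D * h K /\ `|p.2 - q.2| <= D * h K.
have nearXY K i i' j j' : (i' == i) || (i' == i.+1) || (i == i'.+1) ->
    (j' == j) || (j' == j.+1) || (j == j'.+1) ->
    near_pts K (X K i, Y K j) (X K i', Y K j').
  have DX : 0 <= (x1 - x0) * h K <= D * h K.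
    by have := h0 K; rewrite /D => ?; apply/andP; split; nra.
  have DY : 0 <= P * h K <= D * h K.
    by have := h0 K; rewrite /D => ?; apply/andP; split; nra.
  move=> Hi Hj; split => /=.
    move: Hi => /orP[/orP[|]|] /eqP ->; first by rewrite subrr normr0; lra.
      by rewrite distrC XS ger0_norm; lra.
    by rewrite XS ger0_norm; lra.
  move: Hj => /orP[/orP[|]|] /eqP ->; first by rewrite subrr normr0; lra.
    by rewrite distrC YS ger0_norm; lra.
  by rewrite YS ger0_norm; lra.
pose rect (p : R * R) := (x0 <= p.1 <= x1) && (ym - P <= p.2 <= ym + P).
(* The hypotheses on B concern exact zeros of A only, so on a grid the left side may violate what
   [grid_sperner] requires. The first alternative is a trichromatic cell; the other two record such
   a violation, which is excluded only in the limit. *)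
pose good K (t : (R * R) * (R * R) * (R * R)) :=
  let: (p0, p1, p2) := t in
  [/\ [/\ rect p0, rect p1 & rect p2], near_pts K p0 p1 /\ near_pts K p0 p2,
   A p0 < 0 <= A p1 &
   [\/ [/\ 0 <= A p2, 0 < B p1 & B p2 <= 0],
       [/\ p1.1 = x0, p1.2 <= ym & B p1 <= 0] |
       [/\ p1.1 = x0, ym <= p1.2 & 0 <= B p1]]].
have exgood K : exists t, good K t.
  apply: contrapT => ngood.
  pose lab (p : R * R) := if A p < 0 then 0%N else if 0 < B p then 1%N else 2%N.
  pose L i j := lab (X K i, Y K j).
  have lab0 p : A p < 0 -> lab p = 0%N by rewrite /lab => ->.
  have lab_eq0 p : (lab p == 0%N) = (A p < 0).
    by rewrite /lab; case: ifP => //; case: ifP.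
  have lab_eq1 p : (lab p == 1%N) = (0 <= A p) && (0 < B p).
    by rewrite /lab leNgt; case: ifP => //=; case: ifP.
  have lab_eq2 p : (lab p == 2%N) = (0 <= A p) && (B p <= 0).
    rewrite /lab leNgt; case: ifP => //=; rewrite (leNgt (B p)).
    by case: ifP.
  have rXY i j : (i <= K.+1)%N -> (j <= K.+1 + K.+1)%N -> rect (X K i, Y K j).
    by move=> iK jK; rewrite /rect/= Xb// Yb.
  have [||||||||i [j [iK jK tri]]] := @grid_sperner L K.+1 (K.+1 + K.+1) K.+1.
  - exact: leq_addr.
  - by move=> i j; rewrite /L /lab; case: ifP => //; case: ifP.
  - by move=> j jK; apply: lab0; rewrite XK; apply: Ar; exact: Yb.
  - by move=> i iK; apply: lab0; rewrite Y0; apply: Ab; exact: Xb.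
  - by move=> i iK; apply: lab0; rewrite YK; apply: At; exact: Xb.
  - by rewrite /L lab_eq0 X0 YM ltNge (ltW Am).
  - move=> j jK; rewrite /L X0.
    have rj k : (k <= K.+1)%N -> rect (x0, Y K k).
      by move=> kK; rewrite -(X0 K); apply: rXY => //; lia.
    have near1 : near_pts K (x0, Y K j) (x0, Y K j.+1).
      by rewrite -(X0 K); apply: nearXY; rewrite eqxx ?orbT.
    have near2 : near_pts K (x0, Y K j.+1) (x0, Y K j).
      by rewrite -(X0 K); apply: nearXY; rewrite eqxx ?orbT.
    have jK' : (j <= K.+1)%N by rewrite ltnW.
    rewrite /edge01 !lab_eq0 !lab_eq1.
    have [a0|a0] := ltP (A (x0, Y K j)) 0; have [a1|a1] := ltP (A (x0, Y K j.+1)) 0 => //= _.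
      (* A violation on the left side involves two points; the third entry merely repeats the
         second. *)
      rewrite orbF ltNge; apply/negP => b1; apply: ngood.
      exists ((x0, Y K j), (x0, Y K j.+1), (x0, Y K j.+1)); split => //.
      - by split; exact: rj.
      - by rewrite a0.
      - by apply: Or32; split => //=; exact: Ylow.
    rewrite andbT ltNge; apply/negP => b1; apply: ngood.
    exists ((x0, Y K j.+1), (x0, Y K j), (x0, Y K j)); split => //.
    - by split; exact: rj.
    - by rewrite a1.
    - by apply: Or32; split => //=; exact: Ylow.
  - move=> j /andP[Kj jK]; rewrite /L X0.
    have rj k : (k <= K.+1 + K.+1)%N -> rect (x0, Y K k).
      by move=> kK; rewrite -(X0 K); apply: rXY => //; lia.
    have near1 : near_pts K (x0, Y K j) (x0, Y K j.+1).
      by rewrite -(X0 K); apply: nearXY; rewrite eqxx ?orbT.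
    have near2 : near_pts K (x0, Y K j.+1) (x0, Y K j).
      by rewrite -(X0 K); apply: nearXY; rewrite eqxx ?orbT.
    have jK' : (j <= K.+1 + K.+1)%N by rewrite ltnW.
    rewrite /edge01 !lab_eq0 !lab_eq1.
    apply/negP => /orP[/andP[a0 /andP[a1 b1]]|/andP[/andP[a0 b1] a1]]; apply: ngood.
      exists ((x0, Y K j), (x0, Y K j.+1), (x0, Y K j.+1)); split => //.
      - by split; exact: rj.
      - by rewrite a0.
      - by apply: Or33; split => //=; [apply: Yup; lia|exact: ltW].
    exists ((x0, Y K j.+1), (x0, Y K j), (x0, Y K j)); split => //.
    - by split; exact: rj.
    - by rewrite a1.
    - by apply: Or33; split => //=; [apply: Yup; lia|exact: ltW].
  have pick k : (k < 3)%N -> exists i' j',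
      [/\ (i' == i) || (i' == i.+1), (j' == j) || (j' == j.+1) & L i' j' = k].
    move=> /tri; rewrite !inE => /orP[|/orP[|/orP[|]]] /eqP ->.
    - by exists i, j; rewrite !eqxx.
    - by exists i.+1, j; rewrite !eqxx orbT.
    - by exists i.+1, j.+1; rewrite !eqxx !orbT.
    - by exists i, j.+1; rewrite !eqxx !orbT.
  have leX i' : (i' == i) || (i' == i.+1) -> (i' <= K.+1)%N.
    by case/orP => /eqP -> //; exact: ltnW.
  have leY j' : (j' == j) || (j' == j.+1) -> (j' <= K.+1 + K.+1)%N.
    by case/orP => /eqP -> //; exact: ltnW.
  have adj k k1 k2 : (k1 == k) || (k1 == k.+1) -> (k2 == k) || (k2 == k.+1) ->
      (k2 == k1) || (k2 == k1.+1) || (k1 == k2.+1).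
    by move=> /orP[] /eqP -> /orP[] /eqP ->; rewrite eqxx ?orbT.
  have [i0 [j0 [Hi0 Hj0 /eqP]]] := pick 0%N isT.
  have [i1 [j1 [Hi1 Hj1 /eqP]]] := pick 1%N isT.
  have [i2 [j2 [Hi2 Hj2 /eqP]]] := pick 2%N isT.
  rewrite /L lab_eq0 lab_eq1 lab_eq2 => /andP[a2 b2] /andP[a1 b1] a0.
  apply: ngood; exists ((X K i0, Y K j0), (X K i1, Y K j1), (X K i2, Y K j2)).
  split.
  - by split; apply: rXY; [exact: leX|exact: leY|exact: leX|exact: leY|
      exact: leX|exact: leY].
  - by split; apply: nearXY; [exact: (adj i)|exact: (adj j)|exact: (adj i)|exact: (adj j)].
  - by rewrite a0.
  - by apply: Or31.
have [t tP] := choice exgood.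
have [U [UU ooU]] := ultra_oo.
pose p0 K := (t K).1.1; pose p1 K := (t K).1.2; pose p2 K := (t K).2.
have tE K : good K (p0 K, p1 K, p2 K).
  by have := tP K; rewrite /p0 /p1 /p2; case: (t K) => [[]].
have [lx lxb p0x] : exists2 l, x0 <= l <= x1 & (fun K => (p0 K).1) @ U --> l.
  by apply: ultra_cvg => K; have [[/andP[]]] := tE K.
have [ly lyb p0y] : exists2 l, ym - P <= l <= ym + P & (fun K => (p0 K).2) @ U --> l.
  by apply: ultra_cvg => K; have [[/andP[]]] := tE K.
have Dh0 : (fun K => D * h K) @ U --> (0 : R).
  apply: oo_cvg_ultra ooU _; rewrite -(mulr0 D).
  by apply: cvgM; [exact: cvg_cst|exact: cvg_harmonic].
have close (u v : nat -> R) (l : R) : u @ U --> l ->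
    (forall K, `|u K - v K| <= D * h K) -> v @ U --> l.
  move=> ul uv.
  have -> : v = (fun K => u K - (u K - v K)) by apply/funext => K; rewrite subKr.
  rewrite (_ : l = l - 0); last by rewrite subr0.
  apply: cvgB => //.
  apply/cvgr0Pnorm_le => e e0; have /cvgr0Pnorm_le/(_ e e0) := Dh0.
  apply: filterS => K; apply: le_trans.
  by apply: le_trans (uv K) _; exact: ler_norm.
have p0l : p0 @ U --> (lx, ly).
  rewrite (_ : p0 = fun K => ((p0 K).1, (p0 K).2)); last by apply/funext => K; case: (p0 K).
  exact: cvg_pair p0x p0y.
have p1x : (fun K => (p1 K).1) @ U --> lx.
  by apply: close p0x _ => K; have [_ [[]]] := tE K.
have p1y : (fun K => (p1 K).2) @ U --> ly.
  by apply: close p0y _ => K; have [_ [[]]] := tE K.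
have p2x : (fun K => (p2 K).1) @ U --> lx.
  by apply: close p0x _ => K; have [_ [_ []]] := tE K.
have p2y : (fun K => (p2 K).2) @ U --> ly.
  by apply: close p0y _ => K; have [_ [_ []]] := tE K.
have p1l : p1 @ U --> (lx, ly).
  rewrite (_ : p1 = fun K => ((p1 K).1, (p1 K).2)); last by apply/funext => K; case: (p1 K).
  exact: cvg_pair p1x p1y.
have p2l : p2 @ U --> (lx, ly).
  rewrite (_ : p2 = fun K => ((p2 K).1, (p2 K).2)); last by apply/funext => K; case: (p2 K).
  exact: cvg_pair p2x p2y.
have A0 : (A \o p0) @ U --> A (lx, ly) by apply: cvg_comp p0l _; exact: cA.
have A1 : (A \o p1) @ U --> A (lx, ly) by apply: cvg_comp p1l _; exact: cA.
have B1 : (B \o p1) @ U --> B (lx, ly) by apply: cvg_comp p1l _; exact: cB.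
have B2 : (B \o p2) @ U --> B (lx, ly) by apply: cvg_comp p2l _; exact: cB.
have Al : A (lx, ly) = 0.
  apply/eqP; rewrite eq_le; apply/andP; split.
    by apply: flim_le A0 _; apply: filterE => K /=; have [_ _ /andP[/ltW]] := tE K.
  by apply: flim_ge A1 _; apply: filterE => K /=; have [_ _ /andP[]] := tE K.
exists (lx, ly); split => //=.
(* A strict sign of B at the limit leaves a single alternative of [good] for U-almost all K. It puts
   the limit on the part of the left side where B has the opposite sign at zeros of A. *)
have [Bn|Bp|//] := ltgtP (B (lx, ly)) 0.
- have H : \forall K \near U, (p1 K).1 = x0 /\ (p1 K).2 <= ym.
    have : \forall K \near U, B (p1 K) < 0 by apply: cvgr_lt B1 _ Bn.
    apply: filterS => K b1; have [_ _ _] := tE K.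
    by case=> [[_ /lt_trans/(_ b1)]|[]//|[_ _]]; [rewrite ltxx|rewrite leNgt b1].
  have lx0 : lx = x0.
    apply/eqP; rewrite eq_le; apply/andP; split.
      by apply: flim_le p1x _; apply: filterS H => K [->].
    by apply: flim_ge p1x _; apply: filterS H => K [->].
  have lym : ly <= ym by apply: flim_le p1y _; apply: filterS H => K [].
  move: Al Bn; rewrite lx0 => Al.
  have lyy : ym - P <= ly <= ym by move: lyb => /andP[-> _].
  by have := Blow _ lyy Al; lra.
- have H : \forall K \near U, (p1 K).1 = x0 /\ ym <= (p1 K).2.
    have : \forall K \near U, 0 < B (p1 K) by apply: cvgr_gt B1 _ Bp.
    have : \forall K \near U, 0 < B (p2 K) by apply: cvgr_gt B2 _ Bp.
    apply: filterS2 => K b2 b1; have [_ _ _] := tE K.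
    by case=> [[_ _]|[_ _]|[]//]; [rewrite leNgt b2|rewrite leNgt b1].
  have lx0 : lx = x0.
    apply/eqP; rewrite eq_le; apply/andP; split.
      by apply: flim_le p1x _; apply: filterS H => K [->].
    by apply: flim_ge p1x _; apply: filterS H => K [->].
  have lym : ym <= ly by apply: flim_ge p1y _; apply: filterS H => K [].
  move: Al Bp; rewrite lx0 => Al.
  have lyy : ym <= ly <= ym + P by move: lyb => /andP[_ ->]; rewrite lym.
  by have := Bup _ lyy Al; lra.
Qed.

End PlanarZero.

(** * Euler scheme and its Gronwall estimates *)

Section Scheme.
Context {R : realType}.
Variables (T C : R) (a g : R -> R).
Hypotheses (T0 : 0 < T) (C0 : 0 <= C).
Hypotheses (sa : summable a) (aT : forall t, ~~ (0 <= t <= T) -> a t = 0).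
Hypotheses (cg : continuous g) (gC : forall s, `|g s| <= C * `|s|).
Hypothesis gneg : forall s, s <= 0 -> g s = 0.
Implicit Types (n k i : nat) (p : R * R) (x y t : R).

Definition node n k : R := T * (k%:R * n%:R^-1).

(* Semi-implicit Euler scheme for u' = v, v' = - a g(u), in which a is replaced
   by its integrals over the mesh intervals. *)
Fixpoint scheme n p k : R * R :=
  if k is k'.+1 then
    let q := scheme n p k' in
    let v := q.2 - integ a (node n k') (node n k) * g q.1 in
    (q.1 + T / n%:R * v, v)
  else p.

Definition size1 p : R := `|p.1| + `|p.2|.

Let A : R -> R -> R := integ (fun t => `|a t|).

(** The Gronwall constant on [0, T] of the system u' = v, v' = - a g(u) with |g(s)| <= C |s|. *)
Definition gronwall : R := expR (T + C * A 0 T).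

Lemma node0 n : node n 0 = 0. Proof. by rewrite /node mul0r mulr0. Qed.

Lemma noden n : (0 < n)%N -> node n n = T.
Proof. by move=> n0; rewrite /node mulfV ?mulr1// pnatr_eq0 -lt0n. Qed.

Lemma nodeS n k : node n k.+1 = node n k + T / n%:R.
Proof. by rewrite /node -[k.+1]addn1 natrD; ring. Qed.

Lemma mesh_gt0 n : (0 < n)%N -> 0 < T / n%:R.
Proof. by move=> n0; rewrite divr_gt0// ltr0n. Qed.

Lemma node_ge0 n k : 0 <= node n k.
Proof. by rewrite /node mulr_ge0// ?mulr_ge0 ?invr_ge0//; exact: ltW. Qed.

Lemma le_node n i k : (i <= k)%N -> node n i <= node n k.
Proof.
by move=> ik; rewrite /node ler_pM2l// ler_wpM2r ?invr_ge0// ler_nat.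
Qed.

Lemma node_leT n k : (0 < n)%N -> (k <= n)%N -> node n k <= T.
Proof. by move=> n0 kn; rewrite -[leRHS](noden n0) le_node. Qed.

Lemma size1_ge0 p : 0 <= size1 p.
Proof. by rewrite /size1 addr_ge0. Qed.

Lemma scheme_continuous n k : continuous (fun p => scheme n p k).
Proof.
elim: k => [|k IH] p /=; first exact: cvg_id.
have c1 : (fun q => (scheme n q k).1) @ p --> (scheme n p k).1.
  by apply: cvg_comp (IH p) _; exact: cvg_fst.
have c2 : (fun q => (scheme n q k).2) @ p --> (scheme n p k).2.
  by apply: cvg_comp (IH p) _; exact: cvg_snd.
have c3 : (fun q => (scheme n q k).2 -
    integ a (node n k) (node n k.+1) * g (scheme n q k).1) @ p -->
    (scheme n p k).2 - integ a (node n k) (node n k.+1) * g (scheme n p k).1.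
  apply: cvgB => //; apply: cvgM; first exact: cvg_cst.
  by apply: cvg_comp c1 _; exact: cg.
have c4 : (fun q => (scheme n q k).1 + T / n%:R * ((scheme n q k).2 -
    integ a (node n k) (node n k.+1) * g (scheme n q k).1)) @ p -->
    (scheme n p k).1 + T / n%:R * ((scheme n p k).2 -
    integ a (node n k) (node n k.+1) * g (scheme n p k).1).
  by apply: cvgD => //; apply: cvgM => //; exact: cvg_cst.
exact: cvg_pair c4 c3.
Qed.

Lemma ler_mesh_integ n k : `|integ a (node n k) (node n k.+1)| <=
  A (node n k) (node n k.+1).
Proof. by apply: ler_norm_integ => //; rewrite le_node. Qed.

Lemma A_ge0 x y : x <= y -> 0 <= A x y.
Proof. exact: integ_norm_ge0. Qed.

(** A step is a shear in v followed by a shear in u. These shears and their inverses enlarge [size1]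
    at most by the factors 1 + C b and 1 + h, whose product is below the exponential. *)
Lemma scheme_step n p k : (0 < n)%N ->
  let e := expR (T / n%:R + C * A (node n k) (node n k.+1)) in
  size1 (scheme n p k.+1) <= e * size1 (scheme n p k) /\
  size1 (scheme n p k) <= e * size1 (scheme n p k.+1).
Proof.
move=> n0; set b := A _ _; set h := T / n%:R => /=.
have h0 : 0 < h by exact: mesh_gt0.
have b0 : 0 <= b by rewrite A_ge0// le_node.
have eP : (1 + h) * (1 + C * b) <= expR (h + C * b).
  have Cb : 0 <= C * b by rewrite mulr_ge0.
  by rewrite expRD ler_pM//; [lra|lra|exact: expR_ge1Dx|exact: expR_ge1Dx].
set s := scheme n p k; rewrite /size1/=.
set al := integ a _ _; set v := s.2 - al * g s.1.
have alb : `|al| <= b by exact: ler_mesh_integ.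
have gs := gC s.1.
have ag : `|al * g s.1| <= b * (C * `|s.1|) by rewrite normrM ler_pM.
have hv : `|h * v| = h * `|v| by rewrite normrM gtr0_norm.
have v1 : `|v| <= `|s.2| + `|al * g s.1| by exact: ler_normB.
have v2 : `|s.2| <= `|v| + `|al * g s.1|.
  by rewrite -[s.2 in leLHS](subrK (al * g s.1)); exact: ler_normD.
have u1 : `|s.1 + h * v| <= `|s.1| + h * `|v| by rewrite -hv ler_normD.
have u2 : `|s.1| <= `|s.1 + h * v| + h * `|v|.
  rewrite -hv -[s.1 in leLHS](addrK (h * v)).
  exact: ler_normB.
have n1 := normr_ge0 s.1; have n2 := normr_ge0 s.2; have n3 := normr_ge0 v.
have n4 := normr_ge0 (s.1 + h * v).
have Cb : 0 <= C * b by rewrite mulr_ge0.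
have hCb : 0 <= h * (C * b) by rewrite mulr_ge0// ltW.
split.
  apply: (@le_trans _ _ ((1 + h) * (1 + C * b) * (`|s.1| + `|s.2|))).
    have e1 : `|v| <= `|s.2| + C * b * `|s.1| by lra.
    have e2 : h * `|v| <= h * (`|s.2| + C * b * `|s.1|) by rewrite ler_pM2l.
    have m1 : 0 <= C * b * `|s.2| by rewrite mulr_ge0.
    have m2 : 0 <= h * (C * b) * `|s.2| by rewrite mulr_ge0.
    have m3 : 0 <= h * `|s.1| by rewrite mulr_ge0// ltW.
    lra.
  by rewrite ler_wpM2r// addr_ge0.
apply: (@le_trans _ _ ((1 + h) * (1 + C * b) * (`|s.1 + h * v| + `|v|))).
  have e1 : `|s.2| <= `|v| + C * b * `|s.1| by lra.
  have e2 : C * b * `|s.1| <= C * b * (`|s.1 + h * v| + h * `|v|).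
    by rewrite ler_wpM2l.
  have m1 : 0 <= h * `|s.1 + h * v| by rewrite mulr_ge0// ltW.
  have m2 : 0 <= h * (C * b) * `|s.1 + h * v| by rewrite mulr_ge0.
  have m3 : 0 <= C * b * `|v| by rewrite mulr_ge0.
  lra.
by rewrite ler_wpM2r// addr_ge0.
Qed.

(** The second inequality transports bounds back to the initial data, and prevents u and v from
    vanishing together unless the data are zero. *)
Lemma scheme_gronwall n p k : (0 < n)%N -> (k <= n)%N ->
  size1 (scheme n p k) <= gronwall * size1 p /\
  size1 p <= gronwall * size1 (scheme n p k).
Proof.
move=> n0 kn.
pose e k := expR (node n k + C * A 0 (node n k)).
have H : size1 (scheme n p k) <= e k * size1 p /\
  size1 p <= e k * size1 (scheme n p k).
  elim: k {kn} => [|k [IH1 IH2]].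
    by rewrite /e node0 /A integxx mulr0 addr0 expR0 !mul1r.
  have [S1 S2] := scheme_step p k n0.
  have -> : e k.+1 = e k *
      expR (T / n%:R + C * A (node n k) (node n k.+1)).
    rewrite /e -expRD; congr expR; rewrite /A.
    by rewrite (integ_chasles _ 0 (node n k) (node n k.+1)) {1}nodeS; ring.
  split.
    apply: (le_trans S1); rewrite (mulrC (e k)) -mulrA.
    by apply: ler_wpM2l; [exact: expR_ge0|].
  apply: (le_trans IH2); rewrite -mulrA.
  by apply: ler_wpM2l; [exact: expR_ge0|].
have eg : e k <= gronwall.
  rewrite ler_expR lerD ?node_leT// ler_wpM2l//.
  by apply: integ_norm_mono; rewrite ?node_ge0 ?node_leT.
case: H => H1 H2; split.
  by apply: le_trans H1 _; rewrite ler_wpM2r ?size1_ge0.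
by apply: le_trans H2 _; rewrite ler_wpM2r ?size1_ge0.
Qed.

(** Once u <= 0 and v < 0, g vanishes and the slope is frozen, so the end state would have u <= 0
    and v < 0 as well. The condition on the end state thus yields positivity at all nodes. *)
Lemma scheme_pos n p : (0 < n)%N -> 0 < p.1 ->
  0 < (scheme n p n).1 \/ 0 <= (scheme n p n).2 ->
  forall k, (k <= n)%N -> 0 < (scheme n p k).1.
Proof.
move=> n0 p0.
have Hneg k : (scheme n p k).1 <= 0 -> (scheme n p k).2 < 0 -> forall d,
    (scheme n p (k + d)).1 <= 0 /\ (scheme n p (k + d)).2 < 0.
  move=> k1 k2; elim=> [|d [d1 d2]]; first by rewrite addn0.
  rewrite addnS /= gneg// mulr0 subr0; split=> //.
  have := mesh_gt0 n0; nra.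
have Hpos k : 0 < (scheme n p k).1 \/
    (scheme n p k).1 <= 0 /\ (scheme n p k).2 < 0.
  elim: k => [|k [kp|[k1 k2]]]; first by left.
    (* As u is updated with the new slope, a passage from u > 0 to u <= 0 forces the new slope
       itself to be negative. *)
    have [|le0] := ltP 0 (scheme n p k.+1).1; [by left|right; split=> //].
    move: le0 => /=; set v := _ - _ * _; have := mesh_gt0 n0.
    by move=> h0 le0; rewrite ltNge; apply/negP => v0; nra.
  by right; have := Hneg _ k1 k2 1%N; rewrite addn1.
move=> H k kn; have [//|[k1 k2]] := Hpos k.
have := Hneg _ k1 k2 (n - k)%N; rewrite subnKC// => -[n1 n2].
by case: H; lra.
Qed.

(** The relation u' = v in the form of mean value inequalities, which passes to limits and treats
    the endpoints like interior points. *)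
Definition antiderivative (c d : R) u v := forall x y m M,
  c <= x -> x <= y -> y <= d ->
  (forall z, x <= z <= y -> m <= v z <= M) ->
  m * (y - x) <= u y - u x <= M * (y - x).

(** The Gronwall bounds are part of the notion: they are inherited from the scheme and not rederived
    from the integral equation. *)
Definition solution u v :=
  [/\ continuous u, continuous v,
   forall x y, 0 <= x -> x <= y -> y <= T ->
     v y - v x = - integ (fun t => a t * g (u t)) x y,
   antiderivative 0 T u v &
   forall x, 0 <= x <= T ->
     size1 (u x, v x) <= gronwall * size1 (u 0, v 0) /\
     size1 (u 0, v 0) <= gronwall * size1 (u x, v x)].

End Scheme.

(** * Projection onto an interval, for extending functions to the line *)

Section Clamp.
Context {R : realType}.
Implicit Types (c d x y : R).

Definition clamp c d x : R := Num.max c (Num.min d x).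

Lemma clampP c d x : c <= d -> c <= clamp c d x <= d.
Proof. by move=> cd; rewrite /clamp le_max lexx/= ge_max cd ge_min lexx. Qed.

Lemma clampE c d x : c <= x <= d -> clamp c d x = x.
Proof.
by move=> /andP[cx xd]; rewrite /clamp (min_idPr xd) (max_idPr cx).
Qed.

Lemma clamp_lip c d x y : c <= d -> `|clamp c d x - clamp c d y| <= `|x - y|.
Proof.
move=> cd; have h1 := ler_norm (x - y); have h2 := ler_norm (y - x).
rewrite (distrC y x) in h2; rewrite /clamp.
rewrite ler_norml; case: (leP d x) => xd; case: (leP d y) => yd;
  rewrite ?(max_idPr cd).
- by apply/andP; split; lra.
- by case: (leP c y) => y0; apply/andP; split; lra.
- by case: (leP c x) => x0; apply/andP; split; lra.
- by case: (leP c x) => x0; case: (leP c y) => y0; apply/andP; split; lra.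
Qed.

End Clamp.

(** * Exact solutions as ultrafilter limits of the scheme *)

Section SchemeLimit.
Context {R : realType}.
Variables (T C : R) (a g : R -> R).
Hypotheses (T0 : 0 < T) (C0 : 0 <= C).
Hypotheses (sa : summable a) (aT : forall t, ~~ (0 <= t <= T) -> a t = 0).
Hypotheses (cg : continuous g) (gC : forall s, `|g s| <= C * `|s|).
Implicit Types (x y t : R).

Let A : R -> R -> R := integ (fun t => `|a t|).
Let E := gronwall T C a.

Variables (U : set_system nat).
Context {UU : UltraFilter U}.
Hypothesis ooU : \oo `<=` U.

Let limB (f h : nat -> R) (l m : R) : f @ U --> l -> h @ U --> m ->
  (fun j => f j - h j) @ U --> l - m.
Proof. exact: cvgB. Qed.

Let limZ (c : R) (f : nat -> R) (l : R) : f @ U --> l ->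
  (fun j => c * f j) @ U --> c * l.
Proof. by apply: cvgM; exact: cvg_cst. Qed.

Let lim_norm (f : nat -> R) (l : R) : f @ U --> l ->
  (fun j => `|f j|) @ U --> `|l|.
Proof. exact: cvg_norm. Qed.

Variables (N : nat -> nat) (p : nat -> R * R) (L : R).
Hypotheses (NP : forall j, (j < N j)%N) (pL : forall j, size1 (p j) <= L).

Local Notation nod j k := (node T (N j) k).
Let s j k := scheme T a g (N j) (p j) k.

Let N0 j : (0 < N j)%N. Proof. exact: leq_trans (NP j). Qed.

Let V := E * L.

Let V0 : 0 <= V.
Proof.
by rewrite mulr_ge0 ?expR_ge0//; apply: le_trans (pL 0%N); exact: size1_ge0.
Qed.

Let sV j k : (k <= N j)%N -> size1 (s j k) <= V.
Proof.
move=> kN; have [h _] := scheme_gronwall T0 C0 sa gC (p j) (N0 j) kN.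
by apply: (le_trans h); rewrite ler_wpM2l ?expR_ge0.
Qed.

Let s1V j k : (k <= N j)%N -> `|(s j k).1| <= V.
Proof. by move=> /sV; apply: le_trans; rewrite /size1 lerDl. Qed.

Let s2V j k : (k <= N j)%N -> `|(s j k).2| <= V.
Proof. by move=> /sV; apply: le_trans; rewrite /size1 lerDr. Qed.

Let mesh j := T / (N j)%:R.

Let mesh0 : mesh @ U --> (0 : R).
Proof.
have H : (fun j => T * (j.+1%:R)^-1) @ U --> (0 : R).
  apply: oo_cvg_ultra ooU _; rewrite -(mulr0 T).
  by apply: cvgM; [exact: cvg_cst|exact: cvg_harmonic].
apply/cvgr0Pnorm_le => e e0; have /cvgr0Pnorm_le/(_ e e0) := H.
apply: filterS => j; apply: le_trans.
rewrite /mesh !ger0_norm ?divr_ge0 ?(ltW T0)//.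
by rewrite ler_pM2l// lef_pV2 ?posrE ?ltr0n// ler_nat; exact: NP.
Qed.

Let s1_lip j i k : (i <= k)%N -> (k <= N j)%N ->
  `|(s j k).1 - (s j i).1| <= V * (nod j k - nod j i).
Proof.
elim: k => [|k IH]; first by rewrite leqn0 => /eqP -> _; rewrite !subrr normr0 mulr0.
rewrite leq_eqVlt => /orP[/eqP -> _|ik kN].
  by rewrite !subrr normr0 mulr0.
have := IH ik (ltnW kN); have := s2V kN; rewrite nodeS.
have h0 := mesh_gt0 T0 (N0 j).
have e1 : (s j k.+1).1 - (s j i).1 =
    (s j k).1 - (s j i).1 + T / (N j)%:R * (s j k.+1).2 by rewrite /s/=; ring.
rewrite e1 => H1 H2; apply: le_trans (ler_normD _ _) _.
by rewrite normrM (gtr0_norm h0); nra.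
Qed.

Let idx j x := Num.truncn (x / T * (N j)%:R).

Let idxP j x : 0 <= x -> nod j (idx j x) <= x < nod j (idx j x).+1.
Proof.
move=> x0; have y0 : 0 <= x / T * (N j)%:R by rewrite mulr_ge0 ?divr_ge0 ?(ltW T0).
have Np : 0 < (N j)%:R :> R by rewrite ltr0n.
have xE : x = T * ((x / T * (N j)%:R) / (N j)%:R).
  by field; rewrite !gt_eqF.
have := truncn_itv y0; rewrite -/(idx j x).
move: (idx j x) => m; move: (x / T * _) xE => y -> hy.
rewrite /node ler_pM2l// ltr_pM2l// ler_pM2r ?invr_gt0//.
by rewrite ltr_pM2r ?invr_gt0.
Qed.

Let idx_leN j x : 0 <= x <= T -> (idx j x <= N j)%N.
Proof.
move=> /andP[x0 xT]; have /andP[h _] := idxP j x0.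
have : nod j (idx j x) <= nod j (N j) by rewrite noden// (le_trans h).
have Np : 0 < (N j)%:R :> R by rewrite ltr0n.
by rewrite /node ler_pM2l// ler_pM2r ?invr_gt0// ler_nat.
Qed.

Let le_idx j x y : 0 <= x -> x <= y -> (idx j x <= idx j y)%N.
Proof.
move=> x0 xy; have /andP[h1 _] := idxP j x0.
have /andP[_ h2] := idxP j (le_trans x0 xy).
have : nod j (idx j x) < nod j (idx j y).+1 by rewrite (le_lt_trans h1)// (le_lt_trans xy).
have Np : 0 < (N j)%:R :> R by rewrite ltr0n.
by rewrite /node ltr_pM2l// ltr_pM2r ?invr_gt0// ltr_nat ltnS.
Qed.

Let idx_cvg x : 0 <= x -> (fun j => nod j (idx j x)) @ U --> x.
Proof.
move=> x0; apply/cvgrPdist_le => e e0.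
have /cvgr0Pnorm_le/(_ e e0) := mesh0; apply: filterS => j.
have /andP[h1 h2] := idxP j x0; rewrite nodeS in h2.
have h0 := mesh_gt0 T0 (N0 j); rewrite /mesh.
by rewrite !ger0_norm; lra.
Qed.

Let uex x : exists l : R, (fun j => (s j (idx j (clamp 0 T x))).1) @ U --> l.
Proof.
have [|l _ h] := @ultra_cvg R U UU (fun j => (s j (idx j (clamp 0 T x))).1) (- V) V.
  by move=> j; rewrite -ler_norml; apply: s1V; apply/idx_leN/clampP/ltW.
by exists l.
Qed.

(** Clamping the time makes u Lipschitz on the whole line; by [uex] the default value 0 is never
    taken. *)
Let u x : R := xget 0 [set l : R | (fun j => (s j (idx j (clamp 0 T x))).1) @ U --> l].

Let uP x : 0 <= x <= T -> (fun j => (s j (idx j x)).1) @ U --> u x.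
Proof.
move=> xT; have := xgetPex 0 (uex x); rewrite -/(u x) /=.
by rewrite clampE.
Qed.

Let s1_lip2 j i k : (i <= N j)%N -> (k <= N j)%N ->
  `|(s j k).1 - (s j i).1| <= V * `|nod j k - nod j i|.
Proof.
move=> iN kN; case: (leqP i k) => ik.
  by rewrite (ger0_norm (_ : 0 <= nod j k - nod j i)) ?s1_lip// subr_ge0 le_node.
rewrite distrC (distrC (nod j k)).
rewrite (ger0_norm (_ : 0 <= nod j i - nod j k)) ?s1_lip ?(ltnW ik)//.
by rewrite subr_ge0 le_node// ltnW.
Qed.

Let seq_cvg (k : nat -> nat) (t : nat -> R) x : 0 <= x <= T ->
  (forall j, (k j <= N j)%N) -> (forall j, `|t j - nod j (k j)| <= mesh j) ->
  t @ U --> x -> (fun j => (s j (k j)).1) @ U --> u x.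
Proof.
move=> xT kN tk tx.
have -> : (fun j => (s j (k j)).1) = (fun j => (s j (idx j x)).1 +
    ((s j (k j)).1 - (s j (idx j x)).1)).
  by apply/funext => j; rewrite addrC subrK.
rewrite (_ : u x = u x + 0); last by rewrite addr0.
apply: cvgD; first exact: uP.
have H : (fun j => V * (mesh j + `|t j - x| + mesh j)) @ U --> V * (0 + `|x - x| + 0).
  apply: cvgM; first exact: cvg_cst.
  apply: cvgD => //; apply: cvgD => //; apply: cvg_norm.
  by apply: cvgB => //; exact: cvg_cst.
rewrite subrr normr0 !addr0 mulr0 in H.
apply/cvgr0Pnorm_le => e e0; have /cvgr0Pnorm_le/(_ e e0) := H.
apply: filterS => j h; apply: le_trans (s1_lip2 _ (kN j)) _.
  exact: idx_leN.
apply: le_trans h; apply: le_trans (ler_norm _); rewrite ler_wpM2l//.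
have -> : nod j (k j) - nod j (idx j x) =
  (nod j (k j) - t j) + (t j - x) + (x - nod j (idx j x)) by ring.
apply: le_trans (ler_normD _ _) _; apply: lerD.
  apply: le_trans (ler_normD _ _) _; rewrite lerD2r distrC; exact: tk.
have /andP[x0 _] := xT; have /andP[h1 h2] := idxP j x0; rewrite nodeS in h2.
by rewrite ger0_norm /mesh; lra.
Qed.

Let u_lip x y : `|u x - u y| <= V * `|x - y|.
Proof.
have uclamp z : u z = u (clamp 0 T z) by rewrite /u (clampE (clampP z (ltW T0))).
rewrite (uclamp x) (uclamp y).
apply: le_trans (_ : V * `|clamp 0 T x - clamp 0 T y| <= _); last first.
  by rewrite ler_wpM2l// clamp_lip// ltW.
have /andP[cx _] := clampP x (ltW T0); have /andP[cy _] := clampP y (ltW T0).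
have Hl := lim_norm (limB (uP (clampP x (ltW T0))) (uP (clampP y (ltW T0)))).
have Hr := @limZ V _ _ (lim_norm (limB (idx_cvg cx) (idx_cvg cy))).
have H := limB Hr Hl; rewrite -subr_ge0; apply: flim_ge H _.
by apply: filterE => j; rewrite subr_ge0; apply: s1_lip2; apply/idx_leN/clampP/ltW.
Qed.

Let cu : continuous u.
Proof.
move=> x; apply/cvgrPdist_lt => e e0.
have V1 : 0 < V + 1 by rewrite ltr_wpDl.
have r0 : 0 < e / (V + 1) by rewrite divr_gt0.
apply/nbhs_ballP; exists (e / (V + 1)) => //= y; rewrite /ball/= => xy.
apply: le_lt_trans (u_lip x y) _.
apply: (@le_lt_trans _ _ ((V + 1) * `|x - y|)).
  by rewrite ler_wpM2r// lerDl.
by rewrite -ltr_pdivlMl// mulrC.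
Qed.

Let cgu : continuous (g \o u).
Proof. by move=> x; apply: continuous_comp; [exact: cu|exact: cg]. Qed.

Let sagu : summable (fun t => a t * g (u t)).
Proof. exact: (summableM sa aT cgu). Qed.

Let v0 : {l : R | (fun j => (p j).2) @ U --> l}.
Proof.
apply: cid; have [|l _ h] := @ultra_cvg R U UU (fun j => (p j).2) (- V) V.
  by move=> j; rewrite -ler_norml; exact: (@s2V j 0%N).
by exists l.
Qed.

(** The integral equation holds by construction; that v is the limit of the discrete slopes is shown
    in [v_close]. *)
Let v x := sval v0 - integ (fun t => a t * g (u t)) 0 x.

Let cv : continuous v.
Proof.
move=> x; apply/cvgrPdist_lt => e e0.
have [d d0 dP] := integ_small sagu e0.
have key z y : z <= y -> y - z < d -> `|v z - v y| < e.
  move=> zy yz; apply: le_lt_trans (dP _ _ zy yz).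
  apply: le_trans (ler_norm_integ sagu zy); rewrite /v.
  by rewrite (integ_chasles _ 0 z y) distrC; rewrite le_eqVlt -normrN;
    apply/orP; left; apply/eqP; congr `|_|; ring.
apply/nbhs_ballP; exists d => //= y; rewrite /ball/= => xy.
case: (leP x y) => h.
  by apply: key => //; rewrite (le_lt_trans _ xy)// distrC ler_norm.
by rewrite distrC; apply: key; [exact: ltW|rewrite (le_lt_trans _ xy)// ler_norm].
Qed.

Let vE x y : v y - v x = - integ (fun t => a t * g (u t)) x y.
Proof. by rewrite /v (integ_chasles _ 0 x y); ring. Qed.

(** Uniformity in k and t is a compactness effect: otherwise U-almost all j have a bad pair, and the
    bad times converge along U to some x at which both values tend to [g (u x)]. *)
Let unif e : 0 < e -> \forall j \near U, forall k t, (k < N j)%N ->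
  nod j k <= t <= nod j k.+1 -> `|g (s j k).1 - g (u t)| <= e.
Proof.
move=> e0; pose W := [set j | forall k t, (k < N j)%N ->
  nod j k <= t <= nod j k.+1 -> `|g (s j k).1 - g (u t)| <= e].
have [UW|UW] := in_ultra_setVsetC W UU; [exact: UW|exfalso].
have ex j : exists kt : nat * R, ~ W j -> [/\ (kt.1 < N j)%N,
    nod j kt.1 <= kt.2 <= nod j kt.1.+1 & e < `|g (s j kt.1).1 - g (u kt.2)| ].
  have [Wj|nW] := pselect (W j); first by exists (0%N, 0).
  move: (nW) => /existsNP[k /existsNP[t /not_implyP[kN /not_implyP[kt ke]]]].
  by exists (k, t) => _; split => //; rewrite ltNge; exact/negP.
have [kt ktP] := choice ex.
(* Where no bad pair exists, node 0 at time 0 keeps the estimates on k and t valid for every j. *)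
pose k j := if asbool (W j) then 0%N else (kt j).1.
pose t j := if asbool (W j) then 0 else (kt j).2.
have kN j : (k j <= N j)%N.
  by rewrite /k; case: asboolP => // /ktP[/ltnW].
have tk j : nod j (k j) <= t j <= nod j (k j) + mesh j.
  rewrite /k /t; case: asboolP => [_|/ktP[_]]; rewrite ?nodeS//.
  by rewrite node0 lexx/= add0r ltW// mesh_gt0.
have [x xT tx] : exists2 x, 0 <= x <= T & t @ U --> x.
  apply: ultra_cvg => j; rewrite /t; case: asboolP => [_|/ktP[kNj /andP[h1 h2] _]].
    by rewrite lexx ltW.
  by rewrite (le_trans (node_ge0 _ _ _) h1)//= (le_trans h2)// node_leT.
have h1 : (fun j => (s j (k j)).1) @ U --> u x.
  apply: seq_cvg tx => // j; have /andP[? ?] := tk j.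
  by rewrite ger0_norm; lra.
have h2 : (u \o t) @ U --> u x by apply: cvg_comp tx _; exact: cu.
have g1 : (fun j => g (s j (k j)).1) @ U --> g (u x).
  by apply: (cvg_comp _ g h1); exact: cg.
have g2 : (fun j => g (u (t j))) @ U --> g (u x).
  by apply: (cvg_comp _ g h2); exact: cg.
have := lim_norm (limB g1 g2); rewrite subrr normr0 => /(cvgr0Pnorm_le _)/(_ e e0).
move=> /(filterI UW) /filter_ex[j [nW]] /=.
rewrite normr_id; have [_ _] := ktP j nW.
rewrite /k /t; case: asboolP => // _ ? ?; lra.
Qed.

(** The scheme integrates a exactly over each mesh interval, so a step contributes to the error at
    most the bound of [unif] times the integral of |a| there. *)
Let v_close e : 0 < e -> \forall j \near U, forall k, (k <= N j)%N ->
  `|(s j k).2 - v (nod j k)| <= e.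
Proof.
move=> e0; have AT : 0 <= A 0 T by exact/integ_norm_ge0/ltW.
have e'0 : 0 < e / 2 / (A 0 T + 1) by rewrite !divr_gt0//; lra.
have e2 : 0 < e / 2 by rewrite divr_gt0.
have := unif e'0; have /cvgrPdist_le/(_ _ e2) := svalP v0.
apply: filterS2 => j H1 H2 k kN; set e' := e / 2 / _ in e'0 H2.
have : `|(s j k).2 - v (nod j k)| <= `|(p j).2 - v 0| + e' * A 0 (nod j k).
  elim: k kN => [|k IH] kN; first by rewrite node0 /A integxx mulr0 addr0.
  have hk : nod j k <= nod j k.+1 by rewrite le_node.
  have -> : (s j k.+1).2 - v (nod j k.+1) = (s j k).2 - v (nod j k) +
     (integ (fun t => a t * g (u t)) (nod j k) (nod j k.+1)
      - integ a (nod j k) (nod j k.+1) * g (s j k).1).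
    have := vE (nod j k) (nod j k.+1); rewrite /s /=; set w := v _; set w' := v _.
    by move=> h; rewrite -[integ _ _ _ in RHS]opprK -h; ring.
  apply: le_trans (ler_normD _ _) _.
  have -> : `|(p j).2 - v 0| + e' * A 0 (nod j k.+1) =
    `|(p j).2 - v 0| + e' * A 0 (nod j k) + e' * A (nod j k) (nod j k.+1).
    by rewrite /A (integ_chasles _ 0 (nod j k) (nod j k.+1)); ring.
  apply: lerD; first exact/IH/ltnW.
  have sd : summable (fun t => a t * (g (u t) - g (s j k).1)).
    apply: (summableM sa aT) => x; apply: cvgB; [exact: cgu|exact: cvg_cst].
  have -> : integ (fun t => a t * g (u t)) (nod j k) (nod j k.+1)
      - integ a (nod j k) (nod j k.+1) * g (s j k).1 =
      integ (fun t => a t * (g (u t) - g (s j k).1)) (nod j k) (nod j k.+1).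
    rewrite [_ * g _]mulrC -mulNr -integZ// -integD//; last exact: summableZ.
    apply: eq_integ => //; last by move=> t _; ring.
    by apply: summableD => //; exact: summableZ.
  apply: le_trans (ler_norm_integ sd hk) _.
  rewrite /A -integZ//; last exact: summable_norm.
  apply: le_integ => //; [exact: summable_norm|exact/summableZ/summable_norm|].
  move=> t tk; rewrite normrM mulrC ler_wpM2r// distrC; exact: H2.
move=> h; apply: (le_trans h); rewrite [e in leRHS]splitr; apply: lerD.
  by rewrite /v integxx subr0 distrC.
apply: (@le_trans _ _ (e' * (A 0 T + 1))).
  rewrite ler_pM2l//; apply: (@le_trans _ _ (A 0 T)); last by lra.
  by apply: integ_norm_mono; rewrite ?node_ge0 ?node_leT.
by rewrite /e' divfK// gt_eqF//; lra.
Qed.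

Let v_cvg (k : nat -> nat) x : (forall j, (k j <= N j)%N) ->
  (fun j => nod j (k j)) @ U --> x -> (fun j => (s j (k j)).2) @ U --> v x.
Proof.
move=> kN kx.
have -> : (fun j => (s j (k j)).2) =
    (fun j => v (nod j (k j)) + ((s j (k j)).2 - v (nod j (k j)))).
  by apply/funext => j; rewrite addrC subrK.
rewrite (_ : v x = v x + 0); last by rewrite addr0.
apply: cvgD; first by apply: (cvg_comp _ v kx); exact: cv.
apply/cvgr0Pnorm_le => e e0; apply: filterS (v_close e0) => j; exact.
Qed.

Let u_anti : antiderivative 0 T u v.
Proof.
move=> x y m M x0 xy yT mM.
have y0 := le_trans x0 xy; have xT := le_trans xy yT.
have H e : 0 < e -> (m - e) * (y - x) <= u y - u x <= (M + e) * (y - x).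
  move=> e0.
  have hu := limB (uP (introT andP (conj y0 yT))) (uP (introT andP (conj x0 xT))).
  have hn := limB (idx_cvg y0) (idx_cvg x0).
  have key : \forall j \near U, (m - e) * (nod j (idx j y) - nod j (idx j x)) <=
     (s j (idx j y)).1 - (s j (idx j x)).1 <=
     (M + e) * (nod j (idx j y) - nod j (idx j x)).
    apply: filterS (v_close e0) => j vj.
    have H k : (idx j x <= k)%N -> (k <= idx j y)%N ->
       (m - e) * (nod j k - nod j (idx j x)) <= (s j k).1 - (s j (idx j x)).1 <=
       (M + e) * (nod j k - nod j (idx j x)).
      elim: k => [|k IH].
        by rewrite leqn0 => /eqP -> _; rewrite !subrr !mulr0 lexx.
      rewrite leq_eqVlt => /orP[/eqP -> _|ik kN].
        by rewrite !subrr !mulr0 lexx.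
      have kN' : (k.+1 <= N j)%N.
        by rewrite (leq_trans kN)//; apply: idx_leN; rewrite y0.
      have /andP[h1 h2] := IH ik (ltnW kN).
      (* A step uses the slope at its right end; of the nodes involved only that of index [idx j x]
         may lie to the left of x. *)
      have zk : x <= nod j k.+1 <= y.
        have /andP[_ hx] := idxP j x0; have /andP[hy _] := idxP j y0.
        rewrite (le_trans (ltW hx)) ?(le_trans _ hy)// le_node//.
      have := vj _ kN'; rewrite ler_distl => /andP[v1 v2].
      have /andP[m1 m2] := mM _ zk.
      have e1 : (s j k.+1).1 = (s j k).1 + T / (N j)%:R * (s j k.+1).2 by [].
      have h0 := mesh_gt0 T0 (N0 j); rewrite e1 nodeS.
      set w := (s j k.+1).2 in v1 v2 *; set q := T / _ in h0 *.
      have k1 : q * (m - e) <= q * w by rewrite ler_pM2l//; lra.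
      have k2 : q * w <= q * (M + e) by rewrite ler_pM2l//; lra.
      by apply/andP; split; lra.
    by apply: H => //; exact: le_idx.
  apply/andP; split; rewrite -subr_ge0.
    apply: flim_ge (limB hu (@limZ (m - e) _ _ hn)) _.
    by apply: filterS key => j /andP[h _]; rewrite subr_ge0.
  apply: flim_ge (limB (@limZ (M + e) _ _ hn) hu) _.
  by apply: filterS key => j /andP[_ h]; rewrite subr_ge0.
have d0 : 0 <= y - x by lra.
apply/andP; split; apply/ler_addgt0Pr => e e0.
  have e'0 : 0 < e / (y - x + 1) by rewrite divr_gt0//; lra.
  have /andP[h _] := H _ e'0.
  have : e / (y - x + 1) * (y - x) <= e.
    by rewrite mulrAC ler_pdivrMr; [nra|lra].
  lra.
have e'0 : 0 < e / (y - x + 1) by rewrite divr_gt0//; lra.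
have /andP[_ h] := H _ e'0.
have : e / (y - x + 1) * (y - x) <= e.
  by rewrite mulrAC ler_pdivrMr; [nra|lra].
lra.
Qed.

(** Initial and final states are kept in the conclusion because boundary conditions will be imposed
    on the discrete solutions. *)
Lemma scheme_limit : exists u v, [/\ solution T C a g u v,
  (fun j => (p j).1) @ U --> u 0, (fun j => (p j).2) @ U --> v 0,
  (fun j => (scheme T a g (N j) (p j) (N j)).1) @ U --> u T &
  (fun j => (scheme T a g (N j) (p j) (N j)).2) @ U --> v T] /\
  ((\forall j \near U, forall k, (k <= N j)%N ->
     0 < (scheme T a g (N j) (p j) k).1) ->
   forall x, 0 <= x <= T -> 0 <= u x).
Proof.
have nod0 : (fun j => nod j 0) @ U --> (0 : R).
  by under eq_fun do rewrite node0; exact: cvg_cst.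
have nodT : (fun j => nod j (N j)) @ U --> T.
  by under eq_fun do rewrite noden//; exact: cvg_cst.
have mesh_ge0 j : 0 <= mesh j by exact/ltW/mesh_gt0.
have T00 : 0 <= (0 : R) <= T by rewrite lexx ltW.
have T0T : 0 <= T <= T by rewrite lexx ltW.
have u0 : (fun j => (p j).1) @ U --> u 0.
  by apply: (@seq_cvg (fun=> 0%N) (fun j => nod j 0)) => // j; rewrite subrr normr0.
have v00 : (fun j => (p j).2) @ U --> v 0 by apply: (@v_cvg (fun=> 0%N)).
exists u, v; split; [split => //; first split => //|].
- move=> x xT; have /andP[x0 _] := xT.
  have cs : (fun j => size1 (s j (idx j x))) @ U --> size1 (u x, v x).
    apply: cvgD; apply: cvg_norm; first exact: uP.
    apply: v_cvg => [j|]; [exact: idx_leN|exact: idx_cvg].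
  have c0 : (fun j => size1 (p j)) @ U --> size1 (u 0, v 0).
    by apply: cvgD; exact: cvg_norm.
  split; rewrite -subr_ge0.
    apply: flim_ge (limB (@limZ E _ _ c0) cs) _.
    apply: filterE => j; rewrite subr_ge0.
    by have [] := scheme_gronwall T0 C0 sa gC (p j) (N0 j) (idx_leN j xT).
  apply: flim_ge (limB (@limZ E _ _ cs) c0) _.
  apply: filterE => j; rewrite subr_ge0.
  by have [] := scheme_gronwall T0 C0 sa gC (p j) (N0 j) (idx_leN j xT).
- apply: (@seq_cvg N (fun j => nod j (N j))) => // j; by rewrite subrr normr0.
- exact: (@v_cvg N).
- move=> H x xT; apply: flim_ge (uP xT) _; apply: filterS H => j h.
  by apply/ltW/h; exact: idx_leN.
Qed.

End SchemeLimit.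

(** * Wronskian identity for integral equations *)

Section Wronskian.
Context {R : realType}.
Variables (T : R) (a : R -> R).
Hypotheses (sa : summable a) (aT : forall t, ~~ (0 <= t <= T) -> a t = 0).
Implicit Types (f u v w h phi psi : R -> R) (c d x y z t : R).

Lemma summable_weight w : continuous w -> summable (fun t => a t * w t).
Proof. by move=> cw; exact: (summableM sa aT cw). Qed.

Lemma continuous_local w z (e : R) : continuous w -> 0 < e ->
  exists2 r : R, 0 < r & forall t, `|t - z| < r -> `|w t - w z| <= e.
Proof.
move=> cw e0; have /cvgrPdist_le/(_ _ e0)/nbhs_ballP[r /= r0 rP] := cw z.
exists r => // t tz; rewrite distrC; apply: rP.
by rewrite /ball/= distrC.
Qed.

Lemma integ_weight_osc w f x y (e B : R) : continuous w -> continuous f ->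
  x <= y -> (forall t, x <= t <= y -> `|f t - f y| <= e) ->
  (forall t, x <= t <= y -> `|w t| <= B) ->
  `|integ (fun t => a t * (w t * f t)) x y -
    integ (fun t => a t * w t) x y * f y| <=
  B * e * integ (fun t => `|a t|) x y.
Proof.
move=> cw cf xy fe wB.
have cwf : continuous (fun t => w t * f t).
  by move=> t; apply: cvgM; [exact: cw|exact: cf].
have cd : continuous (fun t => w t * (f t - f y)).
  by move=> t; apply: cvgM; [exact: cw|apply: cvgB; [exact: cf|exact: cvg_cst]].
have s1 := summable_weight cwf; have s2 := summable_weight cw.
have s3 := summable_weight cd.
have -> : integ (fun t => a t * (w t * f t)) x y -
    integ (fun t => a t * w t) x y * f y =
    integ (fun t => a t * (w t * (f t - f y))) x y.
  rewrite [_ * f y]mulrC -mulNr -integZ// -integD//; last exact: summableZ.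
  apply: eq_integ => //; last by move=> t _; ring.
  by apply: summableD => //; exact: summableZ.
apply: le_trans (ler_norm_integ s3 xy) _.
rewrite -integZ//; last exact: summable_norm.
apply: le_integ => //; [exact: summable_norm|exact/summableZ/summable_norm|].
move=> t txy; rewrite !normrM mulrC ler_wpM2r// ler_pM//; first exact: wB.
exact: fe.
Qed.

Lemma wronskian_arith (b1 b2 b3 b4 b5 w1 h1 v1 p1 A1 d1 eta : R) :
  0 <= w1 -> 0 <= h1 -> 0 <= v1 -> 0 <= p1 -> 0 <= eta * A1 -> 0 <= eta * d1 ->
  b1 <= (w1 + 1) * eta * A1 -> b2 <= (h1 + 1) * eta * A1 ->
  b3 <= (v1 + 1) * (eta * d1) -> b4 <= (p1 + 1) * (eta * d1) ->
  b5 <= (eta * p1 + eta * v1) * d1 ->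
  b1 + b2 + b3 + b4 + b5 <=
    (2 * (w1 + 1) + 2 * (h1 + 1) + 2 * v1 + 2 * p1 + 2) * eta * (A1 + d1).
Proof.
move=> w0 h0 v0 p0 P1 P2 B1 B2 B3 B4 B5.
have P3 b : 0 <= b -> 0 <= b * (eta * A1) by move=> ?; rewrite mulr_ge0.
have P4 b : 0 <= b -> 0 <= b * (eta * d1) by move=> ?; rewrite mulr_ge0.
have := P3 _ w0; have := P3 _ h0; have := P3 _ v0; have := P3 _ p0.
have := P4 _ w0; have := P4 _ h0; have := P4 _ v0; have := P4 _ p0.
lra.
Qed.

(** Formally (v phi - u psi)' = a h u - a w phi. Since v and psi need not be differentiable
    everywhere, the identity is proved on short intervals up to e times the integral of |a| plus the
    length, and [cousin] adds these up. *)
Lemma wronskian c d u v w phi psi h : c <= d ->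
  continuous u -> continuous v -> continuous w ->
  continuous phi -> continuous psi -> continuous h ->
  antiderivative c d u v -> antiderivative c d phi psi ->
  (forall x y, c <= x -> x <= y -> y <= d ->
    v y - v x = - integ (fun t => a t * w t) x y) ->
  (forall x y, c <= x -> x <= y -> y <= d ->
    psi y - psi x = - integ (fun t => a t * h t) x y) ->
  (v d * phi d - u d * psi d) - (v c * phi c - u c * psi c) =
  integ (fun t => a t * (h t * u t)) c d - integ (fun t => a t * (w t * phi t)) c d.
Proof.
move=> cd cu cv cw cphi cpsi ch au aphi vE psiE.
pose W x := v x * phi x - u x * psi x.
pose J1 := integ (fun t => a t * (h t * u t)).
pose J2 := integ (fun t => a t * (w t * phi t)).
pose A := integ (fun t => `|a t|).
have A_ge0 x y : x <= y -> 0 <= A x y by move=> xy; exact: integ_norm_ge0.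
suff H e : 0 < e -> `|W d - W c - (J1 c d - J2 c d)| <= e * (A c d + (d - c)).
  apply/eqP; rewrite -subr_eq0 -normr_eq0 eq_le normr_ge0 andbT.
  apply/ler_addgt0Pr => e e0; rewrite add0r; have D0 : 0 < A c d + (d - c) + 1.
    by have := A_ge0 _ _ cd; lra.
  apply: (le_trans (H (e / (A c d + (d - c) + 1)) _)); first exact: divr_gt0.
  rewrite mulrAC ler_pdivrMr// ler_pM2l//; lra.
move=> e0.
pose Q x y := `|W y - W x - (J1 x y - J2 x y)| <= e * (A x y + (y - x)).
apply: (@cousin _ c d Q) => // [x y z _ xy yz _|z zcd].
  rewrite /Q => h1 h2.
  have -> : W z - W x - (J1 x z - J2 x z) = (W y - W x - (J1 x y - J2 x y)) +
     (W z - W y - (J1 y z - J2 y z)).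
    by rewrite /J1 /J2 !(integ_chasles _ x y z); ring.
  apply: le_trans (ler_normD _ _) _.
  by rewrite /A (integ_chasles _ x y z) -/A; lra.
(* K dominates the coefficients of the five error terms summed in [wronskian_arith]; [eta <= 1] lets
   |v| and |psi| exceed their values at z by at most 1. *)
pose K := 2 * (`|w z| + 1) + 2 * (`|h z| + 1) + 2 * `|v z| + 2 * `|psi z| + 2.
have [w0 h0 v0 p0] : [/\ 0 <= `|w z|, 0 <= `|h z|, 0 <= `|v z| & 0 <= `|psi z|].
  by split.
have K0 : 0 < K by rewrite /K; lra.
pose eta := Num.min 1 (e / K).
have eta0 : 0 < eta by rewrite lt_min ltr01 divr_gt0.
have eta1 : eta <= 1 by rewrite ge_min lexx.
have etaK : K * eta <= e.
  by rewrite mulrC -ler_pdivlMr// ge_min lexx orbT.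
have e20 : 0 < eta / 2 by rewrite divr_gt0.
have [r1 r10 H1] := continuous_local z cu e20.
have [r2 r20 H2] := continuous_local z cv eta0.
have [r3 r30 H3] := continuous_local z cphi e20.
have [r4 r40 H4] := continuous_local z cpsi eta0.
have [r5 r50 H5] := continuous_local z cw ltr01.
have [r6 r60 H6] := continuous_local z ch ltr01.
pose r := Num.min r1 (Num.min r2 (Num.min r3 (Num.min r4 (Num.min r5 r6)))).
exists r; first by rewrite !lt_min r10 r20 r30 r40 r50.
move=> x y cx xz zy yd zrx yzr.
have xy : x <= y := le_trans xz zy.
have near t : x <= t <= y -> `|t - z| < r.
  move=> /andP[xt ty]; rewrite ltr_distl (lt_le_trans zrx xt)/=.
  exact: le_lt_trans yzr.
have Hr t : x <= t <= y -> [/\ `|t - z| < r1, `|t - z| < r2, `|t - z| < r3,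
    `|t - z| < r4 & `|t - z| < r5 /\ `|t - z| < r6].
  by move=> /near; rewrite !lt_min => /and5P[? ? ? ? /andP[? ?]].
have yxy : x <= y <= y by rewrite xy lexx.
have xxy : x <= x <= y by rewrite xy lexx.
have osc f : (forall t, x <= t <= y -> `|f t - f z| <= eta / 2) ->
    forall t, x <= t <= y -> `|f t - f y| <= eta.
  move=> Hf t txy; have := Hf t txy; have := Hf y yxy.
  rewrite distrC => h1 h2; have -> : f t - f y = f t - f z + (f z - f y) by ring.
  by apply: le_trans (ler_normD _ _) _; rewrite [leRHS]splitr lerD.
have bnd f : (forall t, x <= t <= y -> `|f t - f z| <= 1) ->
    forall t, x <= t <= y -> `|f t| <= `|f z| + 1.
  move=> Hf t txy; rewrite -[f t](subrK (f z)) addrC.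
  by apply: le_trans (ler_normD _ _) _; rewrite lerD2l Hf.
have E1 : `|J1 x y - integ (fun t => a t * h t) x y * u y| <=
    (`|h z| + 1) * eta * A x y.
  apply: integ_weight_osc => //.
    by apply: osc => t /Hr[? ? ? ? _]; exact: H1.
  by apply: bnd => t /Hr[? ? ? ? [? ?]]; exact: H6.
have E2 : `|J2 x y - integ (fun t => a t * w t) x y * phi y| <=
    (`|w z| + 1) * eta * A x y.
  apply: integ_weight_osc => //.
    by apply: osc => t /Hr[? ? ? ? _]; exact: H3.
  by apply: bnd => t /Hr[? ? ? ? [? ?]]; exact: H5.
have diff f f' : antiderivative c d f f' ->
    (forall t, x <= t <= y -> `|f' t - f' z| <= eta) ->
    `|f y - f x - f' z * (y - x)| <= eta * (y - x).
  move=> af Hf; have := af x y (f' z - eta) (f' z + eta) cx xy yd.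
  case/(_ _)/andP => [t txy|k1 k2]; first by rewrite -ler_distl; exact: Hf.
  by rewrite ler_distl -mulrBl -mulrDl k1.
have E3 : `|u y - u x - v z * (y - x)| <= eta * (y - x).
  by apply: diff => // t /Hr[? ? ? ? _]; exact: H2.
have E4 : `|phi y - phi x - psi z * (y - x)| <= eta * (y - x).
  by apply: diff => // t /Hr[? ? ? ? _]; exact: H4.
have E5 : `|v x - v z| <= eta by have [? ? ? ? _] := Hr _ xxy; exact: H2.
have E6 : `|psi x - psi z| <= eta by have [? ? ? ? _] := Hr _ xxy; exact: H4.
rewrite /Q.
(* Errors, in order: freezing phi and u at y under the integrals, replacing the increments of phi
   and u by their linear parts at z, and evaluating v and psi at x instead of z. *)
have -> : W y - W x - (J1 x y - J2 x y) =
    (J2 x y - integ (fun t => a t * w t) x y * phi y)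
  - (J1 x y - integ (fun t => a t * h t) x y * u y)
  + v x * (phi y - phi x - psi z * (y - x))
  - psi x * (u y - u x - v z * (y - x))
  + ((v x - v z) * psi z - (psi x - psi z) * v z) * (y - x).
  have := vE _ _ cx xy yd; have := psiE _ _ cx xy yd.
  set I1 := integ _ _ _; set I2 := integ _ _ _ => h1 h2.
  have -> : I1 = psi x - psi y by rewrite -[LHS]opprK -h1 opprB.
  have -> : I2 = v x - v y by rewrite -[LHS]opprK -h2 opprB.
  by rewrite /W; ring.
have yx0 : 0 <= y - x by rewrite subr_ge0.
have Axy := A_ge0 _ _ xy.
have vx : `|v x| <= `|v z| + 1.
  rewrite -[v x](subrK (v z)) addrC; apply: le_trans (ler_normD _ _) _.
  by rewrite lerD2l (le_trans E5).
have px : `|psi x| <= `|psi z| + 1.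
  rewrite -[psi x](subrK (psi z)) addrC; apply: le_trans (ler_normD _ _) _.
  by rewrite lerD2l (le_trans E6).
have E7 : `|v x * (phi y - phi x - psi z * (y - x))| <=
    (`|v z| + 1) * (eta * (y - x)) by rewrite normrM ler_pM.
have E8 : `|psi x * (u y - u x - v z * (y - x))| <=
    (`|psi z| + 1) * (eta * (y - x)) by rewrite normrM ler_pM.
have E9 : `|((v x - v z) * psi z - (psi x - psi z) * v z) * (y - x)| <=
    (eta * `|psi z| + eta * `|v z|) * (y - x).
  rewrite normrM (ger0_norm yx0) ler_wpM2r//.
  by apply: le_trans (ler_normB _ _) _; rewrite !normrM lerD// ler_wpM2r.
have tri (b1 b2 b3 b4 b5 : R) : `|b1 - b2 + b3 - b4 + b5| <=
    `|b1| + `|b2| + `|b3| + `|b4| + `|b5|.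
  apply: le_trans (ler_normD _ _) _; rewrite lerD2r.
  apply: le_trans (ler_normB _ _) _; rewrite lerD2r.
  apply: le_trans (ler_normD _ _) _; rewrite lerD2r.
  exact: ler_normB.
apply: le_trans (tri _ _ _ _ _) _.
apply: (@le_trans _ _ (K * eta * (A x y + (y - x)))); last first.
  by rewrite ler_wpM2r// addr_ge0.
have P1 : 0 <= eta * A x y by rewrite mulr_ge0// ltW.
have P2 : 0 <= eta * (y - x) by rewrite mulr_ge0// ltW.
exact: wronskian_arith.
Qed.

End Wronskian.

(** * A priori bound on an interval of nonnegative weight *)

Section SturmBound.
Context {R : realType}.
Implicit Types (T C K k lam al be c d x y z t : R) (a g u v phi psi : R -> R).

(* A nodal domain [c, d] of a Dirichlet eigenfunction phi on [al, be], with the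
   derivative psi of phi. *)
Definition nodal_domain a al be lam c d phi psi :=
  [/\ [/\ al <= c, c <= d, d <= be & al < be],
      [/\ continuous phi, continuous psi, antiderivative c d phi psi &
          forall x y, c <= x -> x <= y -> y <= d ->
            psi y - psi x = - integ (fun t => a t * (lam * phi t)) x y],
      [/\ phi c = 0, phi d = 0, forall x, c <= x <= d -> 0 <= phi x,
          0 <= psi c & psi d <= 0] &
      0 < integ (fun t => a t * (phi t * ((t - al) * (be - t)))) c d].

(** The Wronskian identity gives (k - lam) times the integral of a phi u at most K times that of a
    phi; concavity bounds u(t) (be - al)^2 below by u(y) (t - al) (be - t). Solving for u(y) gives
    this quotient. *)
Definition sturm_constant a al be lam c d phi k K : R :=
  K * integ (fun t => a t * phi t) c d * (be - al) ^+ 2 /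
  ((k - lam) * integ (fun t => a t * (phi t * ((t - al) * (be - t)))) c d).

Section Concave.
Variables (T C : R) (a g : R -> R) (al be : R) (u v : R -> R).
Hypotheses (sa : summable a) (aT : forall t, ~~ (0 <= t <= T) -> a t = 0).
Hypotheses (cg : continuous g) (g_ge0 : forall s, 0 <= g s).
Hypotheses (al0 : 0 <= al) (ab : al < be) (beT : be <= T).
Hypothesis (a_ge0 : forall t, al <= t <= be -> 0 <= a t).
Hypothesis (suv : solution T C a g u v).

Let cgu : continuous (g \o u).
Proof. by case: suv => cu _ _ _ _ x; apply: continuous_comp; [exact: cu|exact: cg]. Qed.

Lemma sol_decreasing x y : al <= x -> x <= y -> y <= be -> v y <= v x.
Proof.
move=> ax xy yb; have [_ _ vE _ _] := suv.
rewrite -subr_le0 vE ?(le_trans al0)// ?(le_trans yb)// oppr_le0.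
apply: integ_ge0 => //; first exact: (summable_weight sa aT cgu).
move=> t /andP[xt ty]; rewrite mulr_ge0// a_ge0//.
by rewrite (le_trans ax)// (le_trans ty).
Qed.

Lemma sol_slope x y : al <= x -> x <= y -> y <= be ->
  v y * (y - x) <= u y - u x <= v x * (y - x).
Proof.
move=> ax xy yb; have [_ _ _ au _] := suv.
apply: au => //; rewrite ?(le_trans al0)// ?(le_trans yb)//.
move=> z /andP[xz zy]; apply/andP; split; apply: sol_decreasing => //.
  exact: le_trans xz.
exact: le_trans yb.
Qed.

Hypothesis (u_ge0 : forall t, al <= t <= be -> 0 <= u t).

(** A nonnegative concave function lies above the chord from its value at y to 0 at the endpoint on
    the other side of x; the remaining factor, at most be - al, makes the bound the same on both
    sides of y. *)
Lemma sol_concave x y : al <= x <= be -> al <= y <= be ->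
  u y * ((x - al) * (be - x)) <= u x * (be - al) ^+ 2.
Proof.
move=> /andP[ax xb] /andP[ay yb].
have ua : 0 <= u al by rewrite u_ge0// lexx ltW.
have ub : 0 <= u be by rewrite u_ge0// lexx ltW.
have ux : 0 <= u x by rewrite u_ge0// ax.
have uy : 0 <= u y by rewrite u_ge0// ay.
have [xy|/ltW yx] := leP x y.
  have /andP[s1 _] := sol_slope (lexx al) ax xb.
  have /andP[_ s2] := sol_slope ax xy yb.
  have H : u y * (x - al) <= u x * (be - al).
    have h1 : (u y - u x) * (x - al) <= v x * (y - x) * (x - al).
      by rewrite ler_wpM2r// subr_ge0.
    have h2 : v x * (x - al) * (y - x) <= (u x - u al) * (y - x).
      by rewrite ler_wpM2r// subr_ge0.
    have h3 : 0 <= u al * (y - x) by rewrite mulr_ge0// subr_ge0.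
    have h4 : u x * (y - al) <= u x * (be - al) by rewrite ler_wpM2l//; lra.
    lra.
  have h5 : u y * (x - al) * (be - x) <= u x * (be - al) * (be - al).
    rewrite ler_pM//; [by rewrite mulr_ge0//; lra|lra|lra].
  lra.
have /andP[_ s1] := sol_slope ax xb (lexx be).
have /andP[s2 _] := sol_slope ay yx xb.
have H : u y * (be - x) <= u x * (be - al).
  have h1 : v x * (x - y) * (be - x) <= (u x - u y) * (be - x).
    by rewrite ler_wpM2r// subr_ge0.
  have h2 : (u be - u x) * (x - y) <= v x * (be - x) * (x - y).
    by rewrite ler_wpM2r// subr_ge0.
  have h3 : 0 <= u be * (x - y) by rewrite mulr_ge0// subr_ge0.
  have h4 : u x * (be - y) <= u x * (be - al) by rewrite ler_wpM2l//; lra.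
  lra.
have h5 : u y * (be - x) * (x - al) <= u x * (be - al) * (be - al).
  rewrite ler_pM//; [by rewrite mulr_ge0//; lra|lra|lra].
lra.
Qed.

(** The tangent at the midpoint lies above the concave u, hence is nonnegative at both ends. *)
Lemma sol_midpoint :
  `|v ((al + be) / 2)| * (be - al) <= 2 * u ((al + be) / 2).
Proof.
have ab' := ab; have am : al <= (al + be) / 2 by lra.
have mb : (al + be) / 2 <= be by lra.
have e1 : (al + be) / 2 - al = (be - al) / 2 by field.
have e2 : be - (al + be) / 2 = (be - al) / 2 by field.
move: ((al + be) / 2) => m in am mb e1 e2 *.

have ua : 0 <= u al by rewrite u_ge0// lexx ltW.
have ub : 0 <= u be by rewrite u_ge0// lexx ltW.
have /andP[s1 _] := sol_slope (lexx al) am mb.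
have /andP[_ s2] := sol_slope am mb (lexx be).
rewrite e1 in s1; rewrite e2 in s2.
by have [v0|v0] := ger0P (v m); lra.
Qed.

Variables (lam k K c d : R) (phi psi : R -> R).
Hypothesis nd : nodal_domain a al be lam c d phi psi.
Hypotheses (lamk : lam < k) (gk : forall s, 0 <= s -> k * s - K <= g s).

(** At the ends of the nodal domain phi vanishes and psi points inwards, so the boundary terms have
    a sign and the integral of a g(u) phi is at most lam times that of a phi u. With g(u) >= k u - K
    and k > lam the latter integral is bounded. *)
Lemma sturm_bound y : al <= y <= be ->
  u y <= sturm_constant a al be lam c d phi k K.
Proof.
move=> yI; have lk := lamk; have al_ge0 := al0; have be_leT := beT.
have [[ac cd db _] [cphi cpsi aphi psiE] [pc pd p0 sc sd] I0] := nd.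
have [cu cv vE au _] := suv.
set I := integ _ c d in I0; pose P := integ (fun t => a t * phi t) c d.
have c0 : 0 <= c by exact: le_trans ac.
have dT : d <= T by exact: le_trans beT.
have ch : continuous (fun t => lam * phi t).
  by move=> t; apply: cvgM; [exact: cvg_cst|exact: cphi].
have au' : antiderivative c d u v.
  by move=> x z m M cx xz zd; apply: au => //; lra.
have vE' x z : c <= x -> x <= z -> z <= d ->
    v z - v x = - integ (fun t => a t * g (u t)) x z.
  by move=> cx xz zd; apply: vE => //; lra.
have := wronskian sa aT cd cu cv cgu cphi cpsi ch au' aphi vE' psiE.
rewrite pc pd !mulr0 => W.
have cpu : continuous (fun t => phi t * u t).
  by move=> t; apply: cvgM; [exact: cphi|exact: cu].
have cgp : continuous (fun t => g (u t) * phi t).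
  by move=> t; apply: cvgM; [exact: cgu|exact: cphi].
have cq : continuous (fun t => phi t * ((t - al) * (be - t))).
  move=> t; apply: cvgM; [exact: cphi|apply: cvgM; apply: cvgB;
    by [exact: cvg_id|exact: cvg_cst]].
have s1 := summable_weight sa aT cpu; have s2 := summable_weight sa aT cgp.
have s3 := summable_weight sa aT cphi; have s4 := summable_weight sa aT cq.
have W' : integ (fun t => a t * (g (u t) * phi t)) c d <=
    lam * integ (fun t => a t * (phi t * u t)) c d.
  rewrite -integZ//.
  have -> : integ (fun t => lam * (a t * (phi t * u t))) c d =
      integ (fun t => a t * (lam * phi t * u t)) c d.
    by congr integ; apply/funext => t; ring.
  have h1 : 0 <= u c * psi c by rewrite mulr_ge0// u_ge0//; lra.
  have h2 : u d * psi d <= 0 by rewrite mulr_ge0_le0// u_ge0//; lra.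
  by move: W; rewrite /= !sub0r; set X := integ _ _ _; set Y := integ _ _ _; lra.
have G : k * integ (fun t => a t * (phi t * u t)) c d - K * P <=
    integ (fun t => a t * (g (u t) * phi t)) c d.
  rewrite /P -mulNr -!integZ// -integD//; [|exact: summableZ|exact: summableZ].
  apply: le_integ => //; first by apply: summableD; exact: summableZ.
  move=> t tcd; have ut : 0 <= u t by rewrite u_ge0//; lra.
  have ap : 0 <= a t * phi t by rewrite mulr_ge0 ?p0// a_ge0//; lra.
  have := ler_wpM2l ap (gk ut); lra.
have Q : u y * I <= (be - al) ^+ 2 * integ (fun t => a t * (phi t * u t)) c d.
  rewrite /I -!integZ//; apply: le_integ => //; [exact: summableZ|exact: summableZ|].
  move=> t tcd; have ap : 0 <= a t * phi t by rewrite mulr_ge0 ?p0// a_ge0//; lra.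
  have tI : al <= t <= be by lra.
  have := ler_wpM2l ap (sol_concave tI yI); lra.
have kl : 0 < k - lam by lra.
rewrite /sturm_constant -/I -/P ler_pdivlMr ?mulr_gt0//.
set Z := integ _ c d in G W' Q.
have h1 : (k - lam) * Z <= K * P by lra.
have h2 : (k - lam) * (u y * I) <= (k - lam) * ((be - al) ^+ 2 * Z).
  by rewrite ler_pM2l.
have h3 : (be - al) ^+ 2 * ((k - lam) * Z) <= (be - al) ^+ 2 * (K * P).
  by rewrite ler_wpM2l// sqr_ge0.
lra.
Qed.

End Concave.
End SturmBound.

(** * Behaviour of solutions with small initial data *)

Section SmallData.
Context {R : realType}.
Variables (T C : R) (a g : R -> R).
Hypotheses (T0 : 0 < T) (C0 : 0 <= C).
Hypotheses (sa : summable a) (aT : forall t, ~~ (0 <= t <= T) -> a t = 0).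
Hypothesis (a_int : integ a 0 T < 0).
Hypotheses (cg : continuous g) (gC : forall s, `|g s| <= C * `|s|).
Hypotheses (g_ge0 : forall s, 0 <= g s) (g_gt0 : forall s, 0 < s -> 0 < g s).
Hypothesis g_flat : forall e : R, 0 < e -> exists2 d : R, 0 < d &
  forall s t, `|s| <= d -> `|t| <= d -> `|g s - g t| <= e * `|s - t|.
Implicit Types (r x y t G : R) (u v : R -> R).

Let A := integ (fun t => `|a t|) 0 T.
Let E := gronwall T C a.

Let A0 : 0 <= A. Proof. by apply: integ_norm_ge0 => //; exact: ltW. Qed.
Let E1 : 1 <= E.
Proof. by rewrite -expR0 ler_expR addr_ge0 ?mulr_ge0// ltW. Qed.

Lemma sol_dv u v G x y : solution T C a g u v -> 0 <= x -> x <= y -> y <= T ->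
  (forall t, x <= t <= y -> g (u t) <= G) -> `|v y - v x| <= A * G.
Proof.
move=> [cu _ vE _ _] x0 xy yT uG.
have cgu : continuous (g \o u) by move=> t; apply: continuous_comp; [exact: cu|exact: cg].
have sw := summable_weight sa aT cgu.
rewrite vE// normrN; apply: le_trans (ler_norm_integ sw xy) _.
have G0 : 0 <= G by apply: le_trans (uG x _); rewrite ?lexx.
apply: (@le_trans _ _ (G * integ (fun t => `|a t|) x y)).
  rewrite -integZ//; last exact: summable_norm.
  apply: le_integ => //; [exact: summable_norm|exact/summableZ/summable_norm|].
  by move=> t txy; rewrite normrM mulrC ler_wpM2r// ger0_norm//= uG.
by rewrite mulrC ler_wpM2r// integ_norm_mono.
Qed.

Lemma sol_du u v x y m M : solution T C a g u v -> 0 <= x -> x <= y -> y <= T ->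
  (forall t, x <= t <= y -> m <= v t <= M) ->
  m * (y - x) <= u y - u x <= M * (y - x).
Proof. by move=> [_ _ _ au _] x0 xy yT; exact: au. Qed.

Lemma sol_tilt u v G : solution T C a g u v ->
  (forall t, 0 <= t <= T -> g (u t) <= G) ->
  forall x, 0 <= x <= T -> `|u x - u 0 - v 0 * x| <= A * G * x.
Proof.
move=> suv uG x /andP[x0 xT].
have := @sol_du u v 0 x (v 0 - A * G) (v 0 + A * G) suv (lexx 0) x0 xT.
case/(_ _)/andP => [t /andP[t0 tx]|h1 h2].
  rewrite -ler_distl; apply: sol_dv suv _ _ _ _ => //; first exact: le_trans xT.
  by move=> z /andP[z0 zt]; apply: uG; rewrite z0 (le_trans zt)// (le_trans tx).
by rewrite ler_norml; apply/andP; split; lra.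
Qed.

Lemma sol_max u v : solution T C a g u v -> exists2 z, 0 <= z <= T &
  forall t, 0 <= t <= T -> g (u t) <= g (u z).
Proof.
move=> [cu _ _ _ _]; have cgu : continuous (g \o u).
  by move=> t; apply: continuous_comp; [exact: cu|exact: cg].
have [z zT zP] := @EVT_max R (g \o u) 0 T (ltW T0) (continuous_subspaceT cgu).
exists z; first by move: zT; rewrite in_itv.
by move=> t tT; apply: zP; rewrite in_itv.
Qed.

(** Let G be the maximum of g(u). Both the slope at 0 and its variation are at most A G, so u varies
    by at most 2 A G T and, by [g_flat], g(u) varies by a small fraction of G itself. Hence v(T) -
    v(0) is close to - g(u(0)) times the integral of a. *)
Lemma small_core : exists2 d, 0 < d & forall u v, solution T C a g u v ->
  0 < u 0 -> size1 (u 0, v 0) <= d ->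
  (forall G, (forall t, 0 <= t <= T -> g (u t) <= G) -> `|v 0| <= A * G) ->
  v 0 < v T.
Proof.
pose I := - integ a 0 T; have I0 : 0 < I by rewrite oppr_gt0.
(* The first bound gives G <= 2 g(u(0)); with it the second keeps the error th G A below g(u(0))
   I. *)
pose th := Num.min (1 / 2) (I / (4 * (A + 1))).
have A0' := A0; have T0' := T0; have E1' := E1.
have A1 : 0 < 4 * (A + 1) by lra.
have th0 : 0 < th by rewrite lt_min !divr_gt0//; lra.
have th2 : th <= 1 / 2 by rewrite ge_min lexx.
have thI : th * (4 * (A + 1)) <= I by rewrite -ler_pdivlMr// ge_min lexx orbT.
have AT0 : 0 <= 2 * A * T by rewrite !mulr_ge0// ltW.
have AT1 : 0 < 2 * A * T + 1 by lra.
pose eta := th / (2 * A * T + 1).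
have eta0 : 0 < eta by rewrite divr_gt0.
have etath : eta * (2 * A * T) <= th.
  by rewrite /eta mulrAC ler_pdivrMr// ler_pM2l//; lra.
have [d d0 dP] := g_flat eta0.
(* By the Gronwall bound, data of size d / E keep |u| <= d. *)
exists (d / E); first by rewrite divr_gt0//; lra.
move=> u v suv u0 sz vG; have [cu cv vE au gr] := suv.
have ud t : 0 <= t <= T -> `|u t| <= d.
  move=> tT; have [h _] := gr t tT.
  apply: (@le_trans _ _ (size1 (u t, v t))); first by rewrite /size1/= lerDl.
  apply: (le_trans h); rewrite -/E -ler_pdivlMl; last by lra.
  by rewrite mulrC.
have T00 : 0 <= (0 : R) <= T by rewrite lexx ltW.
have [z zT zG] := sol_max suv; set G := g (u z) in zG.
have G0 : 0 <= G by rewrite g_ge0.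
have AG : 0 <= A * G by rewrite mulr_ge0.
have v0G := vG _ zG.
have ur t : 0 <= t <= T -> `|u t - u 0| <= 2 * A * G * T.
  move=> tT; have h1 := sol_tilt suv zG tT; have /andP[t0 tT'] := tT.
  have -> : u t - u 0 = (u t - u 0 - v 0 * t) + v 0 * t by ring.
  apply: le_trans (ler_normD _ _) _.
  have h2 : `|v 0 * t| <= A * G * t by rewrite normrM (ger0_norm t0) ler_wpM2r.
  have h3 : A * G * t <= A * G * T by rewrite ler_wpM2l.
  lra.
have gr' t : 0 <= t <= T -> `|g (u t) - g (u 0)| <= th * G.
  move=> tT; apply: le_trans (dP _ _ (ud _ tT) (ud _ T00)) _.
  apply: (@le_trans _ _ (eta * (2 * A * G * T))); first by rewrite ler_pM2l// ur.
  have -> : eta * (2 * A * G * T) = eta * (2 * A * T) * G by ring.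
  by rewrite ler_wpM2r.
have Gr : G <= 2 * g (u 0).
  have := gr' z zT; rewrite -/G => h; have := ler_norm (G - g (u 0)).
  have : th * G <= 1 / 2 * G by rewrite ler_wpM2r.
  lra.
have gr0 := g_gt0 u0.
have cgu : continuous (g \o u) by move=> t; apply: continuous_comp; [exact: cu|exact: cg].
have sw := summable_weight sa aT cgu.
have cd : continuous (fun t => g (u t) - g (u 0)).
  by move=> t; apply: cvgB; [exact: cgu|exact: cvg_cst].
have sd := summable_weight sa aT cd.
have V : v T - v 0 = g (u 0) * I - integ (fun t => a t * (g (u t) - g (u 0))) 0 T.
  rewrite vE ?(ltW T0)//.
  have -> : integ (fun t => a t * g (u t)) 0 T =
    integ (fun t => g (u 0) * a t + a t * (g (u t) - g (u 0))) 0 T.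
    by congr integ; apply/funext => t; ring.
  rewrite integD ?(ltW T0)//; last exact: summableZ.
  by rewrite integZ ?(ltW T0)// /I; ring.
have D : `|integ (fun t => a t * (g (u t) - g (u 0))) 0 T| <= th * G * A.
  apply: le_trans (ler_norm_integ sd (ltW T0)) _.
  rewrite /A -integZ ?(ltW T0)//; last exact: summable_norm.
  apply: le_integ; rewrite ?(ltW T0)//; [exact: summable_norm|exact/summableZ/summable_norm|].
  by move=> t tT; rewrite normrM mulrC ler_wpM2r// gr'.
have := ler_norm (integ (fun t => a t * (g (u t) - g (u 0))) 0 T).
move: D V; set D0 := integ _ 0 T => D V hD; rewrite ler_norml in D.
have /andP[D1 D2] := D.
have h1 : th * G * A <= th * (2 * g (u 0)) * A.
  by rewrite ler_wpM2r// ler_pM2l.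
have h2 : g (u 0) * (th * (4 * (A + 1))) <= g (u 0) * I by rewrite ler_pM2l.
have h3 : 0 < th * g (u 0) by rewrite mulr_gt0.
have h4 : 0 <= th * g (u 0) * A by rewrite mulr_ge0// ltW.
lra.
Qed.

(** The factor 1/4 suffices for u(T) > u(0) once v(0) >= u(0) > 0, as the error is then at most T
    v(0) / 2. *)
Lemma small_tilt : exists2 d, 0 < d & forall u v, solution T C a g u v ->
  size1 (u 0, v 0) <= d ->
  `|u T - u 0 - v 0 * T| <= T * (size1 (u 0, v 0) / 4).
Proof.
have A0' := A0; have T0' := T0; have E1' := E1.
have AE : 0 <= A * E by rewrite mulr_ge0//; lra.
have AE1 : 0 < 4 * (A * E + 1) by lra.
pose eta := 1 / (4 * (A * E + 1)).
have eta0 : 0 < eta by rewrite divr_gt0.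
have etaAE : eta * (A * E) <= 1 / 4.
  by rewrite /eta mulrAC ler_pdivrMr//; lra.
have [d d0 dP] := g_flat eta0.
exists (d / E); first by rewrite divr_gt0//; lra.
move=> u v suv sz; have [_ _ _ _ gr] := suv.
have g0 : g 0 = 0.
  by apply/eqP; rewrite -normr_eq0 eq_le normr_ge0 (le_trans (gC 0))// normr0 mulr0.
set w := size1 _ in sz *; have w0 : 0 <= w by exact: size1_ge0.
have uw t : 0 <= t <= T -> `|u t| <= E * w.
  move=> tT; have [h _] := gr t tT; apply: le_trans h.
  by rewrite /size1/= lerDl.
have ud t : 0 <= t <= T -> `|u t| <= d.
  move=> tT; apply: (le_trans (uw _ tT)); rewrite -ler_pdivlMl; last by lra.
  by rewrite mulrC.
have uG t : 0 <= t <= T -> g (u t) <= eta * (E * w).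
  move=> tT; rewrite -[g _]ger0_norm// -[g _]subr0 -g0.
  apply: le_trans (dP _ _ (ud _ tT) _) _; first by rewrite normr0 ltW.
  by rewrite subr0 ler_pM2l// uw.
have := @sol_tilt u v _ suv uG T; rewrite lexx ltW// => /(_ isT) h.
apply: (le_trans h).
have -> : A * (eta * (E * w)) * T = T * (eta * (A * E) * w) by ring.
by rewrite ler_pM2l//; have := ler_wpM2r w0 etaAE; lra.
Qed.

(* Were p < - d, w would become negative before x1. *)
Lemma steep_descent (w : R -> R) r p d x1 : continuous w -> 0 < r -> 0 < d ->
  x1 = 2 * r / d -> r <= d / (8 * (A * C + 1)) ->
  (forall x, 0 <= x <= x1 -> 0 <= w x) ->
  (forall B, 0 <= B -> (forall t, 0 <= t <= x1 -> w t <= B) ->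
    forall x, 0 <= x <= x1 -> w x <= r + (p + A * (C * B)) * x) ->
  - d <= p.
Proof.
move=> cw r0 d0 x1E rd w_ge0 wB; rewrite leNgt; apply/negP => pd.
have AC0 : 0 <= A * C by rewrite mulr_ge0.
have AC1 : 0 < 8 * (A * C + 1) by lra.
rewrite ler_pdivlMr// in rd.
have x10 : 0 < x1 by rewrite x1E divr_gt0//; lra.
have x1d : x1 * d = 2 * r by rewrite x1E divfK// gt_eqF.
have [z zI zP] := @EVT_max R w 0 x1 (ltW x10) (continuous_subspaceT cw).
have zI' : 0 <= z <= x1 by move: zI; rewrite in_itv.
have M0 := w_ge0 z zI'.
have wM t : 0 <= t <= x1 -> w t <= w z by move=> tI; apply: zP; rewrite in_itv.
have h1 := wB _ M0 wM z zI'.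
have /andP[z0 zx] := zI'.
have rAC : 8 * (r * (A * C)) <= d by lra.
have h2 : A * C * x1 <= 1 / 4.
  rewrite -(ler_pM2r d0).
  have -> : A * C * x1 * d = A * C * (x1 * d) by ring.
  rewrite x1d; lra.
have h3 : p * z <= 0 by rewrite mulr_le0_ge0//; lra.
have h4 : A * C * w z * z <= A * C * w z * x1 by rewrite ler_wpM2l// mulr_ge0.
have h5 : w z * (A * C * x1) <= w z * (1 / 4) by rewrite ler_wpM2l.
(* The term p z is nonpositive, so the maximum exceeds r by at most a quarter of itself. *)
have M2 : w z <= 2 * r by lra.
have wM2 t : 0 <= t <= x1 -> w t <= 2 * r by move=> tI; apply: le_trans (wM _ tI) M2.
have x1I : 0 <= x1 <= x1 by rewrite lexx ltW.
have r20 : 0 <= 2 * r by lra.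
(* At x1 the descent exceeds d x1 = 2 r, more than r plus the possible regain d x1 / 4 = r / 2. *)
have h6 := wB _ r20 wM2 x1 x1I.
have h7 := w_ge0 _ x1I.
have h8 : p * x1 < - d * x1 by rewrite ltr_pM2r.
have h9 : A * (C * (2 * r)) * x1 <= d / 4 * x1 by rewrite ler_pM2r//; lra.
lra.
Qed.

(** Nonnegativity excludes a steep initial descent. For v(0) <= r the slope is thus small, and u(T)
    = u(0) makes [small_core] applicable. For v(0) >= r, if v(T) >= v(0), the same argument in
    reversed time makes v(T), hence v(0), small, and [small_tilt] contradicts u(T) = r. *)
Lemma small_data : exists2 r : R, 0 < r & forall u v, solution T C a g u v ->
  u 0 = r -> [/\ v 0 = r -> r < u T,
   u T = r -> (forall x, 0 <= x <= T -> 0 <= u x) -> v 0 <= r -> v 0 < v T,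
   u T = r -> (forall x, 0 <= x <= T -> 0 <= u x) -> r <= v 0 -> v T < v 0 &
   v 0 = 0 -> v 0 < v T].
Proof.
have [d1 d10 H1] := small_core; have [d2 d20 H2] := small_tilt.
have A0' := A0; have T0' := T0; have C0' := C0.
pose d := Num.min d1 d2; have d0 : 0 < d by rewrite lt_min d10.
have dd1 : d <= d1 by rewrite ge_min lexx.
have dd2 : d <= d2 by rewrite ge_min lexx orbT.
pose d' := d / 2; have d'0 : 0 < d' by rewrite divr_gt0.
have AC0 : 0 <= A * C by rewrite mulr_ge0.
(* The three bounds keep the data within size d = 2 d', the descent time x1 within [0, T], and r
   within the range of [steep_descent]. *)
pose r := Num.min d' (Num.min (T * d' / 2) (d' / (8 * (A * C + 1)))).
have r0 : 0 < r by rewrite !lt_min d'0 !divr_gt0 ?mulr_gt0//; lra.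
have rd' : r <= d' by rewrite ge_min lexx.
have rT : r <= T * d' / 2 by rewrite !ge_min lexx !orbT.
have rAC : r <= d' / (8 * (A * C + 1)) by rewrite !ge_min lexx !orbT.
have dE : d = 2 * d' by rewrite /d' mulrC divfK.
pose x1 := 2 * r / d'.
have x10 : 0 <= x1 by rewrite divr_ge0 ?mulr_ge0// ltW.
have x1T : x1 <= T by rewrite ler_pdivrMr//; lra.
exists r => // u v suv u0; have [cu cv vE au gr] := suv.
have tilt : `|v 0| <= d' -> `|u T - r - v 0 * T| <= T * ((r + `|v 0|) / 4).
  move=> vd; have := H2 _ _ suv; rewrite /size1/= u0 (gtr0_norm r0).
  by apply; lra.
have core : `|v 0| <= d' -> (forall G, (forall t, 0 <= t <= T -> g (u t) <= G) ->
    `|v 0| <= A * G) -> v 0 < v T.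
  move=> vd; apply: H1 => //; first by rewrite u0.
  by rewrite /size1/= u0 (gtr0_norm r0); lra.
have tilt_r : r <= v 0 -> v 0 <= d' -> r < u T.
  move=> rv vd; have v0p : 0 <= v 0 by lra.
  have := tilt; rewrite (ger0_norm v0p) => /(_ vd); rewrite ler_norml => /andP[h _].
  have : 0 < T * v 0 by rewrite mulr_gt0//; lra.
  have : T * r <= T * v 0 by rewrite ler_pM2l.
  lra.
have fwd : (forall x, 0 <= x <= T -> 0 <= u x) -> - d' <= v 0.
  move=> up; apply: (@steep_descent u r (v 0) d' x1) => //.
    by move=> x /andP[x0 xx]; apply: up; rewrite x0 (le_trans xx).
  move=> B B0 uB x /andP[x0 xx].
  have := @sol_du u v 0 x (- A * (C * B) + v 0) (v 0 + A * (C * B)) suv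
    (lexx 0) x0 (le_trans xx x1T).
  case/(_ _)/andP => [t /andP[t0 tx]|_ h]; last by rewrite u0 subr0 in h; lra.
  have zG z : 0 <= z <= t -> g (u z) <= C * B.
    move=> /andP[z0 zt].
    have zx1 : 0 <= z <= x1 by rewrite z0 (le_trans zt)// (le_trans tx).
    apply: le_trans (le_trans (ler_norm _) (gC _)) _.
    rewrite ler_wpM2l// ger0_norm ?uB// up// z0/= (le_trans zt)//.
    by rewrite (le_trans tx)// (le_trans xx).
  have := sol_dv suv (lexx 0) t0 (le_trans tx (le_trans xx x1T)) zG.
  by rewrite ler_norml => /andP[? ?]; apply/andP; split; lra.
have bwd : u T = r -> (forall x, 0 <= x <= T -> 0 <= u x) -> v T <= d'.
  move=> uT up; rewrite -lerN2.
  apply: (@steep_descent (fun x => u (T - x)) r (- v T) d' x1) => //.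
  - move=> x; apply: (@continuous_comp _ _ _ (fun x => T - x) u); last exact: cu.
    by apply: cvgB; [exact: cvg_cst|exact: cvg_id].
  - by move=> x /andP[x0 xx]; apply: up; apply/andP; split; lra.
  move=> B B0 uB x /andP[x0 xx].
  have Tx : 0 <= T - x by lra.
  have TxT : T - x <= T by lra.
  have := @sol_du u v (T - x) T (v T - A * (C * B)) (v T + A * (C * B)) suv Tx TxT (lexx T).
  case/(_ _)/andP => [t /andP[t0 tx]|h _]; last first.
    by rewrite uT subKr in h; lra.
  have zG z : t <= z <= T -> g (u z) <= C * B.
    move=> /andP[z0 zt].
    have zx1 : 0 <= T - z <= x1 by apply/andP; split; lra.
    apply: le_trans (le_trans (ler_norm _) (gC _)) _.
    rewrite ler_wpM2l// ger0_norm; last by apply: up; apply/andP; split; lra.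
    by have := uB _ zx1; rewrite subKr.
  have := sol_dv suv (le_trans Tx t0) tx (lexx T) zG.
  by rewrite ler_norml => /andP[? ?]; apply/andP; split; lra.
split.
- by move=> v0; apply: tilt_r; rewrite v0.
- move=> uT up v0r; apply: core.
    by rewrite ler_norml; apply/andP; split; [exact: fwd|lra].
  (* With u(T) = u(0) the tilt estimate reads |v(0)| T <= A G T, the hypothesis of [small_core]. *)
  move=> G uG; have := @sol_tilt u v G suv uG T; rewrite lexx ltW// => /(_ isT).
  rewrite u0 uT subrr sub0r normrN normrM (gtr0_norm T0).
  by rewrite ler_pM2r.
- move=> uT up rv; rewrite ltNge; apply/negP => vT.
  have vd := le_trans vT (bwd uT up).
  by have := tilt_r rv vd; rewrite uT ltxx.
- move=> v0; apply: core => [|G uG]; rewrite v0 normr0; first exact: ltW.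
  rewrite mulr_ge0//; apply: le_trans (uG 0 _); first exact: g_ge0.
  by rewrite lexx ltW.
Qed.

End SmallData.

(** * Sign of the slope at one-sided minima *)

Section Extrema.
Context {R : realType}.
Implicit Types (c d x y z : R) (u v : R -> R).

Lemma antiderivativeN c d u v : antiderivative c d u v ->
  antiderivative c d (fun x => - u x) (fun x => - v x).
Proof.
move=> au x y m M cx xy yd mM.
have := au x y (- M) (- m) cx xy yd.
case/(_ _)/andP => [z /mM /andP[h1 h2]|h1 h2]; apply/andP; split; lra.
Qed.

Lemma left_min c d u v z : continuous v -> antiderivative c d u v ->
  c < z -> z <= d -> (forall x, c <= x <= z -> u z <= u x) -> v z <= 0.
Proof.
move=> cv au cz zd uz; rewrite leNgt; apply/negP => vz.
have v20 : 0 < v z / 2 by lra.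
have [r r0 rP] := continuous_local z cv v20.
pose x := Num.max c (z - r / 2).
have cx : c <= x by rewrite le_max lexx.
have xz : x < z by rewrite gt_max cz/=; lra.
have xr : z - r / 2 <= x by rewrite le_max lexx orbT.
have := au x z (v z / 2) (2 * v z) cx (ltW xz) zd.
case/(_ _)/andP => [t /andP[xt tz]|h _].
  have := rP t; rewrite ler_norml; case/(_ _)/andP => [|h1 h2].
    by rewrite ltr_norml; apply/andP; split; lra.
  by apply/andP; split; lra.
have h' : u z <= u x by apply: uz; rewrite cx ltW.
have h2 : 0 < v z / 2 * (z - x) by rewrite mulr_gt0// subr_gt0.
lra.
Qed.

Lemma right_min c d u v z : continuous v -> antiderivative c d u v ->
  c <= z -> z < d -> (forall x, z <= x <= d -> u z <= u x) -> 0 <= v z.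
Proof.
move=> cv au cz zd uz; rewrite leNgt; apply/negP => vz.
have v20 : 0 < - v z / 2 by lra.
have [r r0 rP] := continuous_local z cv v20.
pose x := Num.min d (z + r / 2).
have xd : x <= d by rewrite ge_min lexx.
have zx : z < x by rewrite lt_min zd/=; lra.
have xr : x <= z + r / 2 by rewrite ge_min lexx orbT.
have := au z x (2 * v z) (v z / 2) cz (ltW zx) xd.
case/(_ _)/andP => [t /andP[zt tx]|_ h].
  have := rP t; rewrite ler_norml; case/(_ _)/andP => [|h1 h2].
    by rewrite ltr_norml; apply/andP; split; lra.
  by apply/andP; split; lra.
have h' : u z <= u x by apply: uz; rewrite xd ltW.
have h2 : 0 < - v z / 2 * (x - z) by rewrite mulr_gt0// subr_gt0.
lra.
Qed.

End Extrema.

(** * Solving the truncated boundary value problems *)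

Section TruncatedProblem.
Context {R : realType}.
Variables (T C : R) (a g : R -> R).
Hypotheses (T0 : 0 < T) (C0 : 0 <= C).
Hypotheses (sa : summable a) (aT : forall t, ~~ (0 <= t <= T) -> a t = 0).
Hypothesis (a_int : integ a 0 T < 0).
Hypotheses (cg : continuous g) (gC : forall s, `|g s| <= C * `|s|).
Hypotheses (g_ge0 : forall s, 0 <= g s) (g_gt0 : forall s, 0 < s -> 0 < g s).
Hypothesis gneg : forall s, s <= 0 -> g s = 0.
Hypothesis g_flat : forall e : R, 0 < e -> exists2 d : R, 0 < d &
  forall s t, `|s| <= d -> `|t| <= d -> `|g s - g t| <= e * `|s - t|.
Variables (al be lam k K c d : R) (phi psi : R -> R).
Hypotheses (al0 : 0 <= al) (beT : be <= T).
Hypothesis (a_ge0 : forall t, al <= t <= be -> 0 <= a t).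
Hypothesis nd : nodal_domain a al be lam c d phi psi.
Hypotheses (lamk : lam < k) (gk : forall s, 0 <= s -> k * s - K <= g s).
Implicit Types (r x y t : R) (u v : R -> R) (p : R * R).

Let E := gronwall T C a.

Let E0 : 0 <= E. Proof. exact: expR_ge0. Qed.

(** At the midpoint of the interval u is bounded by [sturm_bound] and v by [sol_midpoint]; the
    backward Gronwall inequality carries both to time 0. *)
Lemma nonneg_sol_bounded : exists C1 : R, 0 <= C1 /\ forall u v,
  solution T C a g u v -> (forall x, 0 <= x <= T -> 0 <= u x) ->
  size1 (u 0, v 0) <= C1.
Proof.
have [[_ _ _ ab] _ _ _] := nd; have ab0 : 0 < be - al by rewrite subr_gt0.
have al0' := al0; have beT' := beT.
pose S := sturm_constant a al be lam c d phi k K.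
exists (E * Num.max 0 (S + 2 * S / (be - al))).
split=> [|u v suv up]; first by rewrite mulr_ge0// le_max lexx.
have upI t : al <= t <= be -> 0 <= u t by move=> tI; apply: up; lra.
pose m := (al + be) / 2; have mI : al <= m <= be by rewrite /m; lra.
have uS := sturm_bound sa aT cg g_ge0 al0 ab beT a_ge0 suv upI nd lamk gk mI.
have vS := sol_midpoint sa aT cg g_ge0 al0 ab beT a_ge0 suv upI.
have mT : 0 <= m <= T by rewrite /m; lra.
have [_ _ _ _ gr] := suv; have [_ h] := gr m mT.
apply: (le_trans h); rewrite ler_wpM2l// le_max; apply/orP; right.
rewrite /size1/= (ger0_norm (upI _ mI)) lerD//.
rewrite ler_pdivlMr//; apply: (le_trans vS); rewrite -/m ler_pM2l//.
Qed.

(** A zero of u is a minimum, so the slope vanishes there too, and the backward Gronwall inequality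
    annihilates the initial data. At T a minimum controls the slope from one side only, hence the
    extra hypothesis. *)
Lemma nonneg_sol_pos u v : solution T C a g u v ->
  (forall x, 0 <= x <= T -> 0 <= u x) -> 0 < u 0 -> (u T = 0 -> v T = 0) ->
  forall x, 0 <= x <= T -> 0 < u x.
Proof.
move=> suv up u0 uvT x xT; rewrite lt_neqAle up// andbT eq_sym.
apply/eqP => ux; have [cu cv _ au gr] := suv.
have vx : v x = 0.
  have /andP[x0 xT'] := xT.
  have {}x0 : 0 < x.
    by rewrite lt_neqAle x0 andbT; apply/eqP => x0'; rewrite -x0' in ux; lra.
  have [xe|xne] := eqVneq x T; first by rewrite xe uvT// -xe.
  have {}xT' : x < T by rewrite lt_neqAle xne.
  apply/eqP; rewrite eq_le; apply/andP; split.
    apply: (left_min cv au x0 (ltW xT')) => y /andP[y0 yx].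
    by rewrite ux up// y0 (le_trans yx)// ltW.
  apply: (right_min cv au (ltW x0) xT') => y /andP[xy yT].
  by rewrite ux up// yT (le_trans _ xy)// ltW.
have [_] := gr x xT; rewrite ux vx /size1/= normr0 addr0 mulr0.
by have := normr_ge0 (v 0); have := ler_norm (u 0); lra.
Qed.

Local Notation final n p := (scheme T a g n p n).

(** Transfer from exact solutions to all fine schemes, uniformly for data of size at most L. The
    last premise offers nonnegativity of the limit when the violating discrete solutions meet the
    conditions of [scheme_pos]. *)
Lemma scheme_eventually (L : R) (good : nat -> R * R -> Prop) :
  (forall (U : set_system nat) (N : nat -> nat) (p : nat -> R * R) u v,
    UltraFilter U -> (forall j, j < N j)%N -> (forall j, ~ good (N j) (p j)) ->
    solution T C a g u v ->
    (fun j => (p j).1) @ U --> u 0 -> (fun j => (p j).2) @ U --> v 0 ->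
    (fun j => (final (N j) (p j)).1) @ U --> u T ->
    (fun j => (final (N j) (p j)).2) @ U --> v T ->
    ((forall j, 0 < (p j).1 /\
      (0 < (final (N j) (p j)).1 \/ 0 <= (final (N j) (p j)).2)) ->
     forall x, 0 <= x <= T -> 0 <= u x) -> False) ->
  exists N0, forall n, (N0 < n)%N -> forall p, size1 p <= L -> good n p.
Proof.
move=> H; apply: contrapT => nex.
have ex j : exists np : nat * (R * R),
    [/\ (j < np.1)%N, size1 np.2 <= L & ~ good np.1 np.2].
  apply: contrapT => nj; apply: nex; exists j => n jn p pL.
  by apply: contrapT => ng; apply: nj; exists (n, p).
have [np npP] := choice ex.
have [U [UU ooU]] := ultra_oo.
have N1 j : (j < (np j).1)%N by have [] := npP j.
have p1 j : size1 (np j).2 <= L by have [] := npP j.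
have ng j : ~ good (np j).1 (np j).2 by have [] := npP j.
have [u [v [[suv h1 h2 h3 h4] hpos]]] :=
  scheme_limit T0 C0 sa aT cg gC ooU N1 p1.
apply: (H U _ _ u v UU N1 ng suv h1 h2 h3 h4) => Hp; apply: hpos.
apply: filterE => j k' kN; have [q1 q2] := Hp j.
by apply: scheme_pos q1 q2 _ kN => //; exact: leq_ltn_trans (N1 j).
Qed.

(** Passage from discrete to exact solutions of a boundary value problem; the lower bound r on u(0)
    excludes the trivial solution. *)
Lemma scheme_zero_limit (L r : R) (bc : nat -> R * R -> Prop) : 0 < r ->
  (exists N0, forall n, (N0 < n)%N -> exists p, [/\ size1 p <= L, r <= p.1,
     0 < (final n p).1 \/ 0 <= (final n p).2 & bc n p]) ->
  exists (U : set_system nat) (N : nat -> nat) (p : nat -> R * R) u v,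
    [/\ UltraFilter U, forall j, bc (N j) (p j), solution T C a g u v,
    (forall x, 0 <= x <= T -> 0 <= u x) /\ r <= u 0 &
    [/\ (fun j => (p j).1) @ U --> u 0, (fun j => (p j).2) @ U --> v 0,
    (fun j => (final (N j) (p j)).1) @ U --> u T &
    (fun j => (final (N j) (p j)).2) @ U --> v T]].
Proof.
move=> r0 [N0 N0P].
have ex j := N0P (N0 + j).+1 (leq_addr j N0).
have [p pP] := choice ex.
have [U [UU ooU]] := ultra_oo.
have N1 j : (j < (N0 + j).+1)%N by rewrite ltnS leq_addl.
have p1 j : size1 (p j) <= L by have [] := pP j.
have [u [v [[suv h1 h2 h3 h4] hpos]]] :=
  scheme_limit T0 C0 sa aT cg gC ooU N1 p1.
exists U, (fun j => (N0 + j).+1), p, u, v; split => //.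
- by move=> j; have [] := pP j.
- split; last by apply: flim_ge h1 _; apply: filterE => j; have [] := pP j.
  apply: hpos; apply: filterE => j k' kN; have [_ q1 q2 _] := pP j.
  by apply: scheme_pos q2 _ kN => //; exact: lt_le_trans q1.
Qed.

Lemma ultra_eq (U : set_system nat) (UU : UltraFilter U) (s t : nat -> R) (l m : R) :
  s @ U --> l -> t @ U --> m -> (forall j, s j = t j) -> l = m.
Proof.
move=> sl tm /funext st; rewrite st in sl.
apply/eqP; rewrite eq_le; apply/andP; split; rewrite -subr_ge0.
  by apply: flim_ge (cvgB tm sl) _; apply: filterE => j; rewrite /= subrr.
by apply: flim_ge (cvgB sl tm) _; apply: filterE => j; rewrite /= subrr.
Qed.

Lemma ultra_le (U : set_system nat) (UU : UltraFilter U) (s t : nat -> R) (l m : R) :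
  s @ U --> l -> t @ U --> m -> (forall j, s j <= t j) -> l <= m.
Proof.
move=> sl tm st; rewrite -subr_ge0.
by apply: flim_ge (cvgB tm sl) _; apply: filterE => j; rewrite /= subr_ge0.
Qed.

Lemma ultra_cst (U : set_system nat) (UU : UltraFilter U) (l : R) :
  (fun _ : nat => l) @ U --> l.
Proof. exact: cvg_cst. Qed.

Lemma periodic_truncated : exists u v, [/\ solution T C a g u v,
  forall x, 0 <= x <= T -> 0 < u x, u T = u 0 & v T = v 0].
Proof.
have [r r0 small] := small_data T0 C0 sa aT a_int cg gC g_ge0 g_gt0 g_flat.
have [C1 [C10 C1P]] := nonneg_sol_bounded.
(* With this S all data on the sides x = S and y = r - S, r + S have size at least C1 + 1, more than
   nonnegative solutions allow. *)
pose S := C1 + r + 1; have S0 : 0 < S by rewrite /S; lra.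
have rS : r < S by rewrite /S; lra.
pose L := S + S + S + r.
have out : exists N, forall n, (N < n)%N -> forall p, size1 p <= L ->
    r <= p.1 -> C1 + 1 <= size1 p -> (final n p).1 - p.1 < 0.
  apply: scheme_eventually => U N p u v UU NP ng suv u0 v0 uT vT up.
  have ng' j : [/\ r <= (p j).1, C1 + 1 <= size1 (p j) &
      (p j).1 <= (final (N j) (p j)).1].
    have /not_implyP[h1 /not_implyP[h2 /negP h3]] := ng j.
    by split => //; rewrite -subr_ge0 leNgt.
  have u_ge0 x : 0 <= x <= T -> 0 <= u x.
    apply: up => j; have [h1 _ h3] := ng' j.
    have p0 : 0 < (p j).1 by lra.
    by split => //; left; lra.
  have := C1P u v suv u_ge0; apply/negP; rewrite -ltNge.
  apply: (@lt_le_trans _ _ (C1 + 1)); first by lra.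
  have sz : (fun j => size1 (p j)) @ U --> size1 (u 0, v 0).
    by apply: cvgD; exact: cvg_norm.
  by apply: (ultra_le UU (@ultra_cst U UU (C1 + 1)) sz) => j; have [] := ng' j.
have mid : exists N, forall n, (N < n)%N -> forall p, size1 p <= L ->
    p = (r, r) -> 0 < (final n p).1 - p.1.
  apply: scheme_eventually => U N p u v UU NP ng suv u0 v0 uT vT _.
  have ng' j : p j = (r, r) /\ (final (N j) (p j)).1 <= (p j).1.
    by have /not_implyP[h1 /negP h2] := ng j; rewrite -subr_le0 leNgt.
  have u0r : u 0 = r.
    by apply: (ultra_eq UU u0 (@ultra_cst U UU r)) => j; have [->] := ng' j.
  have v0r : v 0 = r.
    by apply: (ultra_eq UU v0 (@ultra_cst U UU r)) => j; have [->] := ng' j.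
  have uTr : u T <= u 0 by apply: (ultra_le UU uT u0) => j; have [] := ng' j.
  by have [h _ _ _] := small u v suv u0r; have := h v0r; lra.
have low : exists N, forall n, (N < n)%N -> forall p, size1 p <= L ->
    p.1 = r -> p.2 <= r -> (final n p).1 - p.1 = 0 -> 0 < (final n p).2 - p.2.
  apply: scheme_eventually => U N p u v UU NP ng suv u0 v0 uT vT up.
  have ng' j : [/\ (p j).1 = r, (p j).2 <= r, (final (N j) (p j)).1 = r &
      (final (N j) (p j)).2 <= (p j).2].
    have /not_implyP[h1 /not_implyP[h2 /not_implyP[h3 /negP h4]]] := ng j.
    split => //; last by rewrite -subr_le0 leNgt.
    by rewrite -h1; apply/eqP; rewrite -subr_eq0 h3.
  have u0r : u 0 = r.
    by apply: (ultra_eq UU u0 (@ultra_cst U UU r)) => j; have [] := ng' j.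
  have uTr : u T = r.
    by apply: (ultra_eq UU uT (@ultra_cst U UU r)) => j; have [] := ng' j.
  have v0r : v 0 <= r.
    by apply: (ultra_le UU v0 (@ultra_cst U UU r)) => j; have [] := ng' j.
  have vTv : v T <= v 0 by apply: (ultra_le UU vT v0) => j; have [] := ng' j.
  have u_ge0 x : 0 <= x <= T -> 0 <= u x.
    by apply: up => j; have [-> _ -> _] := ng' j; split => //; left.
  by have [_ h _ _] := small u v suv u0r; have := h uTr u_ge0 v0r; lra.
have high : exists N, forall n, (N < n)%N -> forall p, size1 p <= L ->
    p.1 = r -> r <= p.2 -> (final n p).1 - p.1 = 0 -> (final n p).2 - p.2 < 0.
  apply: scheme_eventually => U N p u v UU NP ng suv u0 v0 uT vT up.
  have ng' j : [/\ (p j).1 = r, r <= (p j).2, (final (N j) (p j)).1 = r &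
      (p j).2 <= (final (N j) (p j)).2].
    have /not_implyP[h1 /not_implyP[h2 /not_implyP[h3 /negP h4]]] := ng j.
    split => //; last by rewrite -subr_ge0 leNgt.
    by rewrite -h1; apply/eqP; rewrite -subr_eq0 h3.
  have u0r : u 0 = r.
    by apply: (ultra_eq UU u0 (@ultra_cst U UU r)) => j; have [] := ng' j.
  have uTr : u T = r.
    by apply: (ultra_eq UU uT (@ultra_cst U UU r)) => j; have [] := ng' j.
  have v0r : r <= v 0.
    by apply: (ultra_le UU (@ultra_cst U UU r) v0) => j; have [] := ng' j.
  have vTv : v 0 <= v T by apply: (ultra_le UU v0 vT) => j; have [] := ng' j.
  have u_ge0 x : 0 <= x <= T -> 0 <= u x.
    by apply: up => j; have [-> _ -> _] := ng' j; split => //; left.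
  by have [_ _ h _] := small u v suv u0r; have := h uTr u_ge0 v0r; lra.
have [N1 out'] := out; have [N2 mid'] := mid.
have [N3 low'] := low; have [N4 high'] := high.
have exz : exists N0, forall n, (N0 < n)%N -> exists p, [/\ size1 p <= L, r <= p.1,
     0 < (final n p).1 \/ 0 <= (final n p).2 &
     (final n p).1 = p.1 /\ (final n p).2 = p.2].
  exists (maxn (maxn N1 N2) (maxn N3 N4)) => n.
  rewrite !gtn_max => /andP[/andP[n1 n2] /andP[n3 n4]].
  have sL x y : r <= x <= S -> r - S <= y <= r + S -> size1 (x, y) <= L.
    move=> xS /andP[y1 y2]; rewrite /size1/= ger0_norm; last by lra.
    have : `|y| <= r + S by rewrite ler_norml; apply/andP; split; lra.
    by rewrite /L; lra.
  have cf : continuous (fun p => final n p).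
    exact: scheme_continuous.
  have [||||||||||p [p1 p2 A0 B0]] := @planar_zero R
    (fun p => (final n p).1 - p.1) (fun p => (final n p).2 - p.2) r S r S => //.
  - move=> p; apply: cvgB; last exact: cvg_fst.
    by apply: cvg_comp (cf p) _; exact: cvg_fst.
  - move=> p; apply: cvgB; last exact: cvg_snd.
    by apply: cvg_comp (cf p) _; exact: cvg_snd.
  - move=> y yI; apply: (out' n n1 (S, y)).
    + by apply: sL => //; rewrite ltW//= lexx.
    + exact: ltW.
    + by rewrite /size1/= gtr0_norm// /S; have := normr_ge0 y; lra.
  - move=> x xI; apply: (out' n n1 (x, r - S)).
    + by apply: sL => //; apply/andP; split; lra.
    + by case/andP: xI.
    + rewrite /size1/= (ler0_norm (_ : r - S <= 0)); last by lra.
      by rewrite /S; have := normr_ge0 x; lra.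
  - move=> x xI; apply: (out' n n1 (x, r + S)).
    + by apply: sL => //; apply/andP; split; lra.
    + by case/andP: xI.
    + rewrite /size1/= (gtr0_norm (_ : 0 < r + S)); last by lra.
      by rewrite /S; have := normr_ge0 x; lra.
  - apply: (mid' n n2 (r, r)) => //; apply: sL; first by rewrite lexx ltW.
    by apply/andP; split; lra.
  - move=> y /andP[y1 y2]; apply: (low' n n3 (r, y)) => //.
    by apply: sL; [rewrite lexx ltW|apply/andP; split; lra].
  - move=> y /andP[y1 y2]; apply: (high' n n4 (r, y)) => //.
    by apply: sL; [rewrite lexx ltW|apply/andP; split; lra].
  have e1 : (final n p).1 = p.1 by apply/eqP; rewrite -subr_eq0 A0.
  have e2 : (final n p).2 = p.2 by apply/eqP; rewrite -subr_eq0 B0.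
  exists p; split => //.
  - by case: p p1 p2 {A0 B0 e1 e2} => x y; exact: sL.
  - by case/andP: p1.
  - by left; rewrite e1; case/andP: p1 => h _; lra.
have [U [N [p [u [v [UU bc suv [u_ge0 ru0] [u0 v0 uT vT]]]]]]] :=
  scheme_zero_limit r0 exz.
have uT0 : u T = u 0 by apply: (ultra_eq UU uT u0) => j; have [] := bc j.
have vT0 : v T = v 0 by apply: (ultra_eq UU vT v0) => j; have [] := bc j.
have u00 := lt_le_trans r0 ru0.
exists u, v; split => //; apply: (nonneg_sol_pos suv) => //.
by rewrite uT0 => uz; rewrite uz ltxx in u00.
Qed.

Lemma neumann_truncated : exists u v, [/\ solution T C a g u v,
  forall x, 0 <= x <= T -> 0 < u x, v 0 = 0 & v T = 0].
Proof.
have [r r0 small] := small_data T0 C0 sa aT a_int cg gC g_ge0 g_gt0 g_flat.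
have [C1 [C10 C1P]] := nonneg_sol_bounded.
pose S := C1 + r + 1; have S0 : 0 < S by rewrite /S; lra.
have rS : r < S by rewrite /S; lra.
(* A nonnegative final slope would make the limit solution nonnegative, by the second alternative in
   [scheme_pos], although u(0) = S exceeds C1. *)
have out : exists N, forall n, (N < n)%N -> forall p, size1 p <= S ->
    p = (S, 0) -> (final n p).2 < 0.
  apply: scheme_eventually => U N p u v UU NP ng suv u0 v0 uT vT up.
  have ng' j : p j = (S, 0) /\ 0 <= (final (N j) (p j)).2.
    by have /not_implyP[h1 /negP h2] := ng j; rewrite leNgt.
  have u_ge0 x : 0 <= x <= T -> 0 <= u x.
    by apply: up => j; have [h1 h2] := ng' j; split; [rewrite h1|right].
  have := C1P u v suv u_ge0; rewrite /size1/=.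
  have -> : u 0 = S.
    by apply: (ultra_eq UU u0 (@ultra_cst U UU S)) => j; have [->] := ng' j.
  by rewrite gtr0_norm//; have := normr_ge0 (v 0); rewrite /S; lra.
have low : exists N, forall n, (N < n)%N -> forall p, size1 p <= S ->
    p = (r, 0) -> 0 < (final n p).2.
  apply: scheme_eventually => U N p u v UU NP ng suv u0 v0 uT vT _.
  have ng' j : p j = (r, 0) /\ (final (N j) (p j)).2 <= 0.
    by have /not_implyP[h1 /negP h2] := ng j; rewrite leNgt.
  have u0r : u 0 = r.
    by apply: (ultra_eq UU u0 (@ultra_cst U UU r)) => j; have [->] := ng' j.
  have v00 : v 0 = 0.
    by apply: (ultra_eq UU v0 (@ultra_cst U UU 0)) => j; have [->] := ng' j.
  have vTr : v T <= 0.
    by apply: (ultra_le UU vT (@ultra_cst U UU 0)) => j; have [] := ng' j.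
  by have [_ _ _ h] := small u v suv u0r; have := h v00; lra.
have [N1 out'] := out; have [N2 low'] := low.
have exz : exists N0, forall n, (N0 < n)%N -> exists p, [/\ size1 p <= S, r <= p.1,
     0 < (final n p).1 \/ 0 <= (final n p).2 &
     p.2 = 0 /\ (final n p).2 = 0].
  exists (maxn N1 N2) => n; rewrite gtn_max => /andP[n1 n2].
  have sS x : r <= x <= S -> size1 (x, 0) <= S.
    by move=> xS; rewrite /size1/= normr0 addr0 ger0_norm; lra.
  have cf : continuous (fun x => (final n (x, 0)).2).
    move=> x; have h : (fun y : R => (y, 0 : R)) @ x --> (x, 0 : R).
      exact: cvg_pair cvg_id (cvg_cst _).
    apply: (cvg_comp _ (fun p => (final n p).2) h).
    have cs : continuous (fun p => final n p) by exact: scheme_continuous.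
    by apply: cvg_comp (cs (x, 0)) _; exact: cvg_snd.
  have fS : (final n (S, 0)).2 < 0.
    by apply: out' => //; apply: sS; rewrite ltW//= lexx.
  have fr : 0 < (final n (r, 0)).2.
    by apply: low' => //; apply: sS; rewrite lexx ltW.
  have [|x] := @IVT R (fun x => (final n (x, 0)).2) r S 0 (ltW rS)
    (continuous_subspaceT cf).
    by rewrite ge_min le_max (ltW fS) (ltW fr) orbT.
  rewrite in_itv/= => xI fx; exists (x, 0); split => //; first exact: sS.
    by case/andP: xI.
  by right; rewrite fx.
have [U [N [p [u [v [UU bc suv [u_ge0 ru0] [u0 v0 uT vT]]]]]]] :=
  scheme_zero_limit r0 exz.
have v00 : v 0 = 0.
  by apply: (ultra_eq UU v0 (@ultra_cst U UU 0)) => j; have [] := bc j.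
have vT0 : v T = 0.
  by apply: (ultra_eq UU vT (@ultra_cst U UU 0)) => j; have [] := bc j.
have u00 := lt_le_trans r0 ru0.
by exists u, v; split => //; apply: (nonneg_sol_pos suv).
Qed.

End TruncatedProblem.

(** * Derivatives relative to an interval, in epsilon form *)

Section WithinDerivative.
Context {R : realType}.
Implicit Types (c d x y z t : R) (f : R -> R).

Lemma continuous_clamp c d f : c <= d ->
  (forall z (e : R), c <= z <= d -> 0 < e -> exists2 r : R, 0 < r &
     forall y, c <= y <= d -> `|y - z| < r -> `|f y - f z| <= e) ->
  continuous (f \o clamp c d).
Proof.
move=> cd H x; apply/cvgrPdist_le => e e0.
have [r r0 rP] := H _ _ (clampP x cd) e0.
apply/nbhs_ballP; exists r => //= y; rewrite /ball/= => xy.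
rewrite distrC; apply: rP; first exact: clampP.
by rewrite distrC; apply: le_lt_trans xy; exact: clamp_lip.
Qed.

Lemma within_continuous_eps c d f : {within `[c, d], continuous f} ->
  forall z (e : R), c <= z <= d -> 0 < e -> exists2 r : R, 0 < r &
     forall y, c <= y <= d -> `|y - z| < r -> `|f y - f z| <= e.
Proof.
move=> /subspace_continuousP cf z e zcd e0.
have zI : `[c, d]%classic z by rewrite /= in_itv.
have /cvgrPdist_le/(_ _ e0)[r /= r0 rP] := cf z zI.
exists r => // y ycd yz; rewrite distrC; apply: rP; last by rewrite /= in_itv.
by rewrite /ball_/= distrC.
Qed.

Lemma derivable_within_eps (D : set R) f z :
  derivable_within D f z -> forall e : R, 0 < e ->
  exists2 r : R, 0 < r & forall y, D y -> `|y - z| < r ->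
    `|f y - f z - derive_within D f z * (y - z)| <= e * `|y - z|.
Proof.
move=> df e e0; set l := derive_within _ _ _.
have : diff_quotient f z y @[y --> within D z^'] --> l by exact: df.
move=> /cvgrPdist_le/(_ _ e0); rewrite /within/= => -[r /= r0 rP].
exists r => // y Dy yz; have [->|ynz] := eqVneq y z.
  by rewrite !subrr mulr0 subr0 normr0 mulr0.
have yz0 : y - z != 0 by rewrite subr_eq0.
have := rP y; rewrite /= distrC => /(_ yz ynz Dy).
rewrite /diff_quotient => h.
have -> : f y - f z - l * (y - z) = - ((l - (f y - f z) / (y - z)) * (y - z)).
  by field.
by rewrite normrN normrM ler_wpM2r.
Qed.

End WithinDerivative.

(** * Eigenfunctions as solutions of integral equations *)

Section Eigenfunction.
Context {R : realType}.
Implicit Types (c d x y z t : R) (f : R -> R).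

Local Notation mu := (@lebesgue_measure R).

Lemma derivable_within_continuous c d f : c <= d ->
  (forall x, `[c, d]%classic x -> derivable_within `[c, d] f x) ->
  continuous (f \o clamp c d).
Proof.
move=> cd df; apply: continuous_clamp => // z e zcd e0.
have zI : `[c, d]%classic z by rewrite /= in_itv.
have [r r0 rP] := derivable_within_eps (df z zI) ltr01.
set l := derive_within _ _ _ in rP.
have l1 : 0 < `|l| + 1 by rewrite ltr_wpDl.
exists (Num.min r (e / (`|l| + 1))); first by rewrite lt_min r0 divr_gt0.
move=> y ycd; rewrite lt_min => /andP[yr].
have yI : `[c, d]%classic y by rewrite /= in_itv.
rewrite ltr_pdivlMr// => ye; have := rP y yI yr; rewrite mul1r => h.
have -> : f y - f z = (f y - f z - l * (y - z)) + l * (y - z) by ring.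
apply: le_trans (ler_normD _ _) _; rewrite normrM; lra.
Qed.

Lemma antiderivative_eps c d (f l : R -> R) :
  (forall z (e : R), c <= z <= d -> 0 < e -> exists2 r : R, 0 < r &
     forall y, c <= y <= d -> `|y - z| < r ->
       `|f y - f z - l z * (y - z)| <= e * `|y - z|) ->
  antiderivative c d f l.
Proof.
move=> df x y m M cx xy yd mM.
have H e : 0 < e -> (m - e) * (y - x) <= f y - f x <= (M + e) * (y - x).
  move=> e0; apply: (@cousin _ x y (fun s t =>
    (m - e) * (t - s) <= f t - f s <= (M + e) * (t - s))) => //.
    move=> s t w _ st tw _ /andP[h1 h2] /andP[h3 h4].
    by apply/andP; split; lra.
  move=> z zxy; have zcd : c <= z <= d by lra.
  have [r r0 rP] := df z e zcd e0.
  have /andP[l1 l2] := mM z zxy.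
  exists r => // s t xs sz zt ty zrs tzr.
  have tcd : c <= t <= d by lra.
  have scd : c <= s <= d by lra.
  have tr : `|t - z| < r by rewrite ger0_norm; lra.
  have sr : `|s - z| < r by rewrite ler0_norm; lra.
  have := rP t tcd tr; have := rP s scd sr.
  rewrite (ger0_norm (_ : 0 <= t - z)); last by lra.
  rewrite (ler0_norm (_ : s - z <= 0)); last by lra.
  rewrite !ler_norml => /andP[h1 h2] /andP[h3 h4].
  have k1 : m * (t - z) <= l z * (t - z) by rewrite ler_wpM2r//; lra.
  have k2 : l z * (t - z) <= M * (t - z) by rewrite ler_wpM2r//; lra.
  have k3 : m * (z - s) <= l z * (z - s) by rewrite ler_wpM2r//; lra.
  have k4 : l z * (z - s) <= M * (z - s) by rewrite ler_wpM2r//; lra.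
  by apply/andP; split; lra.
have d0 : 0 <= y - x by lra.
apply/andP; split; apply/ler_addgt0Pr => e e0.
  have e'0 : 0 < e / (y - x + 1) by rewrite divr_gt0//; lra.
  have /andP[h _] := H _ e'0.
  have : e / (y - x + 1) * (y - x) <= e.
    by rewrite mulrAC ler_pdivrMr; [nra|lra].
  lra.
have e'0 : 0 < e / (y - x + 1) by rewrite divr_gt0//; lra.
have /andP[_ h] := H _ e'0.
have : e / (y - x + 1) * (y - x) <= e.
  by rewrite mulrAC ler_pdivrMr; [nra|lra].
lra.
Qed.

Lemma derivable_within_antiderivative c d f : c <= d ->
  (forall x, `[c, d]%classic x -> derivable_within `[c, d] f x) ->
  antiderivative c d (f \o clamp c d) (derive_within `[c, d] f \o clamp c d).
Proof.
move=> cd df; apply: antiderivative_eps => z e zcd e0.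
have zI : `[c, d]%classic z by rewrite /= in_itv.
have [r r0 rP] := derivable_within_eps (df z zI) e0.
by exists r => // y ycd yz; rewrite /= !clampE//; exact: rP.
Qed.

Lemma ac_subitv c d x y f : c <= x -> y <= d -> absolutely_continuous_on c d f ->
  absolutely_continuous_on x y f.
Proof.
move=> cx yd acf e e0; have [dl dl0 H] := acf e e0.
exists dl => // n s t st; apply: H => i; have [h1 h2 h3] := st i.
by split=> //; [exact: le_trans h1|exact: le_trans yd].
Qed.

Lemma ac_integ c d f : summable f -> absolutely_continuous_on c d (integ f 0).
Proof.
move=> sf e e0; have [dl dl0 H] := summable_abs_cont sf e0.
exists dl => // n s t st tI std.
have st' i : s i <= t i by have [] := st i.
apply: le_lt_trans (H n s t st' tI std); apply: ler_sum => i _.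
have -> : integ f 0 (t i) - integ f 0 (s i) = integ f (s i) (t i).
  by rewrite (integ_chasles _ 0 (s i) (t i)); ring.
exact: ler_norm_integ.
Qed.

Lemma acD c d f h : absolutely_continuous_on c d f ->
  absolutely_continuous_on c d h -> absolutely_continuous_on c d (f \+ h).
Proof.
move=> acf ach e e0; have e20 : 0 < e / 2 by rewrite divr_gt0.
have [d1 d10 H1] := acf _ e20; have [d2 d20 H2] := ach _ e20.
exists (Num.min d1 d2); first by rewrite lt_min d10.
move=> n s t st tI; rewrite lt_min => /andP[/(H1 n s t st tI) h1 /(H2 n s t st tI) h2].
rewrite [e]splitr; apply: le_lt_trans (ltrD h1 h2).
rewrite -big_split/=; apply: ler_sum => i _.
have -> : f (t i) + h (t i) - (f (s i) + h (s i)) =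
  (f (t i) - f (s i)) + (h (t i) - h (s i)) by ring.
exact: ler_normD.
Qed.

(** The sum of f and a primitive of h is absolutely continuous with derivative zero almost
    everywhere, hence constant. *)
Lemma ac_integral_form c d f h : summable h -> absolutely_continuous_on c d f ->
  {ae mu, forall x, x \in `[c, d] -> derivable f x 1 /\ derive1 f x = - h x} ->
  forall x y, c <= x -> x <= y -> y <= d -> f y - f x = - integ h x y.
Proof.
move=> sh acf aef x y cx xy yd.
have : (f \+ integ h 0) y = (f \+ integ h 0) x.
  apply: ac_ae_derive0 => //.
    apply: (@ac_subitv c d) => //; apply: acD => //; exact: ac_integ.
  move: aef (summable_derive sh); apply: filterS2.
    exact: (ae_filter_ringOfSetsType mu).
  move=> t Hf [dh eh] txy.
  have tcd : t \in `[c, d].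
    by move: txy; rewrite !in_itv/= => /andP[? ?]; apply/andP; split; lra.
  have [df ef] := Hf tcd; split; first exact: (derivableD df dh).
  by rewrite derive1E (deriveD df dh) -!derive1E ef eh addNr.
by rewrite /= (integ_chasles _ 0 x y); lra.
Qed.

Lemma eigenfunction_regular (a b : R -> R) al be lam T phi :
  summable b -> (forall t, ~~ (0 <= t <= T) -> b t = 0) -> al <= be ->
  {ae mu, forall x, x \in `[al, be] -> a x = b x} ->
  ode_solution (fun x y => lam * a x * y) al be phi ->
  let f := phi \o clamp al be in
  let f' := derive_within `[al, be] phi \o clamp al be in
  [/\ continuous f, continuous f', antiderivative al be f f' &
    forall x y, al <= x -> x <= y -> y <= be ->
      f' y - f' x = - integ (fun t => b t * (lam * f t)) x y].
Proof.
move=> sb bT ab aeb [[dphi cphi'] acphi' aephi] f f'.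
have cf : continuous f by exact: derivable_within_continuous.
have cf' : continuous f'.
  by apply: continuous_clamp => //; exact: within_continuous_eps.
split => //; first exact: derivable_within_antiderivative.
move=> x y ax xy yb.
have sbf : summable (fun t => b t * (lam * f t)).
  apply: (summable_weight sb bT) => t; apply: cvgM; [exact: cvg_cst|exact: cf].
rewrite -(ac_integral_form sbf acphi' _ ax xy yb).
  by rewrite /f' /= !clampE//; apply/andP; split; lra.
move: aeb aephi; apply: filterS2; first exact: (ae_filter_ringOfSetsType mu).
move=> t Hb Hphi tI; have [d1 d2] := Hphi tI; split => //.
have tI' : al <= t <= be by rewrite in_itv in tI.
apply/eqP; rewrite -addr_eq0 -(Hb tI) /f/= clampE//.
by apply/eqP; rewrite -[RHS]d2; congr (_ + _); ring.
Qed.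

Lemma last_zero f c x0 : continuous f -> c < x0 -> f c = 0 -> 0 < f x0 ->
  exists z, [/\ c <= z, z < x0, f z = 0 & forall x, z < x -> x <= x0 -> 0 < f x].
Proof.
move=> cf cx0 fc fx0.
pose S := [set x | c <= x <= x0 /\ f x = 0].
have Sc : S c by split => //; rewrite lexx ltW.
have ubS : has_sup S by split; [exists c|exists x0 => y [/andP[]]].
pose z := sup S.
have cz : c <= z by apply: ub_le_sup => //; case: ubS.
have zx0 : z <= x0 by apply: ge_sup; [exists c|move=> y [/andP[]]].
have fz : f z = 0.
  apply/eqP; apply/negPn/negP => fz.
  have fz0 : 0 < `|f z| / 2 by rewrite divr_gt0// normr_gt0.
  have [r r0 rP] := continuous_local z cf fz0.
  have [y Sy yr] := sup_adherent r0 ubS.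
  have yz : y <= z by apply: ub_le_sup => //; case: ubS.
  have yzr : `|y - z| < r by rewrite ler0_norm; rewrite -/z in yr; lra.
  have := rP y yzr; case: Sy => _ ->; rewrite sub0r normrN.
  have : 0 < `|f z| by rewrite normr_gt0.
  lra.
have zx : z < x0 by rewrite lt_neqAle zx0 andbT; apply/eqP => e; rewrite -e fz ltxx in fx0.
exists z; split => // x zx' xx0; rewrite ltNge; apply/negP => fx.
have [|w] := @IVT R f x x0 0 xx0 (continuous_subspaceT cf).
  by rewrite ge_min fx le_max (ltW fx0) orbT.
rewrite in_itv/= => /andP[xw wx0] fw.
have : w <= z by apply: ub_le_sup; [case: ubS|split => //; rewrite wx0 andbT; lra].
lra.
Qed.

End Eigenfunction.

(** * Existence of a nodal domain *)

Section NodalDomain.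
Context {R : realType}.
Variables (T : R) (a : R -> R).
Hypotheses (sa : summable a) (aT : forall t, ~~ (0 <= t <= T) -> a t = 0).
Variables (al be lam : R).
Hypothesis (a_ge0 : forall t, al <= t <= be -> 0 <= a t).
Implicit Types (c d x y z t : R) (phi psi : R -> R).

Local Notation mu := (@lebesgue_measure R).

Lemma first_zero phi x0 d : continuous phi -> x0 < d -> phi d = 0 -> 0 < phi x0 ->
  exists z, [/\ x0 < z, z <= d, phi z = 0 & forall x, x0 <= x -> x < z -> 0 < phi x].
Proof.
move=> cphi x0d pd px0.
have cN : continuous (fun x => phi (- x)).
  by move=> x; apply: (@continuous_comp _ _ _ -%R phi); [exact: oppr_continuous|exact: cphi].
have [||||z [dz zx0 pz pos]] := @last_zero R (fun x => phi (- x)) (- d) (- x0) => //.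
- by rewrite ltrN2.
- by rewrite opprK.
- by rewrite opprK.
exists (- z); split=> //; [lra|lra|] => x x0x xz.
by have := pos (- x); rewrite opprK; apply; lra.
Qed.

Lemma antiderivative_pos c d phi psi : continuous psi -> antiderivative c d phi psi ->
  c < d -> phi c < phi d -> exists2 z, c <= z <= d & 0 < psi z.
Proof.
move=> cpsi aphi cd pcd; apply: contrapT => nex.
have [z zI zP] := @EVT_min R psi c d (ltW cd) (continuous_subspaceT cpsi).
have := aphi c d (psi z) 0 (lexx c) (ltW cd) (lexx d).
case/(_ _)/andP => [t tI|_]; last by rewrite mul0r; lra.
rewrite zP ?in_itv//= leNgt; apply/negP => pt.
by apply: nex; exists t.
Qed.

(** The delicate clause is the positive weighted integral, as a may vanish on large sets. Since phi
    rises before x0 and falls after it, psi is positive at some c2 and negative at some d2 > c2, so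
    a phi has nonzero integral between them. *)
Lemma nodal_domain_exists phi psi x0 : continuous phi -> continuous psi ->
  antiderivative al be phi psi ->
  (forall x y, al <= x -> x <= y -> y <= be ->
    psi y - psi x = - integ (fun t => a t * (lam * phi t)) x y) ->
  phi al = 0 -> phi be = 0 -> al <= x0 <= be -> 0 < phi x0 ->
  exists c d, nodal_domain a al be lam c d phi psi.
Proof.
move=> cphi cpsi aphi psiE pal pbe /andP[ax0 x0b] px0.
have {}ax0 : al < x0.
  by rewrite lt_neqAle ax0 andbT; apply/eqP => e; rewrite -e pal ltxx in px0.
have {}x0b : x0 < be.
  by rewrite lt_neqAle x0b andbT; apply/eqP => e; rewrite e pbe ltxx in px0.
have [c [ac cx0 pc posc]] := last_zero cphi ax0 pal px0.
have [d [x0d db pd posd]] := first_zero cphi x0b pbe px0.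
have p_ge0 x : c <= x <= d -> 0 <= phi x.
  move=> /andP[cx xd].
  have [->|xc] := eqVneq x c; first by rewrite pc.
  have [->|xd'] := eqVneq x d; first by rewrite pd.
  have {}cx : c < x by rewrite lt_neqAle eq_sym xc.
  have {}xd : x < d by rewrite lt_neqAle xd'.
  have [xx0|xx0] := leP x x0; first exact/ltW/posc.
  by apply/ltW/posd => //; exact: ltW.
have cd : c < d by lra.
have aphi' : antiderivative c d phi psi.
  by move=> x y m M cx xy yd; apply: aphi => //; lra.
have half : 0 < phi x0 / 2 by lra.
have [rc rc0 rcP] := continuous_local c cphi half.
have [rd rd0 rdP] := continuous_local d cphi half.
(* Close enough to c for phi(c1) < phi(x0), yet strictly to its right: this keeps c2 away from al
   and so makes [q0] positive. *)
pose c1 := Num.min ((c + x0) / 2) (c + rc / 2).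
have [cc1 c1x0] : c < c1 /\ c1 < x0.
  by split; [rewrite lt_min; apply/andP; split; lra|rewrite gt_min; apply/orP; left; lra].
have c1r : c1 <= c + rc / 2 by rewrite ge_min lexx orbT.
pose d1 := Num.max ((x0 + d) / 2) (d - rd / 2).
have [x0d1 d1d] : x0 < d1 /\ d1 < d.
  by split; [rewrite lt_max; apply/orP; left; lra|rewrite gt_max; apply/andP; split; lra].
have d1r : d - rd / 2 <= d1 by rewrite le_max lexx orbT.
have pc1 : phi c1 < phi x0.
  have := rcP c1; rewrite pc subr0 gtr0_norm; last by lra.
  have : c1 - c < rc by lra.
  by move=> h /(_ h) /(le_trans (ler_norm _)); lra.
have pd1 : phi d1 < phi x0.
  have := rdP d1; rewrite pd subr0 ltr0_norm; last by lra.
  have : - (d1 - d) < rd by lra.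
  by move=> h /(_ h) /(le_trans (ler_norm _)); lra.
have ac1 : antiderivative c1 x0 phi psi.
  by move=> x y m M cx xy yd; apply: aphi => //; lra.
have ad1 : antiderivative x0 d1 (fun x => - phi x) (fun x => - psi x).
  apply: antiderivativeN; move=> x y m M cx xy yd; apply: aphi => //; lra.
have [c2 /andP[c12 c2x0] pc2] := antiderivative_pos cpsi ac1 c1x0 pc1.
have cpsiN : continuous (fun x => - psi x) by move=> x; apply: cvgN; exact: cpsi.
have [|d2 /andP[x0d2 d21] pd2] := antiderivative_pos cpsiN ad1 x0d1.
  by rewrite ltrN2.
have c2d2 : c2 <= d2 by lra.
have spl := summable_weight sa aT cphi.
have I2 : 0 <= integ (fun t => a t * phi t) c2 d2.
  apply: integ_ge0 => // t tI; rewrite mulr_ge0// ?a_ge0 ?p_ge0//; lra.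
have I2' : 0 < integ (fun t => a t * phi t) c2 d2.
  (* A zero integral would give psi the same value at c2 and d2, against the opposite signs. *)
  rewrite lt_neqAle I2 andbT eq_sym; apply/eqP => I20.
  have h1 : al <= c2 by lra.
  have h2 : d2 <= be by lra.
  have := psiE c2 d2 h1 c2d2 h2.
  have -> : integ (fun t => a t * (lam * phi t)) c2 d2 =
      integ (fun t => lam * (a t * phi t)) c2 d2.
    by congr integ; apply/funext => t; ring.
  by rewrite integZ// I20 mulr0 oppr0; lra.
have cq : continuous (fun t => phi t * ((t - al) * (be - t))).
  move=> t; apply: cvgM; [exact: cphi|apply: cvgM; apply: cvgB;
    by [exact: cvg_id|exact: cvg_cst]].
have sq := summable_weight sa aT cq.
exists c, d; split.
- by split; lra.
- split => // x y cx xy yd; apply: psiE => //; lra.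
- split => //.
    by apply: (right_min cpsi aphi' (lexx c) cd) => x xI; rewrite pc p_ge0.
  by apply: (left_min cpsi aphi' cd (lexx d)) => x xI; rewrite pd p_ge0.
- pose q0 := (c2 - al) * (be - d2).
  have q00 : 0 < q0 by rewrite mulr_gt0//; lra.
  apply: (@lt_le_trans _ _ (q0 * integ (fun t => a t * phi t) c2 d2)).
    exact: mulr_gt0.
  apply: (@le_trans _ _ (integ (fun t => a t * (phi t * ((t - al) * (be - t)))) c2 d2)).
    rewrite -integZ//; apply: le_integ => //; first exact: summableZ.
    move=> t tI; have ap : 0 <= a t * phi t.
      by rewrite mulr_ge0 ?a_ge0 ?p_ge0//; lra.
    have qt : q0 <= (t - al) * (be - t).
      by case/andP: tI => t1 t2; rewrite ler_pM ?subr_ge0 ?lerB//; lra.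
    by have := ler_wpM2l ap qt; lra.
  apply: integ_mono => //; [lra|lra|] => t tI.
  have ap : 0 <= a t * phi t by rewrite mulr_ge0 ?a_ge0 ?p_ge0//; lra.
  by rewrite mulrA mulr_ge0// mulr_ge0//; lra.
Qed.

Lemma dirichlet_nodal_domain (b : R -> R) :
  {ae mu, forall x, x \in `[al, be] -> b x = a x} ->
  dirichlet_eigenvalue b al be lam ->
  exists c d phi psi, nodal_domain a al be lam c d phi psi.
Proof.
move=> aeb [phi [ode pal pbe [x0 x0I px0]]].
have x0I' : al <= x0 <= be by rewrite in_itv in x0I.
have ab : al <= be by case/andP: x0I' => ? ?; lra.
have [] := eigenfunction_regular sa aT ab aeb ode.
set f := _ \o _; set f' := _ \o _ => cf cf' af f'E.
have fE x : al <= x <= be -> f x = phi x by move=> xI; rewrite /f/= clampE.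
have fal : f al = 0 by rewrite fE ?lexx.
have fbe : f be = 0 by rewrite fE ?lexx ?andbT.
have [fp|fn|f0] := ltgtP (f x0) 0; last by rewrite fE in f0; rewrite ?f0 ?eqxx in px0.
  have [||||||||c [d nd]] := @nodal_domain_exists (fun x => - f x) (fun x => - f' x) x0.
  - by move=> x; apply: cvgN; exact: cf.
  - by move=> x; apply: cvgN; exact: cf'.
  - exact: antiderivativeN.
  - move=> x y ax xy yb; have := f'E x y ax xy yb.
    have cl : continuous (fun t => lam * f t).
      by move=> t; apply: cvgM; [exact: cvg_cst|exact: cf].
    have sl := summable_weight sa aT cl.
    have -> : integ (fun t => a t * (lam * - f t)) x y =
       integ (fun t => -1 * (a t * (lam * f t))) x y.
      by congr integ; apply/funext => t; ring.
    by rewrite integZ//; lra.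
  - by rewrite fal oppr0.
  - by rewrite fbe oppr0.
  - exact: x0I'.
  - by rewrite oppr_gt0.
  by exists c, d, (fun x => - f x), (fun x => - f' x).
have [c [d nd]] := nodal_domain_exists cf cf' af f'E fal fbe x0I' fn.
by exists c, d, f, f'.
Qed.

End NodalDomain.

(** * Truncation of the nonlinearity *)

Section Truncation.
Context {R : realType}.
Implicit Types (s t x y e : R).
Variable g : R -> R.
Hypotheses (g_cont : {within `[0, +oo[, continuous g}) (g0 : g 0 = 0).
Hypothesis g_pos : forall s, 0 < s -> 0 < g s.
Hypothesis g_lim0 : g s / s @[s --> 0^'+] --> (0 : R).
Hypothesis g_C1 : exists2 eps0 : R, 0 < eps0 &
  continuously_differentiable_on `[0, eps0[ g.

(** The limit of g(s)/s forces g'(0) = 0, and by continuity |g'| <= e near 0; the mean value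
    inequality concludes. *)
Lemma g_flat0 e : 0 < e -> exists2 d : R, 0 < d & forall s t, 0 <= s <= d ->
  0 <= t <= d -> `|g s - g t| <= e * `|s - t|.
Proof.
move=> e0; have [eps0 eps00 [dg cg']] := g_C1.
pose D := `[0, eps0[%classic; pose g' := derive_within D g.
have D0 : D 0 by rewrite /D/= in_itv/= lexx.
have [r0 r00 r0P] : exists2 r : R, 0 < r & forall s, 0 < s -> s < r -> g s <= e / 4 * s.
  have e4 : 0 < e / 4 by rewrite divr_gt0.
  have /cvgr0Pnorm_le/(_ _ e4) := g_lim0.
  move=> [r /= r0 rP]; exists r => // s s0 sr.
  have := rP s; rewrite /ball_/= sub0r normrN gtr0_norm// => /(_ sr s0).
  move=> /(le_trans (ler_norm _)); rewrite ler_pdivrMr//.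
have l0 : `|g' 0| <= e / 2.
  have e4 : 0 < e / 4 by rewrite divr_gt0.
  have [r r0' rP] := derivable_within_eps (dg 0 D0) e4.
  pose s := Num.min (r0 / 2) (Num.min (r / 2) (eps0 / 2)).
  have s0 : 0 < s by rewrite !lt_min !divr_gt0.
  have sr0 : s < r0 by rewrite gt_min; apply/orP; left; lra.
  have sr : s < r.
    by rewrite !gt_min; apply/orP; right; apply/orP; left; lra.
  have se : s < eps0.
    by rewrite !gt_min; apply/orP; right; apply/orP; right; lra.
  have Ds : D s by rewrite /D/= in_itv/= se ltW.
  have := rP s Ds; rewrite subr0 gtr0_norm// => /(_ sr); rewrite g0 subr0 -/g'.
  have gs := r0P s s0 sr0; have gs0 := g_pos s0.
  rewrite ler_norml => /andP[h1 h2].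
  rewrite -(ler_pM2r s0) -{1}(gtr0_norm s0) -normrM ler_norml.
  by apply/andP; split; lra.
have e2 : 0 < e / 2 by rewrite divr_gt0.
have [r r0' rP] : exists2 r : R, 0 < r & forall y, D y -> `|y - 0| < r ->
    `|g' y - g' 0| <= e / 2.
  have /subspace_continuousP/(_ 0 D0)/cvgrPdist_le/(_ _ e2)[r /= r0' rP] := cg'.
  exists r => // y Dy yr; rewrite distrC; apply: rP => //.
  by rewrite /ball_/= distrC.
pose d := Num.min (r / 2) (eps0 / 2).
have d0 : 0 < d by rewrite !lt_min !divr_gt0.
have dr : d < r by rewrite gt_min; apply/orP; left; lra.
have de : d < eps0 by rewrite gt_min; apply/orP; right; lra.
have Dd y : 0 <= y <= d -> D y.
  by move=> /andP[y0 yd]; rewrite /D/= in_itv/= y0 (le_lt_trans yd).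
have ag : antiderivative 0 d g g'.
  apply: antiderivative_eps => z e1 zd e10.
  have [r1 r10 r1P] := derivable_within_eps (dg z (Dd z zd)) e10.
  by exists r1 => // y yd yz; apply: r1P => //; exact: Dd.
have g'e y : 0 <= y <= d -> - e <= g' y <= e.
  move=> yd; have := rP y (Dd y yd); rewrite subr0 ger0_norm; last by case/andP: yd.
  have /andP[_ yd'] := yd; move=> /(_ (le_lt_trans yd' dr)).
  by move: l0; rewrite !ler_norml => /andP[? ?] /andP[? ?]; apply/andP; split; lra.
have mono s t : 0 <= s -> s <= t -> t <= d -> `|g t - g s| <= e * (t - s).
  move=> s0 st td; have := ag s t (- e) e s0 st td.
  case/(_ _)/andP => [z /andP[sz zt]|h1 h2].
    by apply: g'e; rewrite (le_trans s0 sz) (le_trans zt td).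
  by rewrite ler_norml; apply/andP; split; lra.
exists d => // s t /andP[s0 sd] /andP[t0 td]; have [st|/ltW ts] := leP s t.
  by rewrite distrC (distrC s) (ger0_norm (_ : 0 <= t - s)) ?subr_ge0// mono.
by rewrite (ger0_norm (_ : 0 <= s - t)) ?subr_ge0// mono.
Qed.

Variables (k S0 M : R).
Hypotheses (S00 : 0 < S0) (S0M : S0 <= M).
Hypothesis gk : forall s, S0 <= s -> k * s <= g s.

(** Beyond M this is the line through the origin and (M, g(M)), which meets g continuously and has
    slope at least k. *)
Definition growth_cut s : R := g (clamp 0 M s) + g M / M * Num.max 0 (s - M).

Let M0 : 0 < M. Proof. exact: lt_le_trans S0M. Qed.

Let gM0 : 0 < g M / M. Proof. by rewrite divr_gt0// g_pos. Qed.

Let g_ge0 s : 0 <= s -> 0 <= g s.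
Proof. by rewrite le_eqVlt => /orP[/eqP <-|/g_pos/ltW//]; rewrite g0. Qed.

Lemma growth_cut_in s : 0 <= s <= M -> growth_cut s = g s.
Proof.
move=> /andP[s0 sM]; rewrite /growth_cut clampE ?s0// (max_idPl _) ?subr_le0//.
by rewrite mulr0 addr0.
Qed.

Lemma growth_cut_neg s : s <= 0 -> growth_cut s = 0.
Proof.
move=> s0; have M0' := M0; rewrite /growth_cut /clamp min_r; last by lra.
by rewrite max_l// max_l ?g0 ?mulr0 ?addr0//; lra.
Qed.

Lemma growth_cut_out s : M <= s -> growth_cut s = g M / M * s.
Proof.
move=> Ms; have M0' := M0; rewrite /growth_cut /clamp min_l// max_r; last exact: ltW.
rewrite max_r; last by lra.
by field; rewrite gt_eqF.
Qed.

Lemma growth_cut_gt0 s : 0 < s -> 0 < growth_cut s.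
Proof.
move=> s0; have [sM|Ms] := leP s M.
  by rewrite growth_cut_in ?sM ?ltW// g_pos.
by rewrite growth_cut_out ?ltW// mulr_gt0.
Qed.

Lemma growth_cut_ge0 s : 0 <= growth_cut s.
Proof.
by have [s0|/growth_cut_gt0/ltW//] := leP s 0; rewrite growth_cut_neg.
Qed.

Lemma growth_cut_continuous : continuous growth_cut.
Proof.
move=> s; apply: cvgD.
  apply: (@continuous_clamp R 0 M g (ltW M0)) => z e zM e0.
  have zI : `[0, +oo[%classic z by rewrite /= in_itv/=; case/andP: zM => ->.
  have /subspace_continuousP/(_ z zI)/cvgrPdist_le/(_ _ e0)[r /= r0 rP] := g_cont.
  exists r => // y /andP[y0 _] yz; rewrite distrC; apply: rP.
    by rewrite /ball_/= distrC.
  by rewrite in_itv/= y0.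
apply: cvgM; first exact: cvg_cst.
apply: (@continuous_max R R (cst 0) (fun s => s - M)); first exact: cvg_cst.
by apply: cvgB; [exact: cvg_id|exact: cvg_cst].
Qed.

Lemma growth_cut_flat e : 0 < e -> exists2 d : R, 0 < d & forall s t, `|s| <= d ->
  `|t| <= d -> `|growth_cut s - growth_cut t| <= e * `|s - t|.
Proof.
move=> e0; have [d d0 dP] := g_flat0 e0.
exists (Num.min d M); first by rewrite lt_min d0 M0.
have tE s : `|s| <= Num.min d M -> growth_cut s = g (Num.max 0 s) /\ 0 <= Num.max 0 s <= d.
  rewrite le_min !ler_norml => /andP[/andP[_ sd] /andP[_ sM]].
  have [s0|s0] := leP s 0; first by rewrite growth_cut_neg// g0 lexx ltW.
  by rewrite growth_cut_in ?(ltW s0) ?sM ?sd.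
move=> s t /tE[-> h1] /tE[-> h2]; apply: le_trans (dP _ _ h1 h2) _.
rewrite ler_pM2l// ler_norml.
have k1 := ler_norm (s - t); have := ler_norm (t - s); rewrite distrC => k2.
have k3 := normr_ge0 (s - t).
by have [s0|s0] := leP s 0; have [t0|t0] := leP t 0; apply/andP; split; lra.
Qed.

(** The summands 1, G / d and g(M) / M of the constant serve the ranges s <= d, d < s < M and s >=
    M. *)
Lemma growth_cut_linear : exists C : R, 0 <= C /\ forall s, `|growth_cut s| <= C * `|s|.
Proof.
have M0' := M0; have [d d0 dP] := g_flat0 ltr01.
have gM0' := gM0.
have [z zM zP] := @EVT_max R growth_cut 0 M (ltW M0) (continuous_subspaceT growth_cut_continuous).
set G := growth_cut z in zP; have G0 : 0 <= G by exact: growth_cut_ge0.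
have Gd : 0 <= G / d by rewrite divr_ge0// ltW.
exists (1 + G / d + g M / M); split; first by lra.
move=> s; rewrite (ger0_norm (growth_cut_ge0 s)).
have [s0|s0] := leP s 0.
  by rewrite growth_cut_neg// mulr_ge0//; lra.
rewrite gtr0_norm//; have Gs : 0 <= G / d * s by rewrite mulr_ge0// ltW.
have gMs : 0 <= g M / M * s by rewrite mulr_ge0// ltW.
have [Ms|sM] := leP M s; first by rewrite growth_cut_out//; lra.
have [sd|ds] := leP s d.
  rewrite growth_cut_in ?(ltW s0) ?(ltW sM)//.
  have := dP s 0; rewrite (ltW s0) sd lexx (ltW d0) => /(_ isT isT).
  by rewrite g0 !subr0 mul1r (gtr0_norm s0) => /(le_trans (ler_norm _)); lra.
have : growth_cut s <= G by apply: zP; rewrite in_itv/= (ltW s0) ltW.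
have : G <= G / d * s by rewrite mulrAC ler_pdivlMr// ler_wpM2l// ltW.
lra.
Qed.

(** The additive constant is independent of M, which will be chosen from a bound computed with
    it. *)
Lemma growth_cut_lower s : 0 <= s -> k * s - `|k| * S0 <= growth_cut s.
Proof.
have M0' := M0; have S00' := S00.
move=> s0; have kS0 : k * S0 <= `|k| * S0 by rewrite ler_pM2r// ler_norm.
have kS1 : 0 <= `|k| * S0 by rewrite mulr_ge0// ltW.
have [Ms|sM] := leP M s.
  rewrite growth_cut_out//; have : k <= g M / M by rewrite ler_pdivlMr// gk.
  by move=> h; have := ler_wpM2r s0 h; lra.
have [Ss|sS] := leP S0 s.
  by rewrite growth_cut_in ?s0 ?(ltW sM)//; have := gk Ss; lra.
apply: le_trans (growth_cut_ge0 s).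
have : k * s <= `|k| * s by rewrite ler_wpM2r// ler_norm.
have : `|k| * s <= `|k| * S0 by rewrite ler_wpM2l// ltW.
lra.
Qed.

End Truncation.

(** * Maxima are controlled on the intervals of nonnegative weight *)

Section MaximumPrinciple.
Context {R : realType}.
Variables (T C : R) (a g : R -> R).
Hypotheses (T0 : 0 < T).
Hypotheses (sa : summable a) (aT : forall t, ~~ (0 <= t <= T) -> a t = 0).
Hypotheses (cg : continuous g) (g_ge0 : forall s, 0 <= g s).
Variables (m : nat) (al be : 'I_m -> R) (i0 : 'I_m).
Hypotheses (al0 : forall i, 0 <= al i) (beT : forall i, be i <= T).
Hypothesis (ab : forall i, al i < be i).
Hypothesis (a_le0 : forall t, (forall i, ~~ (al i < t < be i)) -> a t <= 0).
Implicit Types (c d x y z t : R) (u v : R -> R).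

Lemma antiderivative_ge c d u v b : c <= d -> continuous v ->
  antiderivative c d u v -> (forall z, c <= z <= d -> b <= v z) ->
  b * (d - c) <= u d - u c.
Proof.
move=> cd cv au bv.
have [z zI zP] := @EVT_max R v c d cd (continuous_subspaceT cv).
have := au c d b (v z) (lexx c) cd (lexx d).
case/(_ _)/andP => [t tI|//].
by rewrite bv// zP// in_itv.
Qed.

Lemma antiderivative_le c d u v b : c <= d -> continuous v ->
  antiderivative c d u v -> (forall z, c <= z <= d -> v z <= b) ->
  u d - u c <= b * (d - c).
Proof.
move=> cd cv au bv.
have cvN : continuous (fun x => - v x) by move=> x; apply: cvgN; exact: cv.
have bv' z : c <= z <= d -> - b <= - v z by move=> /bv; rewrite lerN2.
by have := antiderivative_ge cd cvN (antiderivativeN au) bv'; lra.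
Qed.

(** At an endpoint a maximum controls the slope from one side only. Neumann conditions give the
    slope there; under periodic ones both endpoints are maxima, and their inequalities combine. *)
Lemma boundary_max_slope u v z : solution T C a g u v ->
  v 0 = 0 /\ v T = 0 \/ u T = u 0 /\ v T = v 0 ->
  0 <= z <= T -> (forall x, 0 <= x <= T -> u x <= u z) -> v z = 0.
Proof.
move=> [cu cv _ au _] bc /andP[z0 zT] uz.
have cvN : continuous (fun x => - v x) by move=> x; apply: cvgN; exact: cv.
have auN := antiderivativeN au.
have L x : 0 < x -> x <= T -> u x = u z -> 0 <= v x.
  move=> x0 xT ux; rewrite -oppr_le0; apply: (left_min cvN auN x0 xT) => y /andP[y0 yx].
  by rewrite lerN2 ux uz// y0 (le_trans yx).
have Rr x : 0 <= x -> x < T -> u x = u z -> v x <= 0.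
  move=> x0 xT ux; rewrite -oppr_ge0; apply: (right_min cvN auN x0 xT) => y /andP[xy yT].
  by rewrite lerN2 ux uz// yT (le_trans x0).
have [zz|z_ne0] := eqVneq z 0.
  rewrite zz; case: bc => [[]//|[uT vT]].
  apply/eqP; rewrite eq_le Rr//; last by rewrite zz.
  by rewrite -vT L// uT zz.
have {}z0 : 0 < z by rewrite lt_neqAle eq_sym z_ne0.
have [zz|z_neT] := eqVneq z T.
  rewrite zz; case: bc => [[]//|[uT vT]].
  apply/eqP; rewrite eq_le L// ?andbT; last by rewrite zz.
  by rewrite vT Rr// -uT zz.
have {}zT : z < T by rewrite lt_neqAle z_neT.
by apply/eqP; rewrite eq_le L ?Rr// ltW.
Qed.

(** From a maximum point z outside the intervals, where v = 0, u is convex up to the next interval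
    on the right, so it cannot fall below u(z) before reaching it. If there is none on the right,
    the same holds towards the left. *)
Lemma max_on_intervals u v (b : R) : solution T C a g u v ->
  v 0 = 0 /\ v T = 0 \/ u T = u 0 /\ v T = v 0 ->
  (forall i x, al i <= x <= be i -> u x <= b) ->
  forall x, 0 <= x <= T -> u x <= b.
Proof.
move=> suv bc ub; have [cu cv vE au _] := suv.
have [z zI zP] := @EVT_max R u 0 T (ltW T0) (continuous_subspaceT cu).
have zT : 0 <= z <= T by rewrite in_itv in zI.
have uz x : 0 <= x <= T -> u x <= u z by move=> xT; apply: zP; rewrite in_itv.
suff H : u z <= b by move=> x /uz /le_trans; apply.
have vz := boundary_max_slope suv bc zT uz; have /andP[z0 zT'] := zT.
have cgu : continuous (g \o u) by move=> t; apply: continuous_comp; [exact: cu|exact: cg].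
have sw := summable_weight sa aT cgu.
have v_mono x y : 0 <= x -> x <= y -> y <= T ->
    (forall t, x <= t <= y -> a t <= 0) -> v x <= v y.
  move=> x0 xy yT axy; rewrite -subr_ge0 vE//.
  have -> : - integ (fun t => a t * g (u t)) x y =
      integ (fun t => -1 * (a t * g (u t))) x y by rewrite integZ//; ring.
  apply: integ_ge0 => //; first exact: summableZ.
  move=> t txy; have := mulr_le0_ge0 (axy t txy) (g_ge0 (u t)); lra.
have [[i /andP[aiz zbi]]|notin] := pselect (exists i, al i <= z <= be i).
  by apply: (ub i); rewrite aiz.
have out i : z < al i \/ be i < z.
  have [|az] := ltP z (al i); [by left|right].
  by rewrite ltNge; apply/negP => zb; apply: notin; exists i; rewrite az.
have [[j zj]|noright] := pselect (exists i, z < al i).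
  (* The nearest interval to the right, so that a <= 0 all the way from z to it. *)
  pose i := [arg min_(i < j | z < al i) al i]%O.
  have [zi imin] : z < al i /\ forall i', z < al i' -> al i <= al i'.
    by rewrite /i; case: Order.TotalTheory.arg_minP.
  have aiT : al i <= T by apply: le_trans (beT i); exact: ltW.
  have azi t : z <= t <= al i -> a t <= 0.
    move=> /andP[zt tai]; apply: a_le0 => k; apply/negP => /andP[kt tk].
    case: (out k) => [/imin|]; lra.
  have vy y : z <= y <= al i -> 0 <= v y.
    move=> /andP[zy yai]; rewrite -vz; apply: v_mono => //; first by lra.
    by move=> t /andP[zt ty]; apply: azi; lra.
  have auz : antiderivative z (al i) u v.
    by move=> x y mm M zx xy ya; apply: au => //; lra.
  have := antiderivative_ge (ltW zi) cv auz vy; rewrite mul0r subr_ge0.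
  by move=> /le_trans; apply; apply: (ub i); rewrite lexx ltW.
have left i : be i < z by case: (out i) => // zi; exfalso; apply: noright; exists i.
pose i := [arg max_(i > i0) be i]%O.
have imax k : be k <= be i by rewrite /i; case: Order.TotalTheory.arg_maxP => // j _; apply.
have bi0 : 0 <= be i by apply: le_trans (al0 i) _; exact: ltW.
have azi t : be i <= t <= z -> a t <= 0.
  move=> /andP[bt tz]; apply: a_le0 => k; apply/negP => /andP[kt tk].
  have := imax k; lra.
have vy y : be i <= y <= z -> v y <= 0.
  move=> /andP[by_ yz]; rewrite -vz; apply: v_mono => //; first by lra.
  by move=> t /andP[zt ty]; apply: azi; lra.
have auz : antiderivative (be i) z u v.
  by move=> x y mm M zx xy ya; apply: au => //; lra.
have := antiderivative_le (ltW (left i)) cv auz vy; rewrite mul0r subr_le0.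
by move=> /le_trans; apply; apply: (ub i); rewrite lexx andbT ltW.
Qed.

End MaximumPrinciple.

(** * From the integral equation to a Caratheodory solution *)

Section OdeSolution.
Context {R : realType}.
Variables (T : R) (a g f u v : R -> R).
Hypotheses (T0 : 0 < T) (sf : summable f).
Hypotheses (cu : continuous u) (cv : continuous v) (au : antiderivative 0 T u v).
Hypothesis vE : forall x y, 0 <= x -> x <= y -> y <= T -> v y - v x = - integ f x y.
Implicit Types (x y z t : R).

Local Notation mu := (@lebesgue_measure R).
Local Notation D := `[0, T]%classic.
Local Notation u' := (derive_within D u).

(** Properness makes the limit defining [derive_within] unique; the witness steps from z towards the
    middle of [0, T] in order to stay inside. *)
Lemma within_dnbhs_proper z : 0 <= z <= T -> ProperFilter (within D z^').
Proof.
move=> /andP[z0 zT]; apply: Build_ProperFilter_ex => /= P [r /= r0 rP].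
have T0' := T0.
have [zT2|zT2] := leP z (T / 2).
  pose y := z + Num.min (r / 2) (T / 2).
  have m0 : 0 < Num.min (r / 2) (T / 2) by rewrite lt_min !divr_gt0.
  have mT : Num.min (r / 2) (T / 2) <= T / 2 by rewrite ge_min lexx orbT.
  have mr : Num.min (r / 2) (T / 2) <= r / 2 by rewrite ge_min lexx.
  exists y; apply: rP => /=.
  - by rewrite /ball_/= /y opprD addNKr normrN gtr0_norm//; lra.
  - by rewrite /y -subr_eq0 addrC addKr gt_eqF.
  - by rewrite in_itv/= /y; apply/andP; split; lra.
pose y := z - Num.min (r / 2) (T / 2).
have m0 : 0 < Num.min (r / 2) (T / 2) by rewrite lt_min !divr_gt0.
have mT : Num.min (r / 2) (T / 2) <= T / 2 by rewrite ge_min lexx orbT.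
have mr : Num.min (r / 2) (T / 2) <= r / 2 by rewrite ge_min lexx.
exists y; apply: rP => /=.
- by rewrite /ball_/= /y subKr gtr0_norm//; lra.
- by rewrite /y -subr_eq0 addrC addKr oppr_eq0 gt_eqF.
- by rewrite in_itv/= /y; apply/andP; split; lra.
Qed.

Lemma diff_quotient_cvg z : 0 <= z <= T ->
  diff_quotient u z y @[y --> within D z^'] --> v z.
Proof.
move=> /andP[z0 zT]; apply/cvgrPdist_le => e e0.
have [r r0 rP] := continuous_local z cv e0.
exists r => //= y; rewrite /ball_/= distrC => yz yz0; rewrite in_itv/= => /andP[y0 yT].
have near t : `|t - z| <= `|y - z| -> v z - e <= v t <= v z + e.
  by move=> tz; rewrite -ler_distl; apply: rP; exact: le_lt_trans yz.
rewrite ler_distlC /diff_quotient.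
have [zy|yz'] := ltP z y.
  have := au (m := v z - e) (M := v z + e) z0 (ltW zy) yT.
  case/(_ _)/andP => [t /andP[zt ty]|h1 h2].
    by apply: near; rewrite !ger0_norm; lra.
  by rewrite ler_pdivlMr ?subr_gt0// ler_pdivrMr ?subr_gt0// h1.
have {}yz' : y < z by rewrite lt_neqAle yz0.
have := au (m := v z - e) (M := v z + e) y0 (ltW yz') zT.
case/(_ _)/andP => [t /andP[yt tz]|h1 h2].
  by apply: near; rewrite !ler0_norm; lra.
have -> : (u y - u z) / (y - z) = (u z - u y) / (z - y).
  by rewrite -(opprB (u z)) -(opprB z y) invrN mulrNN.
by rewrite ler_pdivlMr ?subr_gt0// ler_pdivrMr ?subr_gt0// h1.
Qed.

Lemma derive_withinE z : 0 <= z <= T -> u' z = v z.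
Proof.
move=> zT; have PF := within_dnbhs_proper zT.
by apply/cvg_lim; [exact: Rhausdorff|exact: diff_quotient_cvg].
Qed.

Lemma ode_solution_intro :
  {ae mu, forall x, x \in `[0, T] -> a x * g (u x) = f x} ->
  ode_solution (fun x y => a x * g y) 0 T u.
Proof.
move=> aef; have T0' := T0; split.
- split=> [z|].
    rewrite /= in_itv/= => zT; apply/cvg_ex; exists (v z).
    exact: diff_quotient_cvg.
  apply/subspace_continuousP => z; rewrite /= in_itv/= => zT.
  apply/cvgrPdist_le => e e0; rewrite /from_subspace derive_withinE//.
  have [r r0 rP] := continuous_local z cv e0.
  exists r => //= y; rewrite /ball_/= distrC => yz; rewrite in_itv/= => yT.
  by rewrite derive_withinE// distrC; exact: rP.
- move=> e e0; have [dl dl0 H] := ac_integ 0 T sf e0.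
  exists dl => // n s t st tI std; apply: le_lt_trans (H n s t st tI std).
  apply: ler_sum => i _; have [h1 h2 h3] := st i.
  rewrite !derive_withinE ?h1 ?h3 ?(le_trans h1) ?(le_trans h2)//.
  rewrite vE// normrN (_ : integ f 0 (t i) - integ f 0 (s i) = integ f (s i) (t i))//.
  by rewrite (integ_chasles _ 0 (s i) (t i)); ring.
(* At 0 and T a two-sided derivative of u' would involve its values off [0, T], where it is not v;
   the two points are discarded as a null set. *)
- have ends : {ae mu, forall x, x != 0 /\ x != T}.
    have neg1 (y : R) : mu.-negligible [set y].
      by exists [set y]; split => //; exact: lebesgue_measure_set1.
    apply: (negligibleS _ (negligibleU (neg1 0) (neg1 T))).
    by move=> x /= /not_andP[|] /negP; rewrite negbK => /eqP ->; [left|right].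
  have aeFF := ae_filter_ringOfSetsType mu.
  move: aef; apply: filterS2 (filterI ends (summable_derive sf)) => x [[x0 xT] [df ef]] fx xI.
  have xI' : 0 < x < T.
    by move: xI; rewrite in_itv/= => /andP[? ?]; rewrite !lt_neqAle eq_sym x0 xT; apply/andP.
  have E : {near x, (cst (v 0) - integ f 0) =1 u'}.
    have : \forall y \near x, 0 < y < T.
      have xO : x \in `]0, T[ by rewrite in_itv.
      by have := near_in_itvoo xO; apply: filterS => y; rewrite in_itv.
    apply: filterS => y /andP[y0 yT].
    rewrite derive_withinE ?(ltW y0) ?ltW//.
    have h : v y - v 0 = - integ f 0 y by apply: vE => //; exact: ltW.
    by rewrite -[LHS]/(v 0 - integ f 0 y); lra.
  have dc : derivable (cst (v 0) : R -> R) x 1 by exact: derivable_cst.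
  have dN := derivableB dc df.
  split; first exact: near_eq_derivable dN.
  have -> : derive1 u' x = - f x.
    rewrite derive1E -[LHS](@near_eq_derive _ _ _ _ u' x 1 E).
    by rewrite (deriveB dc df) derive_cst sub0r -derive1E ef.
  by rewrite fx// addNr.
Qed.

End OdeSolution.

(** * A representative of the weight with pointwise signs *)

Section SignedWeight.
Context {R : realType}.
Variables (T : R) (a : R -> R) (m : nat) (alpha beta : 'I_m -> R).
Implicit Types (x y t : R).

Local Notation mu := (@lebesgue_measure R).

Hypothesis a_L1 : mu.-integrable `[0, T] (EFin \o a).
Hypothesis a_ge0 : forall i, {ae mu, forall x, x \in `[alpha i, beta i] -> 0 <= a x}.
Hypothesis a_le0 : {ae mu, forall x,
  (`[0, T] `\` \bigcup_i `[alpha i, beta i]%classic) x -> a x <= 0}.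

Let U := \bigcup_i `]alpha i, beta i[%classic.
Let F := \bigcup_i `[alpha i, beta i]%classic.
Let b := a \_ `[0, T].

(* A representative of a satisfying the sign conditions everywhere; it vanishes
   at the endpoints of the intervals, where both signs are required. *)
Definition signed_weight : R -> R :=
  (fun t => 2^-1 * (`|b t| + b t)) \_ U \+
  (fun t => 2^-1 * (b t + -1 * `|b t|)) \_ (~` F).

Let signed_weightE t : signed_weight t =
  (if t \in U then 2^-1 * (`|b t| + b t) else 0) +
  (if t \in ~` F then 2^-1 * (b t + -1 * `|b t|) else 0).
Proof. by []. Qed.

Let mU : measurable U.
Proof. by apply: fin_bigcup_measurable => // i _; exact: measurable_itv. Qed.

Let mF : measurable F.
Proof. by apply: fin_bigcup_measurable => // i _; exact: measurable_itv. Qed.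

Let summable_b : summable b.
Proof.
rewrite /summable /b -restrict_EFin.
exact: (iffLR (integrable_mkcond (mu := mu) (EFin \o a) (measurable_itv `[0, T])) a_L1).
Qed.

Lemma summable_restrict (f : R -> R) (A : set R) : measurable A -> summable f ->
  summable (f \_ A).
Proof.
move=> mA sf; rewrite /summable -restrict_EFin.
exact: (iffLR (integrable_mkcond (mu := mu) (EFin \o f) mA) (summableS mA sf)).
Qed.

Lemma signed_weight_summable : summable signed_weight.
Proof.
have sN := summable_norm summable_b.
apply: summableD; apply: summable_restrict => //.
- exact/summableZ/summableD.
- exact: measurableC.
- by apply/summableZ/summableD => //; exact: summableZ.
Qed.

Lemma signed_weight_out t : ~~ (0 <= t <= T) -> signed_weight t = 0.
Proof.
move=> tT; have bt : b t = 0.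
  by rewrite /b patchE ifF//; apply/negbTE; rewrite notin_setE/= in_itv/=; exact/negP.
by rewrite signed_weightE bt normr0 mulr0 !addr0 mulr0 !if_same addr0.
Qed.

Lemma signed_weight_ge0 i t : alpha i <= t <= beta i -> 0 <= signed_weight t.
Proof.
move=> ti; have Ft : F t by exists i => //=; rewrite in_itv.
rewrite signed_weightE [X in _ + X]ifF; last first.
  by apply/negbTE; rewrite notin_setE /=; exact.
rewrite addr0; case: ifP => // _.
have : - b t <= `|b t| by rewrite -normrN ler_norm.
lra.
Qed.

Lemma signed_weight_le0 t : (forall i, ~~ (alpha i < t < beta i)) ->
  signed_weight t <= 0.
Proof.
move=> ti; rewrite signed_weightE ifF; last first.
  by apply/negbTE; rewrite notin_setE /= => -[i _] /=; rewrite in_itv/=; exact/negP.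
rewrite add0r; case: ifP => // _.
have : b t <= `|b t| by exact: ler_norm.
lra.
Qed.

Lemma signed_weight_ae : {ae mu, forall t, t \in `[0, T] -> a t = signed_weight t}.
Proof.
have aeFF := ae_filter_ringOfSetsType mu.
have neg1 (y : R) : mu.-negligible [set y].
  by exists [set y]; split => //; exact: lebesgue_measure_set1.
have neq1 (y : R) : {ae mu, forall t, t != y}.
  by apply: negligibleS (neg1 y) => t /= /negP; rewrite negbK => /eqP.
have H1 : {ae mu, forall t, forall i, t \in `[alpha i, beta i] -> 0 <= a t}.
  exact: filter_forall.
have H2 : {ae mu, forall t, forall i, t != alpha i} by apply: filter_forall => i; exact: neq1.
have H3 : {ae mu, forall t, forall i, t != beta i} by apply: filter_forall => i; exact: neq1.
have H23 : {ae mu, forall t, (forall i, t != alpha i) /\ (forall i, t != beta i)}.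
  exact: (filterI H2 H3).
move: H1 H23 a_le0; apply: filterS3.
move=> t h1 [h2 h3] h4 tT.
have bt : b t = a t by rewrite /b patchE ifT// inE.
rewrite signed_weightE bt.
have [[i _ /= ti]|Ft] := pselect (F t).
  have at0 := h1 i ti; rewrite in_itv/= in ti.
  rewrite ifT; last first.
    rewrite inE; exists i => //=; rewrite in_itv/= !lt_neqAle eq_sym h2 h3/=.
    exact: ti.
  rewrite ifF; last first.
    by apply/negbTE; rewrite notin_setE /= => h; apply: h; exists i => //=; rewrite in_itv.
  by rewrite ger0_norm//; field.
have at0 : a t <= 0 by apply: h4; split.
rewrite ifF; last first.
  apply/negbTE; rewrite notin_setE /= => -[i _] /=; rewrite in_itv/= => /andP[l r].
  by apply: Ft; exists i => //=; rewrite in_itv/= !ltW.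
rewrite ifT; last by rewrite inE.
by rewrite ler0_norm//; field.
Qed.

Lemma signed_weight_integ : 0 <= T ->
  integ signed_weight 0 T = \int[mu]_(x in `[0, T]) a x.
Proof.
move=> T0; rewrite integ_itvcc//; last exact: signed_weight_summable.
rewrite /Rintegral; congr fine; apply: ae_eq_integral => //.
- by have /measurable_int := summableS (measurable_itv `[0, T]) signed_weight_summable.
- by have /measurable_int := a_L1.
- have := signed_weight_ae; apply: filterS; first exact: (ae_filter_ringOfSetsType mu).
  by move=> t /= h tT; rewrite h.
Qed.

End SignedWeight.

(** * A growth rate strictly above all the eigenvalues *)

Section Liminf.
Context {R : realType}.

Lemma liminf_separation (m : nat) (lam : 'I_m -> R) (h : R -> R) : (0 < m)%N ->
  (\big[maxe/-oo]_(i < m) (lam i)%:E <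
    limf_einf (fun s : R => (h s)%:E) (pinfty_nbhs R))%E ->
  exists k S : R, [/\ forall i, lam i < k, 0 < S & forall s, S <= s -> k <= h s].
Proof.
move=> m0; rewrite limf_einfE => /ereal_sup_gt[_ [V [N [_ NV]] <-]] lt.
set mx := \big[_/_]_(_ < _) _ in lt; set c := ereal_inf _ in lt.
have le_mx i : ((lam i)%:E <= mx)%E by exact: le_bigmax.
have [k kmx kc] : exists2 k : R, (mx < k%:E)%E & (k%:E <= c)%E.
  (* Since m > 0 the maximum is not -oo, and being below c it is finite; c itself may be +oo. *)
  move: lt; case: mx le_mx => [x||] le_mx; last 2 first.
  - by rewrite ltNge leey.
  - by have := le_mx (Ordinal m0); rewrite leeNy_eq.
  case: c => [y||] //; rewrite ?lte_fin => xy.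
    by exists ((x + y) / 2); rewrite ?lte_fin ?lee_fin; lra.
  by exists (x + 1); rewrite ?leey// lte_fin; lra.
exists k, (Num.max 1 (N + 1)); split.
- by move=> i; rewrite -lte_fin; exact: le_lt_trans (le_mx i) kmx.
- by rewrite lt_max ltr01.
- move=> s; rewrite ge_max => /andP[_ Ns]; rewrite -lee_fin; apply: (le_trans kc).
  by apply: ereal_inf_lbound; exists s => //; apply: NV; lra.
Qed.

End Liminf.

Theorem theorem3p2 (R : realType) (B : boundary_condition) (T : R) (hT : 0 < T)
    (g : R -> R)
    (g_cont : {within `[0, +oo[, continuous g})
    (g0 : g 0 = 0)
    (g_pos : forall s : R, 0 < s -> 0 < g s)
    (a : R -> R)
    (a_L1 : (@lebesgue_measure R).-integrable `[0, T] (EFin \o a))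
    (m : nat) (hm : (1 <= m)%N) (alpha beta : 'I_m -> R)
    (I_sub : forall i, `[alpha i, beta i] `<=` `[0, T])
    (I_disj : trivIset setT (fun i => `[alpha i, beta i]%classic))
    (a_ge0 : forall i, {ae (@lebesgue_measure R), forall x,
       x \in `[alpha i, beta i] -> 0 <= a x})
    (a_neq0 : forall i, ~ {ae (@lebesgue_measure R), forall x,
       x \in `[alpha i, beta i] -> a x = 0})
    (a_le0 : {ae (@lebesgue_measure R), forall x,
       (`[0, T] `\` \bigcup_i `[alpha i, beta i]%classic) x -> a x <= 0})
    (a_int : \int[@lebesgue_measure R]_(x in `[0, T]) a x < 0)
    (lambda1 : 'I_m -> R)
    (lambda1P : forall i,
       first_dirichlet_eigenvalue a (alpha i) (beta i) (lambda1 i))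
    (g_lim0 : g s / s @[s --> 0^'+] --> (0 : R))
    (g_liminf : (\big[maxe/-oo]_(i < m) (lambda1 i)%:E <
       limf_einf (fun s : R => (g s / s)%:E) (pinfty_nbhs R))%E)
    (g_C1 : exists2 eps0 : R, 0 < eps0 &
       continuously_differentiable_on `[0, eps0[ g) :
  exists u : R -> R, positive_solution B T a g u.
Proof.
have [k [S0 [lamk S00 gkS]]] := liminf_separation hm g_liminf.
pose b := signed_weight T a alpha beta.
have sb : summable b by exact: signed_weight_summable.
have bT t : ~~ (0 <= t <= T) -> b t = 0 by exact: signed_weight_out.
have b_ge0 i t : alpha i <= t <= beta i -> 0 <= b t by exact: signed_weight_ge0.
have aeb : {ae (@lebesgue_measure R), forall t, t \in `[0, T] -> a t = b t}.
  exact: signed_weight_ae.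
have b_int : integ b 0 T < 0 by rewrite signed_weight_integ// ltW.
have ex i : exists w : R * R * (R -> R) * (R -> R),
    nodal_domain b (alpha i) (beta i) (lambda1 i) w.1.1.1 w.1.1.2 w.1.2 w.2.
  have [ev _] := lambda1P i.
  have aebi : {ae (@lebesgue_measure R), forall t,
      t \in `[alpha i, beta i] -> a t = b t}.
    move: aeb; apply: filterS; first exact: (ae_filter_ringOfSetsType (@lebesgue_measure R)).
    by move=> t h ti; apply: h; exact: (I_sub i t ti).
  have [c [d [phi [psi nd]]]] := dirichlet_nodal_domain sb bT (@b_ge0 i) aebi ev.
  by exists (c, d, phi, psi).
have [w nd] := choice ex.
have ab i : alpha i < beta i by have [[]] := nd i.
have al0 i : 0 <= alpha i.
  have : `[0, T]%classic (alpha i) by apply: (I_sub i); rewrite /= in_itv/= lexx ltW.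
  by rewrite /= in_itv/= => /andP[].
have beT i : beta i <= T.
  have : `[0, T]%classic (beta i) by apply: (I_sub i); rewrite /= in_itv/= lexx ltW// ab.
  by rewrite /= in_itv/= => /andP[].
pose bound i := sturm_constant b (alpha i) (beta i) (lambda1 i)
  (w i).1.1.1 (w i).1.1.2 (w i).1.2 k (`|k| * S0).
(* The bounds involve only k, S0 and the eigenfunctions, hence are available before the truncation h
   is defined. *)
pose M := S0 + \sum_(i < m) `|bound i|.
have sum_ge0 : 0 <= \sum_(i < m) `|bound i| by apply: sumr_ge0 => *; exact: normr_ge0.
have S0M : S0 <= M by rewrite /M lerDl.
have boundM i : bound i <= M.
  rewrite /M (bigD1 i)//=; have := ler_norm (bound i).
  have : 0 <= \sum_(j < m | j != i) `|bound j| by apply: sumr_ge0 => *; exact: normr_ge0.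
  lra.
have gk s : S0 <= s -> k * s <= g s.
  move=> S0s; have s0 : 0 < s by exact: lt_le_trans S0s.
  by rewrite -ler_pdivlMr//; exact: gkS.
pose h := growth_cut g M.
have ch : continuous h by exact: (growth_cut_continuous g_cont S00 S0M).
have h_ge0 s : 0 <= h s by exact: (growth_cut_ge0 g0 g_pos S00 S0M).
have h_gt0 s : 0 < s -> 0 < h s.
  by move=> s0; exact: (growth_cut_gt0 g_pos S00 S0M s0).
have h_neg s : s <= 0 -> h s = 0.
  by move=> s0; exact: (growth_cut_neg g0 S00 S0M s0).
have [C [C0 hC]] : exists C : R, 0 <= C /\ forall s, `|h s| <= C * `|s|.
  exact: (growth_cut_linear g_cont g0 g_pos g_lim0 g_C1 S00 S0M).
have h_flat e : 0 < e -> exists2 d : R, 0 < d & forall s t, `|s| <= d ->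
    `|t| <= d -> `|h s - h t| <= e * `|s - t|.
  by move=> e0; exact: (growth_cut_flat g0 g_pos g_lim0 g_C1 S00 S0M e0).
have hk s : 0 <= s -> k * s - `|k| * S0 <= h s.
  by move=> s0; exact: (growth_cut_lower g0 g_pos S00 S0M gk s0).
(* A single interval suffices to solve the truncated problem; all of them enter in [uM], which
   removes the truncation. *)
pose i0 := Ordinal hm.
have [u [v [suv u_gt0 bc]]] : exists u v, [/\ solution T C b h u v,
    forall x, 0 <= x <= T -> 0 < u x &
    match B with Neumann => v 0 = 0 /\ v T = 0
               | Periodic => u T = u 0 /\ v T = v 0 end].
  case: B.
    have [u [v [? ? ? ?]]] := neumann_truncated hT C0 sb bT b_int ch hC h_ge0 h_gt0
      h_neg h_flat (al0 i0) (beT i0) (@b_ge0 i0) (nd i0) (lamk i0) hk.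
    by exists u, v.
  have [u [v [? ? ? ?]]] := periodic_truncated hT C0 sb bT b_int ch hC h_ge0 h_gt0
    h_neg h_flat (al0 i0) (beT i0) (@b_ge0 i0) (nd i0) (lamk i0) hk.
  by exists u, v.
have [cu cv vE au _] := suv.
have uM x : 0 <= x <= T -> u x <= M.
  apply: (@max_on_intervals R T C b h hT sb bT ch h_ge0 m alpha beta i0 al0 beT ab _ u v M suv).
  - by move=> t; exact: signed_weight_le0.
  - by case: B bc => bc; [left|right].
  - move=> i y yi; apply: le_trans (boundM i).
    apply: (sturm_bound sb bT ch h_ge0 (al0 i) (ab i) (beT i) (@b_ge0 i) suv _
      (nd i) (lamk i) hk yi) => t /andP[t1 t2].
    by apply/ltW/u_gt0; rewrite (le_trans (al0 i))// (le_trans t2).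
have hu : continuous (h \o u).
  by move=> t; apply: continuous_comp; [exact: cu|exact: ch].
have sbh := summable_weight sb bT hu.
have aebh : {ae (@lebesgue_measure R), forall x, x \in `[0, T] ->
    a x * g (u x) = b x * h (u x)}.
  move: aeb; apply: filterS; first exact: (ae_filter_ringOfSetsType (@lebesgue_measure R)).
  move=> t abt tT; rewrite abt// /h growth_cut_in//.
  by rewrite uM ?andbT; [apply/ltW/u_gt0|]; rewrite in_itv in tT.
exists u; split.
- exact: (ode_solution_intro hT sbh cv au vE aebh).
- have z0 : 0 <= (0 : R) <= T by rewrite lexx ltW.
  have zT : 0 <= T <= T by rewrite lexx ltW.
  case: B bc => -[bc1 bc2]; rewrite /= !(derive_withinE hT cv au)// bc1 bc2//.
  by rewrite !subrr.
- by move=> x; rewrite in_itv/=; exact: u_gt0.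
Qed.
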